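(* Let $\Sigma$ be a compact Riemann surface of genus $2$ whose period matrix satisfies $$\Omega_{22}=N_1\Omega_{11}+N_2\Omega_{12}+N_3,\qquad N_1=MN_2+M^2,$$ with $M,N_2,N_3\in\mathbb{Q}$. (+) Assume $M\neq0$ and let $$\Gamma^{(+)}=\Big\{(k,j)\in\mathbb{Z}^2 : \Big(\tfrac{k}{M},\,(N_2+M)j+\tfrac{N_3k}{M}\Big)\in\mathbb{Z}^2\Big\}.$$ Let $(n_1,m_1),(n_1',m_1')\in\Gamma^{(+)}$ with $(n_1,m_1)\ne(0,0)$, and set $n_2=\frac{n_1}{M}$, $m_2=(N_2+M)m_1+\frac{N_3n_1}{M}$, $n_2'=\frac{n_1'}{M}$, $m_2'=(N_2+M)m_1'+\frac{N_3n_1'}{M}$. Then $\omega_{n',m'}=c\,\omega_{n,m}$ for some $c\in\mathbb{C}$, and $\Delta_{g^{n,m}}h_{n',m'}=\lambda_c^{(+)}h_{n',m'}$ with $$\lambda_c^{(+)}=2A_{n,m}\frac{\left|Mm_1'-n_1'(M\Omega_{11}+\Omega_{12})\right|^2}{\left|Mm_1-n_1(M\Omega_{11}+\Omega_{12})\right|^2}.$$ (−) Assume $N_2+M\neq0$ and let $$\Gamma^{(-)}=\Big\{(k,j)\in\mathbb{Z}^2 : \Big(\tfrac{k}{N_2+M},\,Mj+\tfrac{N_3k}{N_2+M}\Big)\in\mathbb{Z}^2\Big\}.$$ Let $(n_1,m_1),(n_1',m_1')\in\Gamma^{(-)}$ with $(n_1,m_1)\neq(0,0)$, and set $n_2=-\frac{n_1}{N_2+M}$,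 $m_2=-Mm_1-\frac{N_3n_1}{N_2+M}$, $n_2'=-\frac{n_1'}{N_2+M}$, $m_2'=-Mm_1'-\frac{N_3n_1'}{N_2+M}$. Then $\omega_{n',m'}=c\,\omega_{n,m}$ for some $c\in\mathbb{C}$, and $\Delta_{g^{n,m}}h_{n',m'}=\lambda_c^{(-)}h_{n',m'}$ with $$\lambda_c^{(-)}=2A_{n,m}\frac{\left|(N_2+M)m_1'-n_1'\left[(N_2+M)\Omega_{11}-\Omega_{12}\right]\right|^2}{\left|(N_2+M)m_1-n_1\left[(N_2+M)\Omega_{11}-\Omega_{12}\right]\right|^2}.$$
   Context: Let $\alpha_1,\alpha_2,\beta_1,\beta_2$ be a symplectic basis of $H_1(\Sigma,\mathbb{Z})$. Let $\omega_1,\omega_2$ be the basis of holomorphic one-differentials with $\oint_{\alpha_j}\omega_k=\delta_{jk}$. Set $\Omega_{jk}=\oint_{\beta_j}\omega_k$ (symmetric) and $\Omega^{(2)}=\operatorname{Im}\Omega$. For $n=(n_1,n_2)$ and $m=(m_1,m_2)$ in $\mathbb{Z}^2$ define $$\omega_{n,m}=\sum_{k=1}^2c_{n,m;k}\,\omega_k,\qquad c_{n,m;k}=\pi\sum_{j=1}^2\Big(m_j-\sum_{l=1}^2n_l\overline{\Omega}_{lj}\Big)\big((\Omega^{(2)})^{-1}\big)_{jk},$$ and similarly $\omega_{n',m'}$ for $n'=(n_1',n_2')$, $m'=(m_1',m_2')$. For fixed $z_0\in\Sigma$ set $$h_{n,m}(z)=e^{\int_{z_0}^z\omega_{n,m}-\overline{\int_{z_0}^z\omega_{n,m}}}$$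 (single-valued on $\Sigma$), and $$A_{n,m}=\frac{i}{4}\int_\Sigma\omega_{n,m}\wedge\overline{\omega}_{n,m}.$$ For $(n,m)\neq(0,0)$, with $\omega_{n,m}=h(z)\,dz$ in a local coordinate, the Laplacian of the normalized flat metric proportional to $|\omega_{n,m}|^2$ is $$\Delta_{g^{n,m}}=-2A_{n,m}|h(z)|^{-2}\partial_z\partial_{\bar z},$$ considered away from the zeros of $\omega_{n,m}$. *)

(* Defs.v *)
(* The complex numbers are [R[i]]; [R[i]^o] is [R[i]] as a normed module over
   itself. *)
From HB Require Import structures.
From mathcomp Require Import all_boot all_order all_algebra.
From mathcomp Require Import all_classical all_reals all_analysis.
From mathcomp Require Import complex.
Set Implicit Arguments.
Unset Strict Implicit.
Unset Printing Implicit Defensive.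
Import Order.TTheory GRing.Theory Num.Theory.
Import numFieldNormedType.Exports.
Local Open Scope classical_set_scope.
Local Open Scope ring_scope.
Local Open Scope complex_scope.

Definition holomorphic_at (R : realType) (f : R[i] -> R[i]) (z : R[i]) : Prop :=
  derivable (f : R[i]^o -> R[i]^o) z 1.

Definition cderiv (R : realType) (f : R[i] -> R[i]) (z : R[i]) : R[i] :=
  'D_1 (f : R[i]^o -> R[i]^o) z.

Definition cexp (R : realType) (z : R[i]) : R[i] :=
  (expR (complex.Re z))%:C * (cos (complex.Im z) +i* sin (complex.Im z)).

(* Derivative of a complex-valued function of a real variable. *)
Definition Dt_ex (R : realType) (g : R -> R[i]) (t : R) : Prop :=
  derivable (fun s => complex.Re (g s) : R) t 1 /\
  derivable (fun s => complex.Im (g s) : R) t 1.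

Definition Dt (R : realType) (g : R -> R[i]) (t : R) : R[i] :=
  'D_1 (fun s => complex.Re (g s) : R) t +i*
  'D_1 (fun s => complex.Im (g s) : R) t.

(* Wirtinger operators for [f] viewed as a function of [x + i y]. *)
Definition xline (R : realType) (f : R[i] -> R[i]) (z : R[i]) : R -> R[i] :=
  fun t => f (z + t%:C).

Definition yline (R : realType) (f : R[i] -> R[i]) (z : R[i]) : R -> R[i] :=
  fun t => f (z + 'i%C * t%:C).

Definition partials_ex (R : realType) (f : R[i] -> R[i]) (z : R[i]) : Prop :=
  Dt_ex (xline f z) 0 /\ Dt_ex (yline f z) 0.

Definition d_z (R : realType) (f : R[i] -> R[i]) (z : R[i]) : R[i] :=
  (Dt (xline f z) 0 - 'i%C * Dt (yline f z) 0) / 2.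

Definition d_zbar (R : realType) (f : R[i] -> R[i]) (z : R[i]) : R[i] :=
  (Dt (xline f z) 0 + 'i%C * Dt (yline f z) 0) / 2.

(* A holomorphic atlas on [T].  [param i] is only meaningful on the open set
   [zcoord i @` dom i], where it inverts [zcoord i].  Hausdorffness, compactness
   and connectedness of [T] are separate hypotheses. *)
Record riemann_surface (R : realType) (T : topologicalType) := RiemannSurface {
  chart : Type;
  dom : chart -> set T;
  zcoord : chart -> T -> R[i];
  param : chart -> R[i] -> T;
  chart_at : T -> chart;
  dom_chart_at : forall p, dom (chart_at p) p;
  dom_open : forall i, open (dom i);
  image_open : forall i, open (zcoord i @` dom i : set R[i]^o);
  zcoordK : forall i p, dom i p -> param i (zcoord i p) = p;
  zcoord_continuous : forall i p, dom i p ->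
    {for p, continuous (zcoord i : T -> R[i]^o)};
  param_continuous : forall i p, dom i p ->
    {for zcoord i p, continuous (param i : R[i]^o -> T)};
  transition_holomorphic : forall i j p, dom i p -> dom j p ->
    holomorphic_at (zcoord j \o param i) (zcoord i p)
}.

Section Surface.
Variables (R : realType) (T : topologicalType) (S : riemann_surface R T).

(* The one-form [w i z dz] in the chart [i]; values of [w i] outside
   [zcoord i @` dom i] carry no meaning. *)
Definition one_form : Type := chart S -> R[i] -> R[i].

Definition holo_form (w : one_form) : Prop :=
  (forall i p, dom i p -> holomorphic_at (w i) (zcoord i p)) /\
  (forall i j p, dom i p -> dom j p ->
     w i (zcoord i p) =
     w j (zcoord j p) * cderiv (zcoord j \o param i) (zcoord i p)).

Definition holo_basis (g : nat) (w : 'I_g -> one_form) : Prop :=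
  (forall k, holo_form (w k)) /\
  (forall eta, holo_form eta ->
     exists! c : 'rV[R[i]]_g, forall i p, dom i p ->
       eta i (zcoord i p) = \sum_k c 0 k * w k i (zcoord i p)).

(* C^1 maps from [V = R] or [V = R * R], i.e. all directional derivatives exist
   and are continuous in every chart. *)
Definition C1map (V : normedModType R) (f : V -> T) : Prop :=
  continuous f /\
  forall (i : chart S) x, dom i (f x) -> forall v : V,
    let u := fun y => complex.Re (zcoord i (f y)) : R in
    let u' := fun y => complex.Im (zcoord i (f y)) : R in
    [/\ derivable u x v, derivable u' x v,
        {for x, continuous ('D_v u)} & {for x, continuous ('D_v u')}].

(* The integrand does not depend on the chart containing [g t]. *)
Definition pullback (w : one_form) (g : R -> T) (t : R) : R[i] :=
  let i := chart_at S (g t) in w i (zcoord i (g t)) * Dt (zcoord i \o g) t.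

Definition path_integral (w : one_form) (g : R -> T) : R[i] :=
  (\int[lebesgue_measure]_(t in `[0%R, 1%R]) complex.Re (pullback w g t)) +i*
  (\int[lebesgue_measure]_(t in `[0%R, 1%R]) complex.Im (pullback w g t)).

(* C^1 singular homology.  A singular 1-simplex is the restriction to [0, 1] of
   a C^1 map on R; a singular 2-simplex is the restriction to the triangle with
   vertices (0,0), (1,0), (0,1) of a C^1 map on R * R.  [coef c] is the actual
   element of the free abelian group on 1-simplices represented by the list [c],
   so that only the restrictions to [0, 1] matter. *)
Definition chain1 : Type := seq (int * (R -> T)).
Definition chain2 : Type := seq (int * (R * R -> T)).

Fixpoint all_C1 (V : normedModType R) (c : seq (int * (V -> T))) : Prop :=
  if c is x :: c' then C1map x.2 /\ all_C1 c' else True.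

Definition coef (c : chain1) (g : R -> T) : int :=
  \sum_(x <- c)
    (if `[< forall t, 0 <= t <= 1 -> x.2 t = g t >] then x.1 else 0).

Definition boundary1 (c : chain1) (p : T) : int :=
  \sum_(x <- c) ((if `[< x.2 1 = p >] then x.1 else 0)
                 - (if `[< x.2 0 = p >] then x.1 else 0)).

Definition faces (x : int * (R * R -> T)) : chain1 :=
  [:: (x.1, fun t => x.2 (1 - t, t));
      (- x.1, fun t => x.2 (0, t));
      (x.1, fun t => x.2 (t, 0))].

Definition boundary2 (c : chain2) : chain1 := flatten [seq faces x | x <- c].

Definition cycle1 (c : chain1) : Prop :=
  all_C1 c /\ forall p, boundary1 c p = 0.

Definition homologous (c c' : chain1) : Prop :=
  exists2 d : chain2, all_C1 d &
    forall g, coef c g - coef c' g = coef (boundary2 d) g.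

Definition lincomb (r : nat) (k : 'rV[int]_r) (B : 'I_r -> chain1) : chain1 :=
  flatten [seq [seq (k 0 i * x.1, x.2) | x <- B i] | i <- enum 'I_r].

(* The classes of the cycles [B i] form a Z-basis of H_1. *)
Definition H1_basis (r : nat) (B : 'I_r -> chain1) : Prop :=
  (forall i, cycle1 (B i)) /\
  (forall c, cycle1 c -> exists! k : 'rV[int]_r, homologous c (lincomb k B)).

Definition has_genus (g : nat) : Prop :=
  exists B : 'I_(g + g) -> chain1, H1_basis B.

(* Intersection numbers: signed count of the crossings of transverse closed C^1
   curves representing the two classes.  A crossing of velocities [u], [v] counts
   positively when [(u, v)] is positively oriented, i.e. the imaginary part of
   [conjc u * v] is positive. *)
Definition closed_curve (g : R -> T) : Prop :=
  C1map g /\ forall t, g (t + 1) = g t.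

Definition crossings (g g' : R -> T) : set (R * R) :=
  [set st | [/\ 0 <= st.1 < 1, 0 <= st.2 < 1 & g st.1 = g' st.2]].

Definition crossing_sign (g g' : R -> T) (st : R * R) : int :=
  let i := chart_at S (g st.1) in
  sgz (complex.Im (conjc (Dt (zcoord i \o g) st.1) * Dt (zcoord i \o g') st.2)).

Definition transverse (g g' : R -> T) : Prop :=
  finite_set (crossings g g') /\
  forall st, crossings g g' st -> crossing_sign g g' st != 0.

Definition intersection_number (a b : chain1) (k : int) : Prop :=
  exists g g' : R -> T,
    [/\ closed_curve g /\ homologous a [:: (1, g)],
        closed_curve g' /\ homologous b [:: (1, g')],
        transverse g g' &
        k = \sum_(st \in crossings g g') crossing_sign g g' st].

Definition symplectic_basis (g : nat) (a b : 'I_g -> chain1) : Prop :=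
  H1_basis (fun i : 'I_(g + g) =>
    match fintype.split i with inl j => a j | inr j => b j end) /\
  forall j k,
    [/\ intersection_number (a j) (a k) 0,
        intersection_number (b j) (b k) 0 &
        intersection_number (a j) (b k) (j == k)%:R].

Definition period (w : one_form) (c : chain1) : R[i] :=
  \sum_(x <- c) x.1%:~R * path_integral w x.2.

Definition period_matrix (g : nat) (w : 'I_g -> one_form)
    (b : 'I_g -> chain1) : 'M[R[i]]_g :=
  \matrix_(j, k) period (w k) (b j).

(* Piecewise C^1 paths, as lists of consecutive C^1 arcs on [0, 1]. *)
Fixpoint joins (p : T) (s : seq (R -> T)) (q : T) : Prop :=
  if s is g :: s' then [/\ C1map g, g 0 = p & joins (g 1) s' q] else p = q.

(* The integral of [w] along an arbitrarily chosen piecewise C^1 path from [p]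
   to [q]; another choice changes it by a period of [w]. *)
Definition integral_from (w : one_form) (p q : T) : R[i] :=
  \sum_(g <- xget [::] [set s | joins p s q]) path_integral w g.

(* The integral over the surface of the two-form [e i z dz /\ d zbar], with
   [dz /\ d zbar = -2i dx /\ dy]: the surface is cut into finitely many Borel
   pieces, each lying in a chart, the choice of pieces being immaterial. *)
Definition cell : Type := (chart S * set (R * R))%type.

Definition in_cell (x : cell) (p : T) : Prop :=
  dom x.1 p /\ x.2 (complex.Re (zcoord x.1 p), complex.Im (zcoord x.1 p)).

Fixpoint good_cells (s : seq cell) : Prop :=
  if s is x :: s' then
    [/\ measurable x.2,
        forall q, x.2 q -> (zcoord x.1 @` dom x.1) (q.1 +i* q.2) &
        good_cells s']
  else True.

Definition cell_decomposition (s : seq cell) : Prop :=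
  good_cells s /\ forall p, (\sum_(x <- s) `[< in_cell x p >] = 1)%N.

Definition cell_integral (e : chart S -> R[i] -> R[i]) (x : cell) : R[i] :=
  let mu := (@lebesgue_measure R \x @lebesgue_measure R)%E in
  let F q := -2%:R * 'i%C * e x.1 (q.1 +i* q.2) in
  (\int[mu]_(q in x.2) complex.Re (F q)) +i*
  (\int[mu]_(q in x.2) complex.Im (F q)).

Definition surface_integral (e : chart S -> R[i] -> R[i]) : R[i] :=
  xget 0 [set v | exists2 s, cell_decomposition s &
                             v = \sum_(x <- s) cell_integral e x].

Definition area (w : one_form) : R[i] :=
  'i%C / 4%:R * surface_integral (fun i z => w i z * conjc (w i z)).

Definition c_nm (Om : 'M[R[i]]_2) (n m : 'rV[int]_2) (k : 'I_2) : R[i] :=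
  pi%:C * \sum_j ((m 0 j)%:~R - \sum_l (n 0 l)%:~R * conjc (Om l j))
                 * (invmx (map_mx (@complex.Im R) Om) j k)%:C.

Definition omega_nm (w : 'I_2 -> one_form) (Om : 'M[R[i]]_2)
    (n m : 'rV[int]_2) : one_form :=
  fun i z => \sum_k c_nm Om n m k * w k i z.

Definition h_fun (w : one_form) (z0 z : T) : R[i] :=
  cexp (integral_from w z0 z - conjc (integral_from w z0 z)).

Definition proportional (w' w : one_form) (c : R[i]) : Prop :=
  forall i p, dom i p -> w' i (zcoord i p) = c * w i (zcoord i p).

(* The Laplacian of the normalized metric of [w], in the chart [i]. *)
Definition laplacian (w : one_form) (i : chart S) (f : R[i] -> R[i])
    (z : R[i]) : R[i] :=
  -2%:R * area w * `|w i z| ^- 2 * d_z (d_zbar f) z.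

(* The derivatives entering the Laplacian are required to exist, as [Dt] has a
   default value otherwise. *)
Definition laplacian_eigen (w : one_form) (h : T -> R[i])
    (lambda : R[i]) : Prop :=
  forall i p, dom i p -> w i (zcoord i p) != 0 ->
    let f := h \o param i in
    [/\ \forall z \near (zcoord i p : R[i]^o), partials_ex f z,
        partials_ex (d_zbar f) (zcoord i p) &
        laplacian w i f (zcoord i p) = lambda * h p].

End Surface.

Definition Gamma_plus (M N2 N3 : rat) : set (int * int) :=
  [set kj | kj.1%:~R / M \is a Num.int /\
            (N2 + M) * kj.2%:~R + N3 * kj.1%:~R / M \is a Num.int].

Definition Gamma_minus (M N2 N3 : rat) : set (int * int) :=
  [set kj | kj.1%:~R / (N2 + M) \is a Num.int /\
            M * kj.2%:~R + N3 * kj.1%:~R / (N2 + M) \is a Num.int].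

(* Main.v *)
Require Import Defs.
From HB Require Import structures.
From mathcomp Require Import all_boot all_order all_algebra.
From mathcomp Require Import all_classical all_reals all_analysis.
From mathcomp Require Import complex.
From mathcomp Require Import measurable_realfun ring lra.

(* Write v_j = m_j - sum_l n_l conj(Om_lj), so that the coefficients of
   omega_nm are pi v (Im Om)^-1.  On the lattices of the theorem v is
   proportional to a fixed vector, (1, N2 + M) in (+) and (1, - M) in (-), and
   its first entry is a rational multiple of the conjugate of the denominator
   of lambda; hence omega_n'm' = c omega_nm with |c|^2 the quotient in lambda.
   Locally h_n'm' = K exp(F - conj F) with F' = omega_n'm', whence
   d_z d_zbar h = - |omega_n'm'|^2 h, and the area of omega_nm never has to be
   computed.

   Two global facts are needed.  First, h_n'm' is single-valued: the periods of
   omega_n'm' have imaginary part in pi Z, and the integral of a holomorphic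
   form over a cycle depends only on its homology class.  Secondly, Im Om is
   invertible, and then the denominators do not vanish: a real kernel vector
   would give a holomorphic form with real periods, the imaginary part of whose
   integral is a harmonic function on a compact connected surface, hence
   constant, so that the form, and thus the vector, would vanish.

   Holomorphy being complex differentiability, both facts rest on Goursat's
   theorem.  Its bisection argument, stated for an abstract additive function of
   triangles, also gives the vanishing of the integral over the boundary of a
   C^1 simplex. *)
Import Order.TTheory GRing.Theory Num.Theory.
Import numFieldNormedType.Exports.
Local Open Scope classical_set_scope.
Local Open Scope ring_scope.
Local Open Scope complex_scope.
Set Implicit Arguments.
Unset Strict Implicit.
Unset Printing Implicit Defensive.

(** The relation [N1 = M * N2 + M ^+ 2] says that s^2 + N2 s = N1 has the rational roots s = M and s
    = - (N2 + M); the two lattices belong to the two roots. With n_2 = n_1 / s, the coefficients of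
    conj(Om_11) and conj(Om_12) in v_2 are N2 + s times those in v_1 exactly because of this
    equation, and the formula for m_2 makes the remaining rational terms match. The same equation
    makes both entries of (s, 1) Im Om multiples of s Im Om_11 + Im Om_12, which is how a vanishing
    denominator would yield a kernel vector. The analytic half is shaped by the fact that neither
    forms nor transition maps come with a continuous derivative, while [C1map] demands continuous
    velocities in every chart; hence Cauchy's formula is needed even to build short arcs. Moreover
    [integral_from] picks its paths arbitrarily, so local statements about it hold only modulo
    periods, and smooth functions appear only after passing to the imaginary part (real periods) or
    to the exponential. *)

Lemma slope_errorE (K : fieldType) (a h l : K) : h != 0 ->
  - ((l - h^-1 * a) * h) = a - h * l.
Proof. by move=> h0; field. Qed.

Definition approx (K : numFieldType) (f : K -> K) (z l e y : K) : bool :=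
  `|f y - f z - (y - z) * l| <= e * `|y - z|.

(** Multiplying the difference quotient by the increment turns its limit into an error bound free of
    division. The bound is trivial at [y = z], so a full neighbourhood replaces the punctured
    one. *)
Lemma derive1_epsP (K : numFieldType) (f : K^o -> K^o) (z l : K) :
  (derivable f z 1 /\ 'D_1 f z = l) <->
  (forall e : K, 0 < e -> \forall y \near (z : K^o), approx f z l e y).
Proof.
split=> [[df <-] e e0|H].
  have := df; rewrite /derivable => /cvgrPdist_lt /(_ e e0).
  rewrite -/('D_1 f z) => /nbhs_ballP[d /= d0 dP].
  apply/nbhs_ballP; exists d => //= y; rewrite /ball /= => yd.
  rewrite /approx; have [->|yz] := eqVneq y z.
    by rewrite !subrr mul0r subr0 normr0 mulr0.
  have yz0 : y - z != 0 by rewrite subr_eq0.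
  have := dP (y - z); rewrite /ball /= sub0r opprB => /(_ yd yz0).
  rewrite /= scaler1 subrK => /ltW H.
  have H' : `|('D_1 f z : K) - (y - z)^-1 * (f y - f z)| <= e := H.
  have := ler_wpM2r (normr_ge0 (y - z)) H'; rewrite -normrM -[X in X <= _]normrN.
  by congr (`|_| <= _); exact: slope_errorE.
suff : h^-1 *: ((f \o shift z) (h *: 1) - f z) @[h --> (0 : K^o)^'] --> (l : K^o).
  by move=> h; split; [apply/cvg_ex; exists l | exact: cvg_lim h].
apply/cvgrPdist_le => e e0; have /nbhs_ballP[d /= d0 dP] := H e e0.
apply/nbhs_ballP; exists d => //= h; rewrite /ball /= sub0r normrN => hd h0.
have := dP (h + z); rewrite /ball /= opprD addrCA subrr addr0 normrN => /(_ hd).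
rewrite /approx addrK scaler1 => H1.
have h_gt0 : 0 < `|h| by rewrite normr_gt0.
suff : `|l - h^-1 * (f (h + z) - f z : K)| <= e by [].
rewrite -(ler_pM2r h_gt0) -normrM -[X in X <= _]normrN; apply: le_trans H1.
by rewrite le_eqVlt; apply/orP; left; apply/eqP; congr `|_|; exact: slope_errorE.
Qed.

(** * Calculus of complex-valued functions *)

Section ComplexNorm.
Variable R : realType.
Local Notation C := R[i].
Implicit Types (z w : C) (x : R).

(** The norm of [R[i]] takes values in [R[i]]; its real part lives in the ordered field [R], where
    [lra] applies. *)
Definition nrm z : R := complex.Re `|z|.

Lemma normE z : `|z| = (nrm z)%:C.
Proof. by []. Qed.

Lemma nrm_ge0 z : 0 <= nrm z.
Proof. by rewrite -lecR -normE normr_ge0. Qed.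

Lemma nrm0 : nrm 0 = 0.
Proof. by apply: complexI; rewrite -normE normr0. Qed.

Lemma nrmN z : nrm (- z) = nrm z.
Proof. by apply: complexI; rewrite -!normE normrN. Qed.

Lemma nrmB z w : nrm (z - w) = nrm (w - z).
Proof. by rewrite -nrmN opprB. Qed.

Lemma nrmM z w : nrm (z * w) = nrm z * nrm w.
Proof. by apply: complexI; rewrite rmorphM -!normE normrM. Qed.

Lemma nrmD z w : nrm (z + w) <= nrm z + nrm w.
Proof. by rewrite -lecR rmorphD -!normE ler_normD. Qed.

Lemma nrm_tri z w u : nrm (z - w) <= nrm (z - u) + nrm (u - w).
Proof. by rewrite -{1}(subrKA u z); exact: nrmD. Qed.

Lemma nrm_eq0 z : (nrm z == 0) = (z == 0).
Proof. by rewrite -[RHS]normr_eq0 normE -(rmorph0 (real_complex R)) (inj_eq (@complexI R)). Qed.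

Lemma nrm_gt0 z : (0 < nrm z) = (z != 0).
Proof. by rewrite lt_def nrm_ge0 andbT nrm_eq0. Qed.

Lemma nrmR x : nrm x%:C = `|x|.
Proof. by rewrite /nrm normc_def /= expr0n /= addr0 sqrtr_sqr. Qed.

Lemma nrm1 : nrm 1 = 1.
Proof. by rewrite -(rmorph1 (real_complex R)) nrmR normr1. Qed.

Lemma nrm_i : nrm 'i = 1.
Proof. by rewrite /nrm normc_def /= expr0n /= add0r expr1n sqrtr1. Qed.

Lemma nrmV z : nrm z^-1 = (nrm z)^-1.
Proof. by apply: complexI; rewrite fmorphV -!normE normfV. Qed.
End ComplexNorm.

(** * Continuity of complex-valued functions in epsilon form *)

Section EpsilonCalculus.
Variable R : realType.
Local Notation C := R[i].

Lemma nbhs_complexP (z : C) (P : set C) :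
  (\forall w \near (z : C^o), P w) <->
  exists2 d : R, 0 < d & forall w, nrm (w - z) < d -> P w.
Proof.
split.
  move=> /nbhs_ballP[d /= d0 dP].
  have dE : d = (complex.Re d)%:C.
    by move: d0; rewrite ltcE => /andP[/eqP]; case: (d) => a b /= ->.
  exists (complex.Re d) => [|w wd]; first by rewrite -ltcR -dE.
  by apply: dP; rewrite /ball /= normE dE ltcR nrmB.
move=> [d d0 dP]; apply/nbhs_ballP; exists d%:C; first by rewrite /= ltcR.
by move=> w; rewrite /ball /= normE ltcR nrmB; exact: dP.
Qed.

Definition ccont (X : topologicalType) (f : X -> C) (x : X) :=
  forall e : R, 0 < e -> \forall y \near x, nrm (f y - f x) < e.

Lemma ccontP (X : topologicalType) (f : X -> C) (x : X) :
  {for x, continuous (f : X -> C^o)} <-> ccont f x.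
Proof.
split=> [cf e e0|cf P].
  have : nbhs (f x : C^o) [set w | nrm (w - f x) < e].
    by apply/nbhs_complexP; exists e.
  by move=> /cf.
by move=> /nbhs_complexP[d d0 dP]; near=> y; apply: dP; near: y; exact: cf.
Unshelve. all: by end_near. Qed.

Lemma Re_le_nrm (z : C) : `|complex.Re z| <= nrm z.
Proof.
rewrite /nrm normc_def /= -sqrtr_sqr ler_sqrt ?lerDl ?sqr_ge0 //.
by rewrite addr_ge0 ?sqr_ge0.
Qed.

Lemma Im_le_nrm (z : C) : `|complex.Im z| <= nrm z.
Proof.
rewrite /nrm normc_def /= -sqrtr_sqr ler_sqrt ?lerDr ?sqr_ge0 //.
by rewrite addr_ge0 ?sqr_ge0.
Qed.

Lemma nrm_le_ReIm (z : C) : nrm z <= `|complex.Re z| + `|complex.Im z|.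
Proof.
rewrite {1}[z]complexE (le_trans (nrmD _ _)) // nrmM nrm_i mul1r.
by rewrite !nrmR.
Qed.

Lemma ccont_near (X : topologicalType) (f g : X -> C) (x : X) :
  (\forall y \near x, f y = g y) -> ccont f x -> ccont g x.
Proof.
move=> fg cf e e0; near=> y.
rewrite -(near fg y) // -(nbhs_singleton fg); near: y; exact: cf.
Unshelve. all: by end_near. Qed.

Lemma ccont_cst (X : topologicalType) (c : C) (x : X) : ccont (fun=> c) x.
Proof. by move=> e e0; near=> y; rewrite subrr nrm0. Unshelve. all: by end_near. Qed.

Lemma ccont_id (z : C) : ccont (id : (C^o : topologicalType) -> C) z.
Proof. by move=> e e0; apply/nbhs_complexP; exists e. Qed.

Lemma ccontD (X : topologicalType) (f g : X -> C) (x : X) :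
  ccont f x -> ccont g x -> ccont (fun y => f y + g y) x.
Proof.
move=> cf cg e e0; have e2 : 0 < e / 2 by rewrite divr_gt0.
near=> y; have -> : f y + g y - (f x + g x) = (f y - f x) + (g y - g x) by ring.
rewrite (le_lt_trans (nrmD _ _)) //.
have : nrm (f y - f x) < e / 2 by near: y; exact: cf.
have : nrm (g y - g x) < e / 2 by near: y; exact: cg.
lra.
Unshelve. all: by end_near. Qed.

Lemma ccontM (X : topologicalType) (f g : X -> C) (x : X) :
  ccont f x -> ccont g x -> ccont (fun y => f y * g y) x.
Proof.
move=> cf cg e e0.
pose a := nrm (f x) + 1; pose b := nrm (g x) + 1.
have a0 : 0 < a by rewrite ltr_wpDl ?nrm_ge0.
have b0 : 0 < b by rewrite ltr_wpDl ?nrm_ge0.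
pose ea := e / (2 * b); pose eb := e / (2 * a).
have ea0 : 0 < ea by rewrite divr_gt0 ?mulr_gt0.
have eb0 : 0 < eb by rewrite divr_gt0 ?mulr_gt0.
near=> y.
have -> : f y * g y - f x * g x = (f y - f x) * g y + f x * (g y - g x) by ring.
rewrite (le_lt_trans (nrmD _ _)) // !nrmM.
have Hf : nrm (f y - f x) < ea by near: y; exact: cf.
have Hg : nrm (g y - g x) < eb by near: y; exact: cg.
have Hg1 : nrm (g y - g x) < 1 by near: y; exact: cg.
have gb : nrm (g y) <= b.
  by have := nrmD (g y - g x) (g x); rewrite subrK /b; lra.
have -> : e = ea * b + a * eb by rewrite /ea /eb; field; rewrite !gt_eqF.
apply: ltr_leD.
  apply: le_lt_trans (_ : nrm (f y - f x) * b < _).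
    by rewrite ler_wpM2l ?nrm_ge0.
  by rewrite ltr_pM2r.
by apply: ler_pM; rewrite ?nrm_ge0 // ?(ltW Hg) // /a lerDl.
Unshelve. all: by end_near. Qed.

Lemma ccont_comp (X : topologicalType) (f : C -> C) (g : X -> C) (x : X) :
  ccont (f : (C^o : topologicalType) -> C) (g x) -> ccont g x ->
  ccont (f \o g) x.
Proof.
move=> cf cg e e0; have /nbhs_complexP[d d0 dP] := cf e e0.
by near=> y; apply: dP; near: y; exact: cg.
Unshelve. all: by end_near. Qed.

Lemma ccont_ReP (X : topologicalType) (f : X -> C) (x : X) :
  ccont f x <-> {for x, continuous (fun y => complex.Re (f y))} /\
                {for x, continuous (fun y => complex.Im (f y))}.
Proof.
split=> [cf|[/cvgrPdist_lt cr /cvgrPdist_lt ci] e e0].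
  split; apply/cvgrPdist_lt => e e0; near=> y.
    rewrite distrC -[X in `|X|]raddfB (le_lt_trans (Re_le_nrm _)) //.
    by near: y; exact: cf.
  rewrite distrC -[X in `|X|]raddfB (le_lt_trans (Im_le_nrm _)) //.
  by near: y; exact: cf.
have e2 : 0 < e / 2 by rewrite divr_gt0.
near=> y; rewrite (le_lt_trans (nrm_le_ReIm _)) // !raddfB /=.
have : `|complex.Re (f x) - complex.Re (f y)| < e / 2 by near: y; exact: cr.
have : `|complex.Im (f x) - complex.Im (f y)| < e / 2 by near: y; exact: ci.
rewrite distrC [X in _ -> X < _ -> _]distrC; lra.
Unshelve. all: by end_near. Qed.

Lemma Re_conjE (z : C) : complex.Re (conjc z) = complex.Re z.
Proof. by case: z. Qed.

Lemma Im_conjE (z : C) : complex.Im (conjc z) = - complex.Im z.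
Proof. by case: z. Qed.

Lemma nrm_conj (z : C) : nrm (conjc z) = nrm z.
Proof. by rewrite /nrm !normc_def /= Re_conjE Im_conjE sqrrN. Qed.

End EpsilonCalculus.

(** * Complex derivatives and velocities as first-order error bounds *)

Section Derivative.
Variable R : realType.
Local Notation C := R[i].

(* The derivative of [f : X -> C] with respect to [iota : X -> C]: with
   [X = C] and the identity it is the complex derivative, with [X = R] and
   the embedding of [R] into [C] the derivative of a complex curve. *)
Definition hasd (X : topologicalType) (iota f : X -> C) (x : X) (l : C) :=
  forall e : R, 0 < e -> \forall y \near x,
    nrm (f y - f x - (iota y - iota x) * l) <= e * nrm (iota y - iota x).

Definition chol (f : C -> C) (z l : C) :=
  hasd (id : (C^o : topologicalType) -> C) f z l.

Definition rcurve (g : R -> C) (t : R) (v : C) := hasd (real_complex R) g t v.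

Section Rules.
Variables (X : topologicalType) (iota : X -> C).
Implicit Types (f g : X -> C) (x : X).

Lemma hasd_near f g x l :
  (\forall y \near x, f y = g y) -> hasd iota f x l -> hasd iota g x l.
Proof.
move=> fg df e e0; near=> y.
rewrite -(near fg y) // -(nbhs_singleton fg); near: y; exact: df.
Unshelve. all: by end_near. Qed.

Lemma hasd_cst (c : C) x : hasd iota (fun=> c) x 0.
Proof.
move=> e e0; near=> y; rewrite subrr mulr0 subr0 nrm0.
by rewrite mulr_ge0 ?nrm_ge0 ?ltW.
Unshelve. all: by end_near. Qed.

Lemma hasd_self x : hasd iota iota x 1.
Proof.
move=> e e0; near=> y; rewrite mulr1 subrr nrm0.
by rewrite mulr_ge0 ?nrm_ge0 ?ltW.
Unshelve. all: by end_near. Qed.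

Lemma hasdD f g x a b :
  hasd iota f x a -> hasd iota g x b -> hasd iota (fun y => f y + g y) x (a + b).
Proof.
move=> df dg e e0; have e2 : 0 < e / 2 by rewrite divr_gt0.
near=> y.
have -> : f y + g y - (f x + g x) - (iota y - iota x) * (a + b) =
  (f y - f x - (iota y - iota x) * a) + (g y - g x - (iota y - iota x) * b).
  by ring.
rewrite (le_trans (nrmD _ _)) //.
have : nrm (f y - f x - (iota y - iota x) * a) <= e / 2 * nrm (iota y - iota x).
  by near: y; exact: df.
have : nrm (g y - g x - (iota y - iota x) * b) <= e / 2 * nrm (iota y - iota x).
  by near: y; exact: dg.
lra.
Unshelve. all: by end_near. Qed.

Lemma hasd_lipschitz f x l : hasd iota f x l ->
  \forall y \near x, nrm (f y - f x) <= (nrm l + 1) * nrm (iota y - iota x).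
Proof.
move=> df; near=> y.
have : nrm (f y - f x - (iota y - iota x) * l) <= 1 * nrm (iota y - iota x).
  by near: y; exact: df.
have := nrmD (f y - f x - (iota y - iota x) * l) ((iota y - iota x) * l).
rewrite subrK nrmM; lra.
Unshelve. all: by end_near. Qed.

Hypothesis ciota : forall x, ccont iota x.

Lemma hasd_ccont f x l : hasd iota f x l -> ccont f x.
Proof.
move=> /hasd_lipschitz df e e0.
have l0 : 0 < nrm l + 1 by rewrite ltr_wpDl ?nrm_ge0.
have e1 : 0 < e / (nrm l + 1) by rewrite divr_gt0.
near=> y.
have H1 : nrm (iota y - iota x) < e / (nrm l + 1) by near: y; exact: ciota.
have H : nrm (f y - f x) <= (nrm l + 1) * nrm (iota y - iota x) by near: y.
by apply: le_lt_trans H _; rewrite mulrC -ltr_pdivlMr.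
Unshelve. all: by end_near. Qed.

Lemma hasdM f g x a b : hasd iota f x a -> hasd iota g x b ->
  hasd iota (fun y => f y * g y) x (a * g x + f x * b).
Proof.
move=> df dg e e0.
have cg := hasd_ccont dg.
pose A := nrm a + 1; pose G := nrm (g x) + 1; pose F := nrm (f x) + 1.
have A0 : 0 < A by rewrite ltr_wpDl ?nrm_ge0.
have G0 : 0 < G by rewrite ltr_wpDl ?nrm_ge0.
have F0 : 0 < F by rewrite ltr_wpDl ?nrm_ge0.
pose e1 := e / (3 * G); pose e2 := e / (3 * F); pose e3 := e / (3 * A).
have e10 : 0 < e1 by rewrite divr_gt0 // mulr_gt0.
have e20 : 0 < e2 by rewrite divr_gt0 // mulr_gt0.
have e30 : 0 < e3 by rewrite divr_gt0 // mulr_gt0.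
near=> y; set h := iota y - iota x.
have -> : f y * g y - f x * g x - h * (a * g x + f x * b) =
  (f y - f x - h * a) * g y + f x * (g y - g x - h * b) + h * a * (g y - g x).
  by ring.
have H1 : nrm (f y - f x - h * a) <= e1 * nrm h by rewrite /h; near: y; exact: df.
have H2 : nrm (g y - g x - h * b) <= e2 * nrm h by rewrite /h; near: y; exact: dg.
have H3 : nrm (g y - g x) < e3 by near: y; exact: cg.
have H4 : nrm (g y) <= G.
  have : nrm (g y - g x) < 1 by near: y; exact: cg.
  by have := nrmD (g y - g x) (g x); rewrite subrK /G; lra.
have -> : e * nrm h = (e1 * nrm h) * G + F * (e2 * nrm h) + nrm h * A * e3.
  by rewrite /e1 /e2 /e3; field; rewrite !gt_eqF.
apply: le_trans (nrmD _ _) _; apply: lerD.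
  apply: le_trans (nrmD _ _) _; rewrite !nrmM; apply: lerD.
    by apply: ler_pM; rewrite ?nrm_ge0.
  by apply: ler_pM; rewrite ?nrm_ge0 // /F lerDl.
rewrite !nrmM; apply: ler_pM; rewrite ?mulr_ge0 ?nrm_ge0 ?(ltW H3) //.
by rewrite ler_wpM2l ?nrm_ge0 // /A lerDl.
Unshelve. all: by end_near. Qed.

Lemma hasdZ (c : C) f x a : hasd iota f x a -> hasd iota (fun y => c * f y) x (c * a).
Proof. by move=> df; have := hasdM (hasd_cst c x) df; rewrite mul0r add0r. Qed.

Lemma hasdB f g x a b :
  hasd iota f x a -> hasd iota g x b -> hasd iota (fun y => f y - g y) x (a - b).
Proof.
move=> df dg; have := hasdD df (hasdZ (- 1) dg); rewrite mulN1r.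
by under eq_fun do rewrite mulN1r.
Qed.

Lemma hasd_comp (f : C -> C) g x l v :
  chol f (g x) l -> hasd iota g x v -> hasd iota (f \o g) x (l * v).
Proof.
move=> df dg e e0; have cg := hasd_ccont dg; have lg := hasd_lipschitz dg.
pose B := nrm v + 1; pose L := nrm l + 1.
have B0 : 0 < B by rewrite ltr_wpDl ?nrm_ge0.
have L0 : 0 < L by rewrite ltr_wpDl ?nrm_ge0.
pose e1 := e / (2 * B); pose e2 := e / (2 * L).
have e10 : 0 < e1 by rewrite divr_gt0 // mulr_gt0.
have e20 : 0 < e2 by rewrite divr_gt0 // mulr_gt0.
have /nbhs_complexP[d d0 dP] := df e1 e10.
near=> y; set h := iota y - iota x.
have -> : (f \o g) y - (f \o g) x - h * (l * v) =
  (f (g y) - f (g x) - (g y - g x) * l) + l * (g y - g x - h * v).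
  by rewrite /=; ring.
have H1 : nrm (g y - g x) <= B * nrm h by rewrite /h; near: y.
have H2 : nrm (g y - g x - h * v) <= e2 * nrm h by rewrite /h; near: y; exact: dg.
have H3 : nrm (f (g y) - f (g x) - (g y - g x) * l) <= e1 * nrm (g y - g x).
  by apply: dP; near: y; exact: cg.
have -> : e * nrm h = e1 * (B * nrm h) + L * (e2 * nrm h).
  by rewrite /e1 /e2; field; rewrite !gt_eqF.
apply: le_trans (nrmD _ _) _; apply: lerD.
  by apply: le_trans H3 _; rewrite ler_pM2l.
by rewrite nrmM; apply: ler_pM; rewrite ?nrm_ge0 // /L lerDl.
Unshelve. all: by end_near. Qed.

End Rules.

Lemma ccont_real (t : R) : ccont (real_complex R) t.
Proof.
apply/ccont_ReP; split; first exact: cvg_id.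
exact: cvg_cst.
Qed.

Lemma rcurve_conj g t v : rcurve g t v -> rcurve (fun s => conjc (g s)) t (conjc v).
Proof.
move=> dg e e0; near=> s.
have -> : conjc (g s) - conjc (g t) - (s%:C - t%:C) * conjc v =
          conjc (g s - g t - (s%:C - t%:C) * v).
  rewrite -[s%:C - t%:C]rmorphB [RHS]rmorphB [X in _ = _ - X]rmorphM.
  by rewrite [X in _ = X - _]rmorphB /= oppr0.
by rewrite nrm_conj; near: s; exact: dg.
Unshelve. all: by end_near. Qed.

Lemma holomorphic_atP (f : C -> C) (z l : C) :
  (holomorphic_at f z /\ cderiv f z = l) <-> chol f z l.
Proof.
apply: (iff_trans (derive1_epsP f z l)); split=> [H e e0|H e e0].
  have := H e%:C; rewrite ltcR => /(_ e0) He; near=> y.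
  have : approx f z l e%:C y by near: y.
  by rewrite /approx !normE -rmorphM lecR.
have eE : e = (complex.Re e)%:C.
  by move: e0; rewrite ltcE => /andP[/eqP]; case: (e) => a b /= ->.
have {}e0 : 0 < complex.Re e by rewrite -ltcR -eE.
near=> y; rewrite /approx eE !normE -rmorphM lecR; near: y; exact: H.
Unshelve. all: by end_near. Qed.

Lemma Dt_rcurveP (g : R -> C) (t : R) (v : C) :
  (Dt_ex g t /\ Dt g t = v) <-> rcurve g t v.
Proof.
have E : (Dt_ex g t /\ Dt g t = v) <->
  (derivable (fun s => complex.Re (g s) : R) t 1 /\
   'D_1 (fun s => complex.Re (g s) : R) t = complex.Re v) /\
  (derivable (fun s => complex.Im (g s) : R) t 1 /\
   'D_1 (fun s => complex.Im (g s) : R) t = complex.Im v).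
  split=> [[[a b] <-]|[[a c] [b d]]] //; split => //.
  by rewrite /Dt c d; case: (v).
apply: (iff_trans E); split.
  move=> [/derive1_epsP Hr /derive1_epsP Hi] e e0.
  have e2 : 0 < e / 2 by rewrite divr_gt0.
  near=> s; rewrite -rmorphB nrmR (le_trans (nrm_le_ReIm _)) //.
  have : approx (fun s => complex.Re (g s) : R) t (complex.Re v) (e / 2) s.
    by near: s; exact: Hr.
  have : approx (fun s => complex.Im (g s) : R) t (complex.Im v) (e / 2) s.
    by near: s; exact: Hi.
  rewrite /approx; move: (g s) (g t) (v) => [a b] [c d] [v1 v2] /=.
  by rewrite !mul0r subr0 addr0; lra.
move=> H; split; apply/derive1_epsP => e e0; near=> s.
  have : nrm (g s - g t - (s%:C - t%:C) * v) <= e * nrm (s%:C - t%:C).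
    by near: s; exact: H.
  rewrite -[s%:C - t%:C]rmorphB nrmR; apply: le_trans.
  apply: le_trans (Re_le_nrm _); rewrite /approx.
  move: (g s) (g t) (v) => [a b] [c d] [v1 v2] /=.
  by rewrite !mul0r subr0.
have : nrm (g s - g t - (s%:C - t%:C) * v) <= e * nrm (s%:C - t%:C).
  by near: s; exact: H.
rewrite -[s%:C - t%:C]rmorphB nrmR; apply: le_trans.
apply: le_trans (Im_le_nrm _); rewrite /approx.
move: (g s) (g t) (v) => [a b] [c d] [v1 v2] /=.
by rewrite !mul0r addr0.
Unshelve. all: by end_near. Qed.

Lemma rcurve_Re g t v : rcurve g t v ->
  is_derive t 1 (fun s => complex.Re (g s) : R) (complex.Re v).
Proof. by move=> /Dt_rcurveP[[dr di] <-]; apply: DeriveDef. Qed.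

Lemma rcurve_Im g t v : rcurve g t v ->
  is_derive t 1 (fun s => complex.Im (g s) : R) (complex.Im v).
Proof. by move=> /Dt_rcurveP[[dr di] <-]; apply: DeriveDef. Qed.

Lemma rcurve_ReIm (u v : R -> R) (t du dv : R) :
  is_derive t 1 u du -> is_derive t 1 v dv ->
  rcurve (fun s => u s +i* v s) t (du +i* dv).
Proof.
move=> [du1 du2] [dv1 dv2]; apply/Dt_rcurveP; split=> //.
by rewrite /Dt /= -[X in _ = X +i* _]du2 -[X in _ = _ +i* X]dv2.
Qed.

End Derivative.

(** * Integrals of complex-valued functions over the unit interval *)

Section UnitIntegral.
Variable R : realType.
Local Notation C := R[i].
Local Notation mu := (@lebesgue_measure R).

Definition CI (k : R -> C) : C :=
  (\int[mu]_(t in `[0%R, 1%R]) complex.Re (k t)) +i*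
  (\int[mu]_(t in `[0%R, 1%R]) complex.Im (k t)).

Lemma Rintegral_FTC (k G : R -> R) :
  (forall t : R, 0 <= t <= 1 -> {for t, continuous k}) ->
  (forall t : R, 0 <= t <= 1 -> is_derive t 1 G (k t)) ->
  \int[mu]_(t in `[0%R, 1%R]) k t = G 1 - G 0.
Proof.
move=> ck dG; rewrite /Rintegral (@continuous_FTC2 _ k G) //.
- apply: continuous_in_subspaceT => t; rewrite inE /= in_itv /=; exact: ck.
- have cG t : 0 <= t <= 1 -> {for t, continuous G}.
    move=> t01; apply/differentiable_continuous/derivable1_diffP.
    by have [] := dG _ t01.
  split.
  + move=> t; rewrite in_itv /= => /andP[t0 t1].
    by have [|//] := dG t; rewrite !ltW.
  + by apply: cvg_at_right_filter; apply: cG; rewrite lexx ler01.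
  + by apply: cvg_at_left_filter; apply: cG; rewrite lexx ler01.
- move=> t; rewrite in_itv /= => /andP[t0 t1]; rewrite derive1E.
  by have [|//] := dG t; rewrite !ltW.
Qed.

Lemma CI_FTC (k G : R -> C) :
  (forall t : R, 0 <= t <= 1 -> ccont k t) ->
  (forall t : R, 0 <= t <= 1 -> rcurve G t (k t)) ->
  CI k = G 1 - G 0.
Proof.
move=> ck dG; rewrite /CI.
have -> : \int[mu]_(t in `[0%R, 1%R]) complex.Re (k t) =
    complex.Re (G 1) - complex.Re (G 0).
  apply: (@Rintegral_FTC (fun s => complex.Re (k s)) (fun s => complex.Re (G s))) => t t01.
    by have /ccont_ReP[] := ck t t01.
  exact: rcurve_Re (dG t t01).
have -> : \int[mu]_(t in `[0%R, 1%R]) complex.Im (k t) =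
    complex.Im (G 1) - complex.Im (G 0).
  apply: (@Rintegral_FTC (fun s => complex.Im (k s)) (fun s => complex.Im (G s))) => t t01.
    by have /ccont_ReP[] := ck t t01.
  exact: rcurve_Im (dG t t01).
by case: (G 1) (G 0) => [a b] [c d].
Qed.

(** Equality is asked on the open interval only: two arcs that agree on [0, 1] may have different
    two-sided velocities at the end points. *)
Lemma CI_ext (k k' : R -> C) :
  (forall t : R, 0 < t < 1 -> ccont k t) ->
  (forall t : R, 0 < t < 1 -> k t = k' t) -> CI k = CI k'.
Proof.
move=> ck kk'.
have near01 (t : R) : 0 < t < 1 -> \forall s \near t, k s = k' s.
  move=> t01; near=> s; apply: kk'.
  by near: s; apply: near_in_itvoo; rewrite in_itv.
have ck' t : 0 < t < 1 -> ccont k' t.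
  by move=> t01; apply: ccont_near (ck t t01); exact: near01.
have mf (f : R -> R) : (forall t : R, 0 < t < 1 -> {for t, continuous f}) ->
    measurable_fun ([set` `](0 : R), (1 : R)[] : set (measurableTypeR R)) f.
  move=> cf; apply: open_continuous_measurable_fun; first exact: interval_open.
  by move=> t; rewrite inE /= in_itv /=; exact: cf.
rewrite /CI /Rintegral; congr (fine _ +i* fine _); apply: eq_integral_itv_bounded.
- by apply: mf => t /ck /ccont_ReP[].
- by apply: mf => t /ck' /ccont_ReP[].
- by move=> t; rewrite in_itv /= => /kk' ->.
- by apply: mf => t /ck /ccont_ReP[].
- by apply: mf => t /ck' /ccont_ReP[].
- by move=> t; rewrite in_itv /= => /kk' ->.
Unshelve. all: by end_near. Qed.

(** The retraction of the line onto [0, 1]; composing with it extends a function that is continuous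
    only at the points of [0, 1] to one continuous everywhere. *)
Definition clamp (t : R) : R := Num.max 0 (Num.min 1 t).

Lemma clamp01 t : 0 <= clamp t <= 1.
Proof. by rewrite /clamp le_max lexx /= ge_max ler01 ge_min lexx. Qed.

Lemma clamp_id t : 0 <= t <= 1 -> clamp t = t.
Proof. by move=> /andP[t0 t1]; rewrite /clamp min_r // max_r. Qed.

Lemma clamp_continuous : continuous clamp.
Proof.
move=> t; apply: continuous_max; first exact: cst_continuous.
by apply: continuous_min; [exact: cst_continuous | exact: cvg_id].
Qed.

Lemma antiderivative01 (k : R -> C) :
  (forall t : R, 0 <= t <= 1 -> ccont k t) ->
  exists P : R -> C, forall t, 0 <= t <= 1 -> rcurve P t (k t).
Proof.
move=> ck; pose k' := k \o clamp.
have ck' t : ccont k' t.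
  move=> e e0; have := ck _ (clamp01 t) e e0.
  exact: (@clamp_continuous t).
(* The integral starts at -1 and the integrand is taken on [[-1, 2]], so that 0 and 1 are interior
   points and the derivative there is two-sided. *)
have int (f : R -> R) (t : R) : continuous f -> 0 <= t <= 1 ->
    is_derive t 1 (fun x => \int[mu]_(s in `[- 1, x]) f s) (f t).
  move=> cf /andP[t0 t1].
  have t2 : t < 2 by rewrite (le_lt_trans t1) // ltr1n.
  have tm1 : -1 < t by rewrite (lt_le_trans _ t0) // ltrN10.
  have intf : mu.-integrable `[-1, 2] (EFin \o f).
    apply: continuous_compact_integrable; first exact: segment_compact.
    exact: continuous_subspaceT.
  have [d1 d2] := @continuous_FTC1_closed R f (-1) t 2 t2 intf tm1 (cf t).
  by apply: DeriveDef => //; rewrite -derive1E.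
exists (fun x => (\int[mu]_(s in `[- 1, x]) complex.Re (k' s)) +i*
                 (\int[mu]_(s in `[- 1, x]) complex.Im (k' s))).
move=> t t01.
have -> : k t = complex.Re (k' t) +i* complex.Im (k' t).
  by rewrite /k' /= clamp_id //; case: (k t).
apply: rcurve_ReIm.
- by apply: (int (fun s => complex.Re (k' s))) => // s; have /ccont_ReP[] := ck' s.
- by apply: (int (fun s => complex.Im (k' s))) => // s; have /ccont_ReP[] := ck' s.
Qed.

(** Once an integral is an increment of a primitive, linearity, subdivision, reversal and bounds
    become algebra and the mean value theorem. *)
Lemma CI_antiderivative (k : R -> C) :
  (forall t : R, 0 <= t <= 1 -> ccont k t) ->
  exists P : R -> C, CI k = P 1 - P 0 /\
    forall t, 0 <= t <= 1 -> rcurve P t (k t).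
Proof.
by move=> ck; have [P dP] := antiderivative01 ck; exists P; rewrite (CI_FTC ck dP).
Qed.

Lemma CI_lin (a : C) (k k' : R -> C) :
  (forall t : R, 0 <= t <= 1 -> ccont k t) ->
  (forall t : R, 0 <= t <= 1 -> ccont k' t) ->
  CI (fun t => a * k t + k' t) = a * CI k + CI k'.
Proof.
move=> ck ck'; have [P [-> dP]] := CI_antiderivative ck; have [Q [-> dQ]] := CI_antiderivative ck'.
rewrite (@CI_FTC _ (fun t => a * P t + Q t)); first by ring.
- by move=> t t01; apply: ccontD (ck' t t01); apply: ccontM (ck t t01); exact: ccont_cst.
- move=> t t01; apply: hasdD (dQ t t01).
  by apply: hasdZ (dP t t01); exact: ccont_real.
Qed.

Lemma affine_continuous (a b t : R) : {for t, continuous (fun s : R => a + s * b)}.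
Proof.
apply: cvgD; first exact: cvg_cst.
by apply: cvgMl; exact: cvg_id.
Qed.

Lemma ccont_affine (k : R -> C) (a b t : R) :
  ccont k (a + t * b) -> ccont (fun s : R => k (a + s * b)) t.
Proof. move=> ck e e0; exact: (@affine_continuous a b t _ (ck e e0)). Qed.

Lemma rcurve_affine (P : R -> C) (a b t : R) v :
  rcurve P (a + t * b) v -> rcurve (fun s : R => P (a + s * b)) t (v * b%:C).
Proof.
move=> dP e e0; pose B := `|b| + 1.
have B0 : 0 < B by rewrite ltr_wpDl.
have H0 : \forall s \near t, nrm (P (a + s * b) - P (a + t * b) -
    ((a + s * b)%:C - (a + t * b)%:C) * v) <=
    e / B * nrm ((a + s * b)%:C - (a + t * b)%:C).
  exact: (@affine_continuous a b t _ (dP (e / B) (divr_gt0 e0 B0))).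
apply: filterS H0 => s; rewrite -!rmorphB !nrmR.
have -> : a + s * b - (a + t * b) = (s - t) * b by ring.
have -> : (s - t)%:C * (v * b%:C) = ((s - t) * b)%:C * v by rewrite rmorphM; ring.
move=> H; apply: le_trans H _; rewrite normrM.
have -> : e / B * (`|s - t| * `|b|) = (e * `|s - t|) * (`|b| / B) by ring.
rewrite ler_piMr ?mulr_ge0 ?(ltW e0) // ler_pdivrMr // mul1r /B lerDl //.
Qed.

Lemma CI_sub (k P : R -> C) (a b : R) :
  (forall t : R, 0 <= t <= 1 -> ccont k t) ->
  (forall t : R, 0 <= t <= 1 -> rcurve P t (k t)) ->
  (forall t : R, 0 <= t <= 1 -> 0 <= a + t * b <= 1) ->
  CI (fun t => k (a + t * b) * b%:C) = P (a + b) - P a.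
Proof.
move=> ck dP ab; rewrite (@CI_FTC _ (fun s => P (a + s * b))).
- by rewrite mul1r mul0r addr0.
- move=> t t01; apply: ccontM; last exact: ccont_cst.
  apply: (@ccont_affine k a b t); exact: ck (ab t t01).
- by move=> t t01; apply: rcurve_affine; exact: dP (ab t t01).
Qed.

Lemma CI_halves (k : R -> C) : (forall t : R, 0 <= t <= 1 -> ccont k t) ->
  CI k = CI (fun t => k (0 + t * 2^-1) * (2^-1)%:C) +
         CI (fun t => k (2^-1 + t * 2^-1) * (2^-1)%:C).
Proof.
move=> ck; have [P [-> dP]] := CI_antiderivative ck.
rewrite !(CI_sub ck dP); try by move=> t; lra.
have -> : 2^-1 + 2^-1 = 1 :> R by field.
by rewrite add0r; ring.
Qed.

Lemma CI_rev (k : R -> C) : (forall t : R, 0 <= t <= 1 -> ccont k t) ->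
  CI (fun t => k (1 + t * (- 1)) * (-1)%:C) = - CI k.
Proof.
move=> ck; have [P [-> dP]] := CI_antiderivative ck.
rewrite !(CI_sub ck dP); last by move=> t; lra.
by rewrite subrr; ring.
Qed.

(** The mean value theorem holds for real functions only; applying it to the real and the imaginary
    part of a primitive costs the factor 2. *)
Lemma nrm_CI (k : R -> C) (B : R) : (forall t : R, 0 <= t <= 1 -> ccont k t) ->
  (forall t : R, 0 <= t <= 1 -> nrm (k t) <= B) -> nrm (CI k) <= 2 * B.
Proof.
move=> ck kB; have [P [-> dP]] := CI_antiderivative ck.
have mvt (f df : R -> R) : (forall t : R, 0 <= t <= 1 -> is_derive t 1 f (df t)) ->
    (forall t : R, 0 <= t <= 1 -> `|df t| <= B) -> `|f 1 - f 0| <= B.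
  move=> dff fB.
  have cf : {within `[0, 1], continuous f}.
    apply: derivable_within_continuous => t; rewrite in_itv /= => t01.
    by have [] := dff t t01.
  have [|c c01 ->] := @MVT_segment R f df 0 1 ler01 _ cf.
    by move=> t; rewrite in_itv /= => /andP[t0 t1]; apply: dff; rewrite !ltW.
  by rewrite subr0 mulr1; apply: fB; move: c01; rewrite in_itv.
apply: le_trans (nrm_le_ReIm _) _.
have -> : 2 * B = B + B by ring.
rewrite !raddfB; apply: lerD.
  apply: (mvt (fun t => complex.Re (P t)) (fun t => complex.Re (k t))).
    by move=> t /dP /rcurve_Re.
  by move=> t /kB; apply: le_trans; exact: Re_le_nrm.
apply: (mvt (fun t => complex.Im (P t)) (fun t => complex.Im (k t))).
  by move=> t /dP /rcurve_Im.
by move=> t /kB; apply: le_trans; exact: Im_le_nrm.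
Qed.

End UnitIntegral.

(** * Goursat's theorem and its consequences *)

Section TriangleBisection.
Variable R : realType.
Local Notation C := R[i].

Lemma exists_pow2_lt (r d : R) : 0 <= r -> 0 < d -> exists n, r / 2 ^+ n < d.
Proof.
move=> r0 d0; exists (Num.bound (r / d)).
have H : r / d < (Num.bound (r / d))%:R by apply: archi_boundP; rewrite divr_ge0 // ltW.
rewrite ltr_pdivrMr ?exprn_gt0 // mulrC -ltr_pdivrMr //.
apply: lt_trans H _; rewrite -natrX ltr_nat; exact: ltn_expl.
Qed.

(** The intervals of radius 2 L / 2^n around [x n] are nested, because one step costs exactly what
    the radius loses; the supremum of their left ends lies in all of them. *)
Lemma dyadic_cauchy_real (x : nat -> R) (L : R) :
  (forall n, `|x n.+1 - x n| <= L / 2 ^+ n) ->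
  exists p, forall n, `|x n - p| <= 2 * L / 2 ^+ n.
Proof.
move=> H.
have half n : L / 2 ^+ n.+1 = L / 2 ^+ n / 2.
  by rewrite exprS; field; rewrite expf_neq0.
pose l n := x n - 2 * (L / 2 ^+ n); pose u n := x n + 2 * (L / 2 ^+ n).
have lS n : l n <= l n.+1.
  by have := H n; rewrite ler_norml /l half; lra.
have uS n : u n.+1 <= u n.
  by have := H n; rewrite ler_norml /u half; lra.
have lM m n : (m <= n)%N -> l m <= l n.
  by apply: (homo_leq (@lexx _ _) le_trans).
have uM m n : (m <= n)%N -> u n <= u m.
  by apply: (homo_leq (r := fun a b => b <= a)) => // a b c ab /le_trans; exact.
have lu n : l n <= u n.
  by have := le_trans (normr_ge0 _) (H n); rewrite /l /u; lra.
have lu' m n : l m <= u n.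
  have [mn|nm] := leqP m n; first exact: le_trans (lM _ _ mn) (lu n).
  exact: le_trans (lu m) (uM _ _ (ltnW nm)).
have hs : has_sup (range l).
  split; first by exists (l 0%N), 0%N.
  by exists (u 0%N) => _ [m _ <-].
exists (sup (range l)) => n.
have a1 : l n <= sup (range l) by apply: sup_upper_bound => //; exists n.
have a2 : sup (range l) <= u n.
  by apply: ge_sup; [exists (l 0%N), 0%N | move=> _ [m _ <-]].
by rewrite ler_norml -mulrA; move: a1 a2; rewrite /l /u; lra.
Qed.

Lemma dyadic_cauchy (x : nat -> C) (L : R) :
  (forall n, nrm (x n.+1 - x n) <= L / 2 ^+ n) ->
  exists p, forall n, nrm (x n - p) <= 4 * L / 2 ^+ n.
Proof.
move=> H.
have [|p Hp] := @dyadic_cauchy_real (fun n => complex.Re (x n)) L.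
  by move=> n; rewrite -[X in `|X|]raddfB (le_trans (Re_le_nrm _)).
have [|q Hq] := @dyadic_cauchy_real (fun n => complex.Im (x n)) L.
  by move=> n; rewrite -[X in `|X|]raddfB (le_trans (Im_le_nrm _)).
exists (p +i* q) => n; apply: le_trans (nrm_le_ReIm _) _; rewrite !raddfB /=.
have -> : 4 * L / 2 ^+ n = 2 * L / 2 ^+ n + 2 * L / 2 ^+ n by ring.
exact: lerD.
Qed.

Definition mid (a b : C) : C := (a + b) / 2.

Lemma nrm2 : nrm (2 : C) = 2.
Proof. by rewrite -[2 : C](rmorph_nat (real_complex R)) nrmR ger0_norm. Qed.

Lemma nrm_half (z : C) : nrm (z / 2) = nrm z / 2.
Proof. by rewrite nrmM nrmV nrm2. Qed.

Variables (D : set C) (J : C -> C -> C).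
Hypothesis Dmid : forall a b, D a -> D b -> D (mid a b).
Hypothesis Dlim : forall p, (forall e : R, 0 < e -> exists2 a, D a & nrm (a - p) < e) -> D p.
Hypothesis Jmid : forall a b, D a -> D b -> J a b = J a (mid a b) + J (mid a b) b.
Hypothesis Jrev : forall a b, D a -> D b -> J b a = - J a b.

(** [J a b] stands for an integral along the segment from [a] to [b]: of a function in Goursat's
    theorem, of the pullback of a form by a simplex in Stokes' theorem. Closure of [D] under
    midpoints and limits keeps the bisected triangles and their limit point inside. *)
Definition circ (a b c : C) : C := J a b + J b c + J c a.

(* As each bisection divides the diameter by 2 and the integral by at most 4, a
   local bound of order o(r^2) forces [circ] to vanish. *)
Hypothesis Jloc : forall p, D p -> forall e : R, 0 < e -> exists2 d : R, 0 < d &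
  forall r a b c, 0 < r < d -> D a -> D b -> D c ->
    nrm (a - p) <= r -> nrm (b - p) <= r -> nrm (c - p) <= r ->
    nrm (circ a b c) <= e * r ^+ 2.

Let good (T : C * C * C) := [/\ D T.1.1, D T.1.2 & D T.2].
Let small (T : C * C * C) (L : R) :=
  [/\ nrm (T.1.2 - T.1.1) <= L, nrm (T.2 - T.1.2) <= L & nrm (T.1.1 - T.2) <= L].
Let val (T : C * C * C) := nrm (circ T.1.1 T.1.2 T.2).

(** The midpoints cut the triangle into four, whose inner edges cancel by [Jrev]; so one of the four
    carries at least a quarter of the integral. Every new edge is half an old one up to sign. *)
Lemma bisect_step (T : C * C * C) : good T -> exists T' : C * C * C,
  [/\ good T', forall L, small T L -> small T' (L / 2),
      forall L, small T L -> nrm (T'.1.1 - T.1.1) <= L / 2 & val T / 4 <= val T'].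
Proof.
case: T => -[a b] c [/= Da Db Dc].
set p := mid a b; set q := mid b c; set r := mid c a.
have Dp : D p by exact: Dmid.
have Dq : D q by exact: Dmid.
have Dr : D r by exact: Dmid.
have E : circ a b c = circ a p r + circ p b q + circ r q c + circ p q r.
  rewrite /circ (Jmid Da Db) (Jmid Db Dc) (Jmid Dc Da) -/p -/q -/r.
  by rewrite (Jrev Dp Dr) (Jrev Dq Dr) (Jrev Dp Dq); ring.
have V : val (a, b, c) <= nrm (circ a p r) + nrm (circ p b q) +
                          nrm (circ r q c) + nrm (circ p q r).
  rewrite /val /= E.
  apply: le_trans (nrmD _ _) _; rewrite lerD2r.
  by apply: le_trans (nrmD _ _) _; rewrite lerD2r; exact: nrmD.
have half (x y z : C) L : x = y / 2 \/ x = (- y) / 2 -> nrm y <= L -> nrm x <= L / 2.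
  by move=> [] -> H; rewrite nrm_half ?nrmN ler_pM2r.
have ex : [\/ val (a, b, c) / 4 <= nrm (circ a p r),
    val (a, b, c) / 4 <= nrm (circ p b q),
    val (a, b, c) / 4 <= nrm (circ r q c) |
    val (a, b, c) / 4 <= nrm (circ p q r)].
  have [H1|H1] := leP (val (a, b, c) / 4) (nrm (circ a p r)); first exact: Or41.
  have [H2|H2] := leP (val (a, b, c) / 4) (nrm (circ p b q)); first exact: Or42.
  have [H3|H3] := leP (val (a, b, c) / 4) (nrm (circ r q c)); first exact: Or43.
  by apply: Or44; lra.
have pa : p - a = (b - a) / 2 by rewrite /p /mid; field.
have bp : b - p = (b - a) / 2 by rewrite /p /mid; field.
have qb : q - b = (c - b) / 2 by rewrite /q /mid; field.
have cq : c - q = (c - b) / 2 by rewrite /q /mid; field.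
have rc : r - c = (a - c) / 2 by rewrite /r /mid; field.
have ar : a - r = (a - c) / 2 by rewrite /r /mid; field.
have rp : r - p = (c - b) / 2 by rewrite /r /p /mid; field.
have pq : p - q = (a - c) / 2 by rewrite /p /q /mid; field.
have qr : q - r = (b - a) / 2 by rewrite /q /r /mid; field.
have leh (x : C) L : nrm x <= L -> nrm (x / 2) <= L / 2.
  by move=> H; rewrite nrm_half ler_pM2r.
have nn L : small (a, b, c) L -> 0 <= L / 2.
  by move=> [/= H _ _]; rewrite divr_ge0 // (le_trans (nrm_ge0 _) H).
case: ex => H.
- exists ((a, p), r); split => //= L sL; last by rewrite subrr nrm0 nn.
  by case: sL => /= ab bc ca; split => /=; rewrite ?pa ?rp ?ar; exact: leh.
- exists ((p, b), q); split => //= L sL; case: sL => /= ab bc ca.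
  by split => /=; rewrite ?bp ?qb ?pq; exact: leh.
  by rewrite pa; exact: leh.
- exists ((r, q), c); split => //= L sL; case: sL => /= ab bc ca.
  by split => /=; rewrite ?cq ?qr ?rc; exact: leh.
  by rewrite nrmB ar; exact: leh.
- exists ((p, q), r); split => //= L sL; case: sL => /= ab bc ca.
  by split => /=; rewrite nrmB ?pq ?qr ?rp; exact: leh.
  by rewrite pa; exact: leh.
Qed.

Lemma circ_eq0 (a b c : C) : D a -> D b -> D c -> circ a b c = 0.
Proof.
move=> Da Db Dc; apply/eqP; rewrite -nrm_eq0; apply: contraT => s0.
set s := nrm (circ a b c) in s0.
have {}s0 : 0 < s by rewrite lt_def s0 nrm_ge0.
(* [Q] is vacuous for triangles outside [D], so that the choice of a successor is a total
   function. *)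
pose Q T T' := good T -> [/\ good T', forall L, small T L -> small T' (L / 2),
    forall L, small T L -> nrm (T'.1.1 - T.1.1) <= L / 2 & val T / 4 <= val T'].
have exQ T : exists T', Q T T'.
  have [gT|] := pselect (good T); last by exists T.
  by have [T' ?] := bisect_step gT; exists T'.
have [f fP] := choice exQ.
pose T n := iter n f ((a, b), c).
pose L := nrm (b - a) + nrm (c - b) + nrm (a - c) + 1.
have := nrm_ge0 (b - a); have := nrm_ge0 (c - b); have := nrm_ge0 (a - c).
move=> n1 n2 n3; have L0 : 0 < L by rewrite /L; lra.
have half n : L / 2 ^+ n.+1 = L / 2 ^+ n / 2.
  by rewrite exprS; field; rewrite expf_neq0.
have Tn n : [/\ good (T n), small (T n) (L / 2 ^+ n) & s / 4 ^+ n <= val (T n)].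
  elim: n => [|n [g sm v]].
    by split; rewrite ?expr0 ?divr1 //; split => /=; rewrite /L; lra.
  have [g' sm' _ v'] := fP _ g; split => //; first by rewrite half; exact: sm'.
  apply: le_trans v'; rewrite exprS [4 * _]mulrC invfM mulrA.
  by rewrite ler_pM2r // invr_gt0.
have [|p pP] := @dyadic_cauchy (fun n => (T n).1.1) L.
  move=> n; have [g sm _] := Tn n; have [_ _ H _] := fP _ g.
  apply: le_trans (H _ sm) _; rewrite ler_pdivrMr // ler_peMr ?ler1n //.
  by rewrite divr_ge0 ?exprn_ge0 // ltW.
have Dp : D p.
  apply: Dlim => e e0.
  have [n nP] := @exists_pow2_lt (4 * L) e (ltW (mulr_gt0 (ltr0n _ 4) L0)) e0.
  exists (T n).1.1; first by have [[]] := Tn n.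
  by apply: le_lt_trans nP; apply: pP.
(* The first vertex is within 4 L / 2^n of [p] and the others one edge farther, so r = 5 L / 2^n
   serves for all three. With this [e] the local bound e r^2 is half of s / 4^n, which contradicts
   the lower bound. *)
pose e := s / (50 * L ^+ 2).
have e0 : 0 < e by rewrite divr_gt0 // mulr_gt0 // exprn_gt0.
have [d d0 dP] := Jloc Dp e0.
have [n nP] := @exists_pow2_lt (5 * L) d (ltW (mulr_gt0 (ltr0n _ 5) L0)) d0.
have [[g1 g2 g3] [m1 m2 m3] v] := Tn n.
have r0 : 0 < 5 * L / 2 ^+ n by rewrite divr_gt0 ?exprn_gt0 // mulr_gt0.
have E : 5 * L / 2 ^+ n = L / 2 ^+ n + 4 * L / 2 ^+ n by ring.
have Ln0 : 0 < L / 2 ^+ n by rewrite divr_gt0 ?exprn_gt0.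
have q1 := pP n.
have q2 : nrm ((T n).1.2 - p) <= L / 2 ^+ n + 4 * L / 2 ^+ n.
  by apply: le_trans (nrm_tri _ _ (T n).1.1) _; exact: lerD.
have q3 : nrm ((T n).2 - p) <= L / 2 ^+ n + 4 * L / 2 ^+ n.
  by apply: le_trans (nrm_tri _ _ (T n).1.1) _; rewrite nrmB in m3; exact: lerD.
have q1' : nrm ((T n).1.1 - p) <= L / 2 ^+ n + 4 * L / 2 ^+ n.
  by apply: le_trans q1 _; rewrite lerDr ltW.
rewrite -E in q1' q2 q3.
have rd : 0 < 5 * L / 2 ^+ n < d by rewrite r0 nP.
have := le_trans v (dP _ _ _ _ rd g1 g2 g3 q1' q2 q3).
rewrite expr_div_n -exprM [(n * 2)%N]mulnC exprM.
have -> : 2 ^+ 2 = 4 :> R by ring.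
rewrite mulrA ler_pM2r ?invr_gt0 ?exprn_gt0 // /e.
have -> : s / (50 * L ^+ 2) * (5 * L) ^+ 2 = s / 2.
  by field; rewrite gt_eqF.
lra.
Qed.

End TriangleBisection.

(** * Integrals along segments, Goursat's theorem and local primitives *)

Section Goursat.
Variable R : realType.
Local Notation C := R[i].

Lemma realCD (x y : R) : (x + y)%:C = x%:C + y%:C :> C.
Proof. exact: rmorphD. Qed.

Lemma realCB (x y : R) : (x - y)%:C = x%:C - y%:C :> C.
Proof. exact: rmorphB. Qed.

Lemma realCN (x : R) : (- x)%:C = - x%:C :> C.
Proof. exact: rmorphN. Qed.

Lemma realCM (x y : R) : (x * y)%:C = x%:C * y%:C :> C.
Proof. exact: rmorphM. Qed.

Definition seg (a b : C) (t : R) : C := a + t%:C * (b - a).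

Definition SI (f : C -> C) (a b : C) : C := CI (fun t => f (seg a b t) * (b - a)).

Definition convexC (D : set C) :=
  forall a b t, D a -> D b -> 0 <= t <= 1 -> D (seg a b t).

Definition limclosed (D : set C) :=
  forall p, (forall e : R, 0 < e -> exists2 a, D a & nrm (a - p) < e) -> D p.

Lemma seg0 a b : seg a b 0 = a.
Proof. by rewrite /seg rmorph0 mul0r addr0. Qed.

Lemma seg1 a b : seg a b 1 = b.
Proof. by rewrite /seg rmorph1 mul1r addrC subrK. Qed.

Lemma rcurve_seg a b t : rcurve (seg a b) t (b - a).
Proof.
have := hasdD (hasd_cst (real_complex R) a t)
  (hasdM (@ccont_real R) (hasd_self (real_complex R) t) (hasd_cst (real_complex R) (b - a) t)).
by rewrite mulr0 addr0 mul1r add0r.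
Qed.

Lemma ccont_rcurve (g : R -> C) t v : rcurve g t v -> ccont g t.
Proof. exact: (hasd_ccont (@ccont_real R)). Qed.

Lemma ccont_chol (f : C -> C) z l :
  chol f z l -> ccont (f : (C^o : topologicalType) -> C) z.
Proof.
move=> df; refine (hasd_ccont _ df); exact: ccont_id.
Qed.

Lemma seg_ball a b p r t : nrm (a - p) <= r -> nrm (b - p) <= r -> 0 <= t <= 1 ->
  nrm (seg a b t - p) <= r.
Proof.
move=> ar br /andP[t0 t1].
have -> : seg a b t - p = (1 - t)%:C * (a - p) + t%:C * (b - p).
  by rewrite /seg realCB rmorph1; ring.
apply: le_trans (nrmD _ _) _; rewrite !nrmM !nrmR !ger0_norm ?subr_ge0 //.
have -> : r = (1 - t) * r + t * r by ring.
by apply: lerD; apply: ler_wpM2l => //; rewrite subr_ge0.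
Qed.

Definition ccontC (f : C -> C) (z : C) := ccont (f : (C^o : topologicalType) -> C) z.

Lemma ccontC_cst (c z : C) : ccontC (fun=> c) z.
Proof. exact: (@ccont_cst R C^o). Qed.

Lemma ccontCD (f g : C -> C) z :
  ccontC f z -> ccontC g z -> ccontC (fun w => f w + g w) z.
Proof. exact: (@ccontD R C^o). Qed.

Lemma ccontCM (f g : C -> C) z :
  ccontC f z -> ccontC g z -> ccontC (fun w => f w * g w) z.
Proof. exact: (@ccontM R C^o). Qed.

Lemma ccontCB (f g : C -> C) z :
  ccontC f z -> ccontC g z -> ccontC (fun w => f w - g w) z.
Proof.
move=> cf cg; have := ccontCD cf (ccontCM (ccontC_cst (-1) z) cg).
by under [X in ccontC X _]eq_fun do rewrite mulN1r.
Qed.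

Lemma chol_cst (c z : C) : chol (fun=> c) z 0.
Proof. exact: (@hasd_cst R C^o). Qed.

Lemma chol_id (z : C) : chol (fun w => w) z 1.
Proof. exact: (@hasd_self R C^o). Qed.

Lemma cholD (f g : C -> C) z a b :
  chol f z a -> chol g z b -> chol (fun w => f w + g w) z (a + b).
Proof. exact: (@hasdD R C^o). Qed.

Lemma cholB (f g : C -> C) z a b :
  chol f z a -> chol g z b -> chol (fun w => f w - g w) z (a - b).
Proof. exact: (@hasdB R C^o _ (@ccont_id R)). Qed.

Lemma cholM (f g : C -> C) z a b :
  chol f z a -> chol g z b -> chol (fun w => f w * g w) z (a * g z + f z * b).
Proof. exact: (@hasdM R C^o _ (@ccont_id R)). Qed.

Lemma cholZ (c : C) (f : C -> C) z a :
  chol f z a -> chol (fun w => c * f w) z (c * a).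
Proof. exact: (@hasdZ R C^o _ (@ccont_id R)). Qed.

Lemma chol_comp (f g : C -> C) z a b :
  chol f (g z) a -> chol g z b -> chol (f \o g) z (a * b).
Proof. exact: (@hasd_comp R C^o _ (@ccont_id R)). Qed.

Lemma chol_eq (f : C -> C) z a b : a = b -> chol f z a -> chol f z b.
Proof. by move=> ->. Qed.

Lemma SI_primitive (f F : C -> C) a b :
  (forall t, 0 <= t <= 1 -> chol F (seg a b t) (f (seg a b t))) ->
  (forall t, 0 <= t <= 1 ->
    ccontC f (seg a b t)) ->
  SI f a b = F b - F a.
Proof.
move=> dF cf; rewrite /SI (@CI_FTC _ _ (F \o seg a b)) /=.
- by rewrite seg0 seg1.
- move=> t t01; apply: ccontM; last exact: ccont_cst.
  by apply: ccont_comp (cf t t01) _; apply: ccont_rcurve (rcurve_seg _ _ _).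
- by move=> t t01; apply: hasd_comp (dF t t01) (rcurve_seg _ _ _); exact: ccont_real.
Qed.

Lemma nrm_SI (f : C -> C) a b B :
  (forall t, 0 <= t <= 1 -> ccontC f (seg a b t)) ->
  (forall t, 0 <= t <= 1 -> nrm (f (seg a b t)) <= B) ->
  nrm (SI f a b) <= 2 * B * nrm (b - a).
Proof.
move=> cf fB; rewrite -mulrA; apply: nrm_CI => t t01.
  apply: ccontM; last exact: ccont_cst.
  by apply: ccont_comp (cf t t01) _; apply: ccont_rcurve (rcurve_seg _ _ _).
by rewrite nrmM ler_wpM2r ?nrm_ge0 //; exact: fB.
Qed.

Lemma SI_D (f g : C -> C) a b :
  (forall t, 0 <= t <= 1 -> ccontC f (seg a b t)) ->
  (forall t, 0 <= t <= 1 -> ccontC g (seg a b t)) ->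
  SI (fun z => f z + g z) a b = SI f a b + SI g a b.
Proof.
move=> cf cg.
have cc (h : C -> C) : (forall t, 0 <= t <= 1 ->
    ccontC h (seg a b t)) ->
    forall t, 0 <= t <= 1 -> ccont (fun t => h (seg a b t) * (b - a)) t.
  move=> ch t t01; apply: ccontM; last exact: ccont_cst.
  by apply: ccont_comp (ch t t01) _; apply: ccont_rcurve (rcurve_seg _ _ _).
have := CI_lin 1 (cc f cf) (cc g cg); rewrite mul1r => <-.
by congr CI; apply/funext => t; ring.
Qed.

Section Convex.
Variables (D : set C) (f : C -> C).
Hypothesis Dconv : convexC D.
Hypothesis Dlim : limclosed D.
Hypothesis df : forall z, D z -> exists l, chol f z l.

Let cf a b t : D a -> D b -> 0 <= t <= 1 ->
  ccontC f (seg a b t).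
Proof. by move=> Da Db t01; have [l /ccont_chol] := df (Dconv Da Db t01). Qed.

Let cfk a b t : D a -> D b -> 0 <= t <= 1 -> ccont (fun t => f (seg a b t) * (b - a)) t.
Proof.
move=> Da Db t01; apply: ccontM; last exact: ccont_cst.
by apply: ccont_comp (cf Da Db t01) _; apply: ccont_rcurve (rcurve_seg _ _ _).
Qed.

Lemma SI_mid a b : D a -> D b -> SI f a b = SI f a (mid a b) + SI f (mid a b) b.
Proof.
move=> Da Db; rewrite /SI CI_halves => [|t t01]; last exact: cfk.
have e2 : (2^-1)%:C = 2^-1 :> C by rewrite fmorphV rmorph_nat.
congr (CI _ + CI _); apply/funext => t; rewrite -mulrA e2; congr (f _ * _).
- by rewrite /seg add0r realCM e2 /mid; field.
- by rewrite /mid; field.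
- by rewrite /seg realCD realCM e2 /mid; field.
- by rewrite /mid; field.
Qed.

Lemma SI_rev a b : D a -> D b -> SI f b a = - SI f a b.
Proof.
move=> Da Db; rewrite /SI -CI_rev => [|t t01]; last exact: cfk.
congr CI; apply/funext => t; rewrite -mulrA; congr (f _ * _).
  by rewrite /seg mulrN1 realCB rmorph1; ring.
by rewrite realCN rmorph1; ring.
Qed.

(** Bisection applies because the affine part of [f] at [p] has a primitive and contributes nothing
    around a triangle, while the rest is o(|w - p|) on edges of length O(r). *)
Theorem goursat_triangle a b c : D a -> D b -> D c -> circ (SI f) a b c = 0.
Proof.
apply: (@circ_eq0 R D).
- move=> x y Dx Dy; have -> : mid x y = seg x y 2^-1.
    by rewrite /mid /seg fmorphV rmorph_nat; field.
  by apply: Dconv => //; lra.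
- exact: Dlim.
- exact: SI_mid.
- by move=> *; exact: SI_rev.
move=> p Dp e e0; have [l dl] := df Dp.
(* 12 = 3 * 2 * 2: three edges, the factor 2 of [nrm_SI], and edges of length at most 2 r. *)
have e12 : 0 < e / 12 by rewrite divr_gt0.
have /nbhs_complexP[d d0 dP] := dl _ e12.
exists d => // r x y z /andP[r0 rd] Dx Dy Dz xr yr zr.
pose g w := f p + l * (w - p); pose h w := f w - g w.
pose G w := f p * w + l * (w - p) * (w - p) / 2.
have dg w : chol g w l.
  apply: chol_eq (cholD (chol_cst (f p) w)
    (cholZ l (cholB (chol_id w) (chol_cst p w)))).
  by ring.
have dG w : chol G w (g w).
  have d1 := cholB (chol_id w) (chol_cst p w).
  have -> : G = fun w => f p * w + l / 2 * ((w - p) * (w - p)).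
    by apply/funext => u; rewrite /G; field.
  apply: chol_eq (cholD (cholZ (f p) (chol_id w)) (cholZ (l / 2) (cholM d1 d1))).
  by rewrite /g; field.
have est u v : D u -> D v -> nrm (u - p) <= r -> nrm (v - p) <= r ->
    exists2 E, nrm E <= e / 3 * r ^+ 2 & SI f u v = G v - G u + E.
  move=> Du Dv ur vr; exists (SI h u v).
    have -> : e / 3 * r ^+ 2 = 2 * (e / 12 * r) * (r + r) by field.
    apply: le_trans (nrm_SI (B := e / 12 * r) _ _) _ => [t t01|t t01|].
    - by apply: ccontCB; [exact: cf | exact: ccont_chol (dg _)].
    - have sr := seg_ball ur vr t01.
      have := dP _ (le_lt_trans sr rd).
      rewrite /h /g opprD addrA [l * _]mulrC => /le_trans; apply.
      by rewrite ler_pM2l.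
    - apply: ler_wpM2l; first by rewrite !mulr_ge0 // ltW.
      apply: le_trans (nrm_tri _ _ p) _; rewrite [nrm (p - u)]nrmB.
      exact: lerD.
  rewrite -(@SI_primitive g) //; last first.
  - by move=> t t01; exact: ccont_chol (dg _).
  - rewrite -SI_D; first by congr SI; apply/funext => w; rewrite /h addrC subrK.
    + by move=> t t01; exact: ccont_chol (dg _).
    + by move=> t t01; apply: ccontCB; [exact: cf | exact: ccont_chol (dg _)].
rewrite /circ.
have [E1 E1r ->] := est _ _ Dx Dy xr yr.
have [E2 E2r ->] := est _ _ Dy Dz yr zr.
have [E3 E3r ->] := est _ _ Dz Dx zr xr.
have -> : G y - G x + E1 + (G z - G y + E2) + (G x - G z + E3) = E1 + E2 + E3 by ring.
have := nrmD (E1 + E2) E3; have := nrmD E1 E2; lra.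
Qed.

(** By Goursat on the triangle [z0], [z], [w], the increment of the integral is the integral over
    the segment from [z] to [w], on which [f] stays close to [f z]. *)
Lemma SI_chol (z0 z : C) : D z0 ->
  (exists2 r : R, 0 < r & forall w, nrm (w - z) < r -> D w) ->
  chol (SI f z0) z (f z).
Proof.
move=> Dz0 [r r0 rD] e e0.
have Dz : D z by apply: rD; rewrite subrr nrm0.
have [l /ccont_chol] := df Dz.
have e2 : 0 < e / 2 by rewrite divr_gt0.
move=> /(_ _ e2) /nbhs_complexP[d d0 dP].
apply/nbhs_complexP; exists (Num.min r d); first by rewrite lt_min r0 d0.
move=> w; rewrite lt_min => /andP[wr wd].
have Dw := rD _ wr.
have /eqP := goursat_triangle Dz0 Dz Dw; rewrite /circ (SI_rev Dz0 Dw) subr_eq0 => /eqP <-.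
have cm t : 0 <= t <= 1 ->
    ccontC (fun=> - f z) (seg z w t).
  by move=> _; exact: ccontC_cst.
have E : SI (fun=> - f z) z w = - (f z * (w - z)).
  rewrite (@SI_primitive _ (fun u => - f z * u)) //; first by ring.
  by move=> t _; apply: chol_eq (cholZ (- f z) (chol_id _)); rewrite mulr1.
have -> : SI f z0 z + SI f z w - SI f z0 z - (w - z) * f z =
    SI (fun u => f u - f z) z w.
  rewrite (SI_D (g := fun=> - f z)) ?E //; first by ring.
  by move=> t t01; exact: cf.
have -> : e = 2 * (e / 2) by field.
apply: nrm_SI => t t01.
  by apply: ccontCB; [exact: cf | exact: ccontC_cst].
apply: ltW; apply: dP; apply: le_lt_trans wd.
by apply: seg_ball => //; rewrite subrr nrm0 nrm_ge0.
Qed.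

End Convex.

Lemma ball_convex (p : C) (r : R) : convexC [set z | nrm (z - p) <= r].
Proof. by move=> a b t ar br t01; exact: seg_ball. Qed.

Lemma ball_limclosed (p : C) (r : R) : limclosed [set z | nrm (z - p) <= r].
Proof.
move=> z H /=; apply/ler_addgt0Pl => e e0; have [a /= ar az] := H e e0.
apply: le_trans (nrm_tri _ _ a) _; rewrite nrmB; apply: lerD => //; exact: ltW.
Qed.

Lemma local_primitive (f : C -> C) (p : C) (r : R) :
  (forall z, nrm (z - p) < r -> exists l, chol f z l) ->
  exists F, forall z, nrm (z - p) < r -> chol F z (f z).
Proof.
move=> df; exists (SI f p) => z zr.
(* The closed disc of radius [s] is convex and closed under limits, lies inside the open disc of
   radius [r], and contains a neighbourhood of [z]. The primitive itself does not depend on [s]. *)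
pose s := (nrm (z - p) + r) / 2.
have zs : nrm (z - p) < s by rewrite /s; lra.
have sr : s < r by rewrite /s; lra.
apply: (SI_chol (@ball_convex p s) (@ball_limclosed p s)).
- by move=> w /= ws; apply: df; exact: le_lt_trans sr.
- by rewrite /= subrr nrm0 (le_trans (nrm_ge0 _) (ltW zs)).
- exists (s - nrm (z - p)); first by rewrite subr_gt0.
  move=> w wz /=; have := nrm_tri w p z; lra.
Qed.

End Goursat.

(** * The complex exponential *)

Section ComplexExponential.
Variable R : realType.
Local Notation C := R[i].

Lemma cexpD (z w : C) : cexp (z + w) = cexp z * cexp w.
Proof.
case: z w => [a b] [c d]; rewrite /cexp /= expRD cosD sinD.
by apply/eqP; rewrite eq_complex /=; apply/andP; split; apply/eqP; ring.
Qed.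

Lemma cexp0 : cexp (0 : C) = 1.
Proof.
by rewrite /cexp /= expR0 cos0 sin0 !mul1r.
Qed.

Lemma cexpNK (z : C) : cexp z * cexp (- z) = 1.
Proof. by rewrite -cexpD subrr cexp0. Qed.

Lemma nrm_cexp (z : C) : nrm (cexp z) = expR (complex.Re z).
Proof.
rewrite /cexp nrmM nrmR ger0_norm ?expR_ge0 // /nrm normc_def /=.
by rewrite cos2Dsin2 sqrtr1 mulr1.
Qed.

Lemma cexp_2pi : cexp (0 +i* (pi *+ 2)) = 1 :> C.
Proof.
rewrite /cexp /= expR0 cos2pi mul1r.
have := @sinD2pi R 0; rewrite add0r sin0 => -> //.
Qed.

(** With [E], [Cc], [S] the first-order errors of exp, cos and sin, the error of [cexp] at x + i y
    is (E + Cc e^x) + i (S e^x + y (x + E)). The addition formula carries the result from 0 to all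
    other points. *)
Lemma chol_cexp0 : chol (@cexp R) 0 1.
Proof.
have /derive1_epsP de : derivable (@expR R) 0 1 /\ 'D_1 (@expR R) 0 = 1.
  by have [d1 d2] := @is_derive_expR R 0; rewrite d2 expR0.
have /derive1_epsP dc : derivable (@cos R) 0 1 /\ 'D_1 (@cos R) 0 = 0.
  by have [d1 d2] := @is_derive_cos R 0; rewrite d2 sin0 oppr0.
have /derive1_epsP ds : derivable (@sin R) 0 1 /\ 'D_1 (@sin R) 0 = 1.
  by have [d1 d2] := @is_derive_sin R 0; rewrite d2 cos0.
move=> e e0.
pose e1 := Num.min 1 (e / 8).
have e10 : 0 < e1 by rewrite lt_min ltr01 divr_gt0.
have e11 : e1 <= 1 by rewrite ge_min lexx.
(* The four error terms are at most 1, 2, 2 and 1 times e1 |h|, so 8 leaves room. *)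
have e1e : 8 * e1 <= e by rewrite -ler_pdivlMl // mulrC ge_min lexx orbT.
have : \forall x \near (0 : R), [/\ `|x| <= e1 / 2, approx (@expR R) 0 1 e1 x,
    approx (@cos R) 0 0 e1 x & approx (@sin R) 0 1 e1 x].
  near=> x; split.
  - near: x; apply/nbhs_ballP; exists (e1 / 2); first by rewrite /= divr_gt0.
    by move=> x; rewrite /ball /= sub0r normrN => /ltW.
  - by near: x; exact: de.
  - by near: x; exact: dc.
  - by near: x; exact: ds.
move=> /nbhs_ballP[d /= d0 dP].
apply/nbhs_complexP; exists d => // h; rewrite subr0 => hd.
rewrite cexp0 mulr1.
have := dP (complex.Re h); rewrite /ball /= sub0r normrN.
move=> /(_ (le_lt_trans (Re_le_nrm h) hd)) [xs xe _ _].
have := dP (complex.Im h); rewrite /ball /= sub0r normrN.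
move=> /(_ (le_lt_trans (Im_le_nrm h) hd)) [ys _ yc ysn].
have := Re_le_nrm h; have := Im_le_nrm h.
case: h hd xs xe ys yc ysn => x y /= hd xs xe ys yc ysn hy hx.
move: xe yc ysn; rewrite /approx expR0 cos0 sin0 !subr0 !mulr1 mulr0 subr0.
move=> xe yc ysn.
set n := nrm (x +i* y) in hx hy *.
set E := expR x - 1 - x in xe; set Cc := cos y - 1 in yc; set S := sin y - y in ysn.
have n0 : 0 <= n by exact: nrm_ge0.
have EE : expR x = 1 + x + E by rewrite /E; ring.
have CE : cos y = 1 + Cc by rewrite /Cc; ring.
have SE : sin y = y + S by rewrite /S; ring.
have -> : cexp (x +i* y) - 1 - (x +i* y) =
    (E + Cc * expR x) +i* (S * expR x + y * (x + E)).
  rewrite /cexp /= CE SE.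
  apply/eqP; rewrite eq_complex /=; apply/andP; split; apply/eqP.
    by rewrite !mul0r /E; ring.
  by rewrite !mul0r /E; ring.
apply: le_trans (nrm_le_ReIm _) _ => /=.
have En : `|E| <= e1 * n by apply: le_trans xe _; rewrite ler_pM2l.
have Cn : `|Cc| <= e1 * n by apply: le_trans yc _; rewrite ler_pM2l.
have Sn : `|S| <= e1 * n by apply: le_trans ysn _; rewrite ler_pM2l.
have x1 : `|x| <= 1 / 2 by lra.
have E1 : `|E| <= e1 / 2.
  apply: le_trans xe _; rewrite ler_pM2l //; lra.
have ex2 : `|expR x| <= 2.
  rewrite EE (le_trans (ler_normD _ _)) //.
  have := ler_normD 1 x; rewrite normr1; lra.
have t1 : `|Cc * expR x| <= e1 * n * 2 by rewrite normrM ler_pM.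
have t2 : `|S * expR x| <= e1 * n * 2 by rewrite normrM ler_pM.
have t3 : `|y * (x + E)| <= n * e1.
  rewrite normrM ler_pM // (le_trans (ler_normD _ _)) //; lra.
have H1 := ler_normD E (Cc * expR x).
have H2 := ler_normD (S * expR x) (y * (x + E)).
have H3 : 8 * e1 * n <= e * n by rewrite ler_wpM2r.
have H4 : 0 <= e1 * n by rewrite mulr_ge0 // ltW.
lra.
Unshelve. all: by end_near. Qed.

Lemma chol_cexp (z : C) : chol (@cexp R) z (cexp z).
Proof.
have d1 : chol (fun w => w - z) z 1.
  by have := cholB (chol_id z) (chol_cst z z); rewrite subr0.
have d0 : chol (@cexp R) (z - z) 1 by rewrite subrr; exact: chol_cexp0.
have := cholZ (cexp z) (@chol_comp R (@cexp R) (fun w => w - z) z 1 1 d0 d1); rewrite !mulr1.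
suff -> : (fun w => cexp z * (@cexp R \o (fun w => w - z)) w) = @cexp R by [].
by apply/funext => w; rewrite /= -cexpD addrC subrK.
Qed.

Lemma cexp_surj (z : C) : z != 0 -> exists w, cexp w = z.
Proof.
move=> z0; have n0 : 0 < nrm z by rewrite nrm_gt0.
pose u := z / (nrm z)%:C.
have uE : z = (nrm z)%:C * u.
  rewrite /u mulrC mulrVK // unitfE -(rmorph0 (real_complex R)).
  by rewrite (inj_eq (@complexI R)) gt_eqF.
have u1 : complex.Re u ^+ 2 + complex.Im u ^+ 2 = 1.
  have : nrm u = 1 by rewrite /u nrmM nrmV nrmR gtr0_norm // divff // gt_eqF.
  rewrite /nrm normc_def /= => h.
  by rewrite -[LHS]sqr_sqrtr ?h ?expr1n // addr_ge0 ?sqr_ge0.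
have ru : -1 <= complex.Re u <= 1.
  rewrite -ler_norml -sqrtr_sqr -[leRHS]sqrtr1 ler_wsqrtr //.
  by rewrite -u1 lerDl sqr_ge0.
pose t := acos (complex.Re u).
have ct : cos t = complex.Re u by apply: acosK; rewrite in_itv.
have st : sin t = `|complex.Im u|.
  by rewrite sin_acos // -sqrtr_sqr; congr (Num.sqrt _); rewrite -u1; ring.
have [i0|i0] := leP 0 (complex.Im u).
  exists (ln (nrm z) +i* t); rewrite /cexp /= lnK ?posrE // ct st ger0_norm //.
  by rewrite [RHS]uE; case: (u).
exists (ln (nrm z) +i* (- t)); rewrite /cexp /= lnK ?posrE // cosN sinN ct st.
by rewrite ltr0_norm // opprK [RHS]uE; case: (u).
Qed.

End ComplexExponential.

(** * Cauchy's formula and the mean value property *)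

Section CauchyFormula.
Variable R : realType.
Local Notation C := R[i].

(** This is 2 pi i, the period of the exponential. *)
Definition tau : C := 0 +i* (pi *+ 2).

Lemma seg_tau w t : seg w (w + tau) t = w + t%:C * tau.
Proof. by rewrite /seg; congr (_ + _ * _); ring. Qed.

Lemma chol_cexpN (z : C) : chol (fun w => cexp (- w)) z (- cexp (- z)).
Proof.
have := @chol_comp R (@cexp R) (fun w => -1 * w) z _ _ (chol_cexp _)
  (cholZ (-1) (chol_id z)).
rewrite mulr1 mulrN1 mulN1r.
suff -> : @cexp R \o (fun w => -1 * w) = (fun w => cexp (- w)) by [].
by apply/funext => w; rewrite /= mulN1r.
Qed.

Lemma chol_shift_cexp (f : C -> C) (p z l : C) :
  chol f (p + cexp z) l -> chol (fun w => f (p + cexp w)) z (l * cexp z).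
Proof.
move=> df; apply: (@chol_comp R f (fun w => p + cexp w) z _ _ df).
by have := cholD (chol_cst p z) (chol_cexp z); rewrite add0r.
Qed.

(** Under z = p + exp w a punctured disc around [p] becomes a left half-plane, which is convex, so
    that Goursat's theorem applies where it would not in the [z] plane. *)
Lemma halfplane_convex (s : R) : convexC [set z : C | complex.Re z <= s].
Proof.
move=> a b t /= ar br /andP[t0 t1]; rewrite /seg.
case: a b ar br => [a1 a2] [b1 b2] /= ar br; rewrite !mul0r subr0.
have : 0 <= (1 - t) * (s - a1) by rewrite mulr_ge0 ?subr_ge0.
have : 0 <= t * (s - b1) by rewrite mulr_ge0 ?subr_ge0.
lra.
Qed.

Lemma halfplane_limclosed (s : R) : limclosed [set z : C | complex.Re z <= s].
Proof.
move=> z H /=; apply/ler_addgt0Pl => e e0; have [a /= ar az] := H e e0.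
have := le_lt_trans (Re_le_nrm (a - z)) az; rewrite raddfB /= ltr_norml; lra.
Qed.

Lemma SI_shift (G : C -> C) (a b c : C) :
  (forall w, G (w + c) = G w) -> SI G (a + c) (b + c) = SI G a b.
Proof.
move=> Gc; rewrite /SI; congr CI; apply/funext => t.
have -> : b + c - (a + c) = b - a by ring.
have -> : seg (a + c) (b + c) t = seg a b t + c by rewrite /seg; ring.
by rewrite Gc.
Qed.

(** Two triangles tile the parallelogram with vertices [w0], [w0 + c], [w1 + c], [w1]; its other two
    sides are translates by the period and cancel. *)
Lemma SI_period (G : C -> C) (c w0 w1 : C) : complex.Re c = 0 ->
  (forall w, G (w + c) = G w) ->
  (forall w, complex.Re w <= complex.Re w0 -> exists l, chol G w l) ->
  complex.Re w1 <= complex.Re w0 ->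
  SI G w0 (w0 + c) = SI G w1 (w1 + c).
Proof.
move=> c0 Gc dG w10.
have cv := @halfplane_convex (complex.Re w0).
have lc := @halfplane_limclosed (complex.Re w0).
have D0 : [set z : C | complex.Re z <= complex.Re w0] w0 by exact: lexx.
have D1 : [set z : C | complex.Re z <= complex.Re w0] w1 by exact: w10.
have D0' : [set z : C | complex.Re z <= complex.Re w0] (w0 + c).
  by rewrite /= raddfD /= c0 addr0.
have D1' : [set z : C | complex.Re z <= complex.Re w0] (w1 + c).
  by rewrite /= raddfD /= c0 addr0.
have E1 := goursat_triangle cv lc dG D0 D0' D1'.
have E2 := goursat_triangle cv lc dG D0 D1' D1.
move: E1 E2; rewrite /circ (SI_rev cv dG D0 D1') (SI_rev cv dG D1 D1').
rewrite (SI_rev cv dG D0 D1) (SI_shift w0 w1 Gc) => E1 E2.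
have : SI G w0 (w0 + c) - SI G w1 (w1 + c) = 0.
  by rewrite -[RHS]addr0 -[X in _ = X + _]E1 -E2; ring.
by move/eqP; rewrite subr_eq0 => /eqP.
Qed.

(* The substitution z = p + exp w turns the circles around p into vertical
   segments of length 2 pi, on which the integral of f(p + exp w) exp(- w) is
   independent of Re w; the value is read off as Re w tends to -oo. *)
Lemma cauchy_derivative (f : C -> C) (p w0 l : C) (r : R) :
  (forall z, nrm (z - p) < r -> exists l, chol f z l) -> chol f p l ->
  expR (complex.Re w0) < r ->
  SI (fun w => f (p + cexp w) * cexp (- w)) w0 (w0 + tau) = l * tau.
Proof.
move=> df dfp w0r; set G := fun w => _.
have dG w : complex.Re w <= complex.Re w0 -> exists l, chol G w l.
  move=> ww0; have [|k dk] := df (p + cexp w).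
    by rewrite addrC addKr nrm_cexp (le_lt_trans _ w0r) // ler_expR.
  exists (k * cexp w * cexp (- w) + f (p + cexp w) * (- cexp (- w))).
  by apply: cholM; [exact: chol_shift_cexp | exact: chol_cexpN].
have Gper w : G (w + tau) = G w.
  rewrite /G opprD !cexpD /tau cexp_2pi mulr1.
  have -> : cexp (- (0 +i* (pi *+ 2)) : C) = 1.
    by have := cexpNK (0 +i* (pi *+ 2) : C); rewrite cexp_2pi mul1r.
  by rewrite mulr1.
apply/eqP; rewrite -subr_eq0 -nrm_eq0 eq_le nrm_ge0 andbT.
apply/ler_addgt0Pl => e e0; rewrite addr0.
pose B := 2 * (nrm tau + 1).
have B0 : 0 < B by rewrite mulr_gt0 // ltr_wpDl ?nrm_ge0.
have e1 : 0 < e / B by rewrite divr_gt0.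
have /nbhs_complexP[d d0 dP] := dfp _ e1.
pose s := Num.min (complex.Re w0) (ln (d / 2)).
have d2 : 0 < d / 2 by rewrite divr_gt0.
have sd : expR s < d.
  apply: (@le_lt_trans _ _ (d / 2)); last by lra.
  by rewrite -[leRHS](lnK d2) ler_expR ge_min lexx orbT.
have sw0 : s <= complex.Re w0 by rewrite ge_min lexx.
rewrite (@SI_period G tau w0 s%:C) //.
(* [g] is the contribution of the affine part of [f] at [p]: its primitive - f(p) exp(- w) + l w
   grows by exactly [l * tau] over a period. In the remainder [h] the factor exp(- w) compensates
   the |exp w| of the error bound. *)
pose g w := f p * cexp (- w) + l; pose h w := G w - g w.
have segRe t : complex.Re (seg s%:C (s%:C + tau) t) = s.
  by rewrite seg_tau /= !mul0r mulr0 subr0 addr0.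
have dg w : exists k, chol g w k.
  exists (f p * (- cexp (- w)) + 0); apply: cholD; last exact: chol_cst.
  by apply: cholZ; exact: chol_cexpN.
have dGs t : exists k, chol G (seg s%:C (s%:C + tau) t) k.
  by apply: dG; rewrite segRe.
have cg w : ccontC g w by have [k /ccont_chol] := dg w.
have ch t : ccontC h (seg s%:C (s%:C + tau) t).
  by apply: ccontCB => //; have [k /ccont_chol] := dGs t.
have -> : SI G s%:C (s%:C + tau) = SI g s%:C (s%:C + tau) + SI h s%:C (s%:C + tau).
  rewrite -SI_D; [|by move=> t _; exact: cg|by move=> t _; exact: ch].
  by congr SI; apply/funext => w; rewrite /h addrC subrK.
rewrite (@SI_primitive R g (fun w => - f p * cexp (- w) + l * w)); last 2 first.
- move=> t _; apply: chol_eq (cholD (cholZ _ (chol_cexpN _)) (cholZ l (chol_id _))).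
  by rewrite /g; ring.
- by move=> t _; exact: cg.
have tauN : cexp (- tau) = 1.
  by have := cexpNK tau; rewrite /tau cexp_2pi mul1r.
rewrite [- (_ + tau)]opprD cexpD tauN.
set E := SI h _ _.
have -> : - f p * (cexp (- s%:C) * 1) + l * (s%:C + tau) -
  (- f p * cexp (- s%:C) + l * s%:C) + E - l * tau = E by ring.
have tau1 : 0 < nrm tau + 1 by rewrite ltr_wpDl ?nrm_ge0.
have -> : e = 2 * (e / B) * (nrm tau + 1) by rewrite /B; field; rewrite gt_eqF.
apply: le_trans (nrm_SI (B := e / B) _ _) _ => [t _|t _|].
- exact: ch.
- set w := seg _ _ _.
  have wd : nrm (cexp w) < d by rewrite nrm_cexp segRe.
  have -> : h w = (f (p + cexp w) - f p - cexp w * l) * cexp (- w).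
    rewrite /h /G /g !mulrBl [_ * l * _]mulrAC cexpNK; ring.
  have := dP (p + cexp w); rewrite addrC addKr => /(_ wd) H.
  rewrite nrmM; apply: le_trans (ler_wpM2r (nrm_ge0 _) H) _.
  by rewrite -mulrA -nrmM cexpNK nrm1 mulr1.
- apply: ler_wpM2l; first by rewrite mulr_ge0 // ltW.
  have -> : s%:C + tau - s%:C = tau by ring.
  by rewrite lerDl.
Qed.

Lemma tau_neq0 : tau != 0.
Proof.
by rewrite eq_complex /= eqxx /= mulrn_eq0 /= gt_eqF // pi_gt0.
Qed.

Lemma cauchy_derivative_CI (f : C -> C) (p w0 l : C) (r : R) :
  (forall z, nrm (z - p) < r -> exists l, chol f z l) -> chol f p l ->
  expR (complex.Re w0) < r ->
  CI (fun t => f (p + cexp (w0 + t%:C * tau)) * cexp (- (w0 + t%:C * tau)) * tau) =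
  l * tau.
Proof.
move=> df dp w0r; rewrite -(cauchy_derivative df dp w0r) /SI; congr CI.
apply/funext => t; rewrite seg_tau; congr (_ * _); ring.
Qed.

(** Apply the derivative formula to (z - p) f(z): its derivative at [p] is [f p], and z - p = exp w
    cancels the factor exp(- w). *)
Lemma mean_value (f : C -> C) (p w0 : C) (r : R) :
  (forall z, nrm (z - p) < r -> exists l, chol f z l) ->
  expR (complex.Re w0) < r ->
  CI (fun t => f (p + cexp (w0 + t%:C * tau)) * tau) = f p * tau.
Proof.
move=> df w0r.
have r0 : 0 < r by apply: lt_trans w0r; exact: expR_gt0.
have dg z : nrm (z - p) < r -> exists l, chol (fun z => (z - p) * f z) z l.
  move=> /df[l dl]; exists ((1 - 0) * f z + (z - p) * l).
  by apply: cholM => //; apply: cholB; [exact: chol_id | exact: chol_cst].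
have dgp : chol (fun z => (z - p) * f z) p (f p).
  have [|l dl] := df p; first by rewrite subrr nrm0.
  apply: chol_eq (cholM (cholB (chol_id p) (chol_cst p p)) dl).
  by rewrite subrr mul0r addr0 subr0 mul1r.
rewrite -(cauchy_derivative_CI dg dgp w0r); congr CI; apply/funext => t.
rewrite [p + _]addrC addrK; congr (_ * _).
by rewrite mulrAC cexpNK mul1r addrC.
Qed.

End CauchyFormula.

(** * Continuity of the derivative and the maximum principle *)

Section Consequences.
Variable R : realType.
Local Notation C := R[i].
Local Notation tau := (tau R).

Lemma Re_shift_tau (w : C) (t : R) : complex.Re (w + t%:C * tau) = complex.Re w.
Proof. by case: w => a b /=; rewrite !mul0r mulr0 subr0 addr0. Qed.

Lemma ccont_circle (w : C) (t : R) : ccont (fun t : R => cexp (w + t%:C * tau)) t.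
Proof.
apply: (@ccont_comp R R (@cexp R) (fun t : R => w + t%:C * tau)).
  exact: ccont_chol (chol_cexp _).
apply: ccontD; first exact: ccont_cst.
by apply: ccontM; [exact: ccont_real | exact: ccont_cst].
Qed.

Lemma ccont_on_circle (f : C -> C) (q w : C) (r t : R) :
  (forall z, nrm (z - q) < r -> exists l, chol f z l) ->
  expR (complex.Re w) < r -> ccont (fun t : R => f (q + cexp (w + t%:C * tau))) t.
Proof.
move=> df wr; apply: (@ccont_comp R R f (fun t : R => q + cexp (w + t%:C * tau))).
  have [|l /ccont_chol //] := df (q + cexp (w + t%:C * tau)).
  by rewrite addrC addKr nrm_cexp Re_shift_tau.
by apply: ccontD; [exact: ccont_cst | exact: ccont_circle].
Qed.

(** Cauchy's formula gives g(q) as an integral over a circle of fixed radius around [q], where [q]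
    enters only through the values of [f]; these vary uniformly by compactness of [0, 1]. *)
Lemma derivative_continuous (f g : C -> C) (p : C) (r : R) : 0 < r ->
  (forall z, nrm (z - p) < r -> chol f z (g z)) -> ccontC g p.
Proof.
move=> r0 df.
have r3 : 0 < r / 3 by rewrite divr_gt0.
pose w0 : C := (ln (r / 3))%:C.
have w0E : expR (complex.Re w0) = r / 3 by rewrite lnK.
pose u t := cexp (w0 + t%:C * tau).
have uE t : nrm (u t) = r / 3 by rewrite nrm_cexp Re_shift_tau.
have near_df q : nrm (q - p) < r / 3 ->
    forall z, nrm (z - q) < 2 * (r / 3) -> exists l, chol f z l.
  move=> qp z zq; exists (g z); apply: df.
  by have := nrm_tri z p q; lra.
have w0r : expR (complex.Re w0) < 2 * (r / 3) by rewrite w0E; lra.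
have formula q : nrm (q - p) < r / 3 ->
    CI (fun t => f (q + u t) * (cexp (- (w0 + t%:C * tau)) * tau)) = g q * tau.
  move=> qp; have dq : chol f q (g q) by apply: df; lra.
  rewrite -(cauchy_derivative_CI (near_df _ qp) dq w0r).
  by congr CI; apply/funext => t; rewrite mulrA.
have cexpu t : ccont (fun t : R => cexp (- (w0 + t%:C * tau)) * tau) t.
  apply: ccontM; last exact: ccont_cst.
  apply: (@ccont_comp R R (fun w => cexp (- w)) (fun t : R => w0 + t%:C * tau)).
    exact: ccont_chol (chol_cexpN _).
  apply: ccontD; first exact: ccont_cst.
  by apply: ccontM; [exact: ccont_real | exact: ccont_cst].
have cfu q : nrm (q - p) < r / 3 -> forall t : R,
    ccont (fun t : R => f (q + u t) * (cexp (- (w0 + t%:C * tau)) * tau)) t.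
  move=> qp t; apply: ccontM; last exact: cexpu.
  exact: ccont_on_circle (near_df _ qp) w0r.
have pp : nrm (p - p) < r / 3 by rewrite subrr nrm0.
move=> e e0.
(* The integral estimate costs a factor 2 and |exp(- w)| = 3 / r on the circle, so the total is 2 e
   / 3, up to |tau| on both sides. *)
pose e1 := e * (r / 3) / 3.
have e10 : 0 < e1 by rewrite divr_gt0 // mulr_gt0.
have unif : \forall q \near (p : C^o),
    `[0, 1] `<=` [set t : R | nrm (f (q + u t) - f (p + u t)) < e1].
  have /compact_near_coveringP/(_ C^o (nbhs (p : C^o))
    (fun q t => nrm (f (q + u t) - f (p + u t)) < e1)) := @segment_compact R 0 1.
  apply=> t _.
  have e2 : 0 < e1 / 2 by rewrite divr_gt0.
  have /ccont_chol : chol f (p + u t) (g (p + u t)).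
    by apply: df; rewrite addrC addKr uE; lra.
  move=> /(_ _ e2) /nbhs_complexP[d d0 dP].
  have d2 : 0 < d / 2 by rewrite divr_gt0.
  have := @ccont_circle w0 t _ d2.
  have : \forall q \near (p : C^o), nrm (q - p) < d / 2.
    by apply/nbhs_complexP; exists (d / 2).
  move=> nq nt; near=> t' q => /=.
  have qp : nrm (q - p) < d / 2 by near: q.
  have tt : nrm (u t' - u t) < d / 2 by near: t'.
  have H1 : nrm (f (q + u t') - f (p + u t)) < e1 / 2.
    apply: dP; have -> : q + u t' - (p + u t) = (q - p) + (u t' - u t) by ring.
    by apply: le_lt_trans (nrmD _ _) _; lra.
  have H2 : nrm (f (p + u t') - f (p + u t)) < e1 / 2.
    apply: dP; have -> : p + u t' - (p + u t) = u t' - u t by ring.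
    lra.
  have := nrm_tri (f (q + u t')) (f (p + u t')) (f (p + u t)).
  by rewrite [nrm (f (p + u t) - _)]nrmB; lra.
have near_p : \forall q \near (p : C^o), nrm (q - p) < r / 3.
  by apply/nbhs_complexP; exists (r / 3).
near=> q.
have qp : nrm (q - p) < r / 3 by near: q.
have H : `[0, 1] `<=` [set t : R | nrm (f (q + u t) - f (p + u t)) < e1] by near: q.
have tau0 : 0 < nrm tau by rewrite nrm_gt0 tau_neq0.
rewrite -(ltr_pM2r tau0) -nrmM mulrBl -(formula _ qp) -(formula _ pp).
have := CI_lin (-1) (fun t _ => cfu p pp t) (fun t _ => cfu q qp t).
rewrite mulN1r addrC => <-.
have lt2 : 2 * (e1 * (3 / r) * nrm tau) < e * nrm tau.
  rewrite mulrA ltr_pM2r //.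
  have -> : 2 * (e1 * (3 / r)) = 2 / 3 * e by rewrite /e1; field; rewrite gt_eqF.
  lra.
apply: le_lt_trans lt2; apply: nrm_CI => t t01.
  apply: ccontD; last exact: cfu.
  by apply: ccontM; [exact: ccont_cst | exact: cfu].
set E := cexp _ * tau.
have -> : -1 * (f (p + u t) * E) + f (q + u t) * E = (f (q + u t) - f (p + u t)) * E.
  by ring.
have nE : nrm E = 3 / r * nrm tau.
  rewrite /E nrmM nrm_cexp raddfN /= -[X in - X]/(complex.Re (w0 + t%:C * tau)).
  by rewrite Re_shift_tau expRN w0E invf_div.
rewrite nrmM nE mulrA ler_wpM2r ?nrm_ge0 // ler_wpM2r ?divr_ge0 ?(ltW r0) //.
by apply: ltW; apply: H; rewrite /= in_itv.
Unshelve. all: by end_near. Qed.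

(** The mean of Im F over the circle through [z] is Im F(p), and no value exceeds it. Hence the
    primitive [Q] of the nonnegative defect has equal values at 0 and 1, is monotone and so
    constant, and the defect vanishes. *)
Lemma maximum_principle (F : C -> C) (p : C) (r : R) :
  (forall z, nrm (z - p) < r -> exists l, chol F z l) ->
  (forall z, nrm (z - p) < r -> complex.Im (F z) <= complex.Im (F p)) ->
  forall z, nrm (z - p) < r -> complex.Im (F z) = complex.Im (F p).
Proof.
move=> dF Fmax z zr.
have [->//|zp] := eqVneq z p.
have [w1 w1E] : exists w, cexp w = z - p by apply: cexp_surj; rewrite subr_eq0.
(* Starting half a turn earlier puts [z] at the parameter 1/2, an interior point, where constancy of
   [Q] on [0, 1] determines its derivative. *)
pose w0 := w1 + (- 2^-1)%:C * tau.
have w0r : expR (complex.Re w0) < r by rewrite Re_shift_tau -nrm_cexp w1E.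
pose k (t : R) := F (p + cexp (w0 + t%:C * tau)).
have khalf : k 2^-1 = F z.
  rewrite /k /w0 -addrA -mulrDl -rmorphD addNr rmorph0 mul0r addr0 w1E.
  by rewrite addrC subrK.
have ck t : ccont (fun t => k t * tau) t.
  apply: ccontM; last exact: ccont_cst.
  exact: ccont_on_circle dF w0r.
have kle t : complex.Im (k t) <= complex.Im (F p).
  by apply: Fmax; rewrite addrC addKr nrm_cexp Re_shift_tau.
have [P [PE dP]] := CI_antiderivative (fun t _ => ck t).
have := mean_value dF w0r; rewrite -/k PE => PF.
pose T : R := pi *+ 2.
have T0 : 0 < T by rewrite mulrn_wgt0 // pi_gt0.
have ReM (c : C) : complex.Re (c * tau) = - (complex.Im c * T).
  by case: c => a b /=; rewrite mulr0 sub0r.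
pose m := complex.Im (F p).
pose Q (t : R) := complex.Re (P t) + T * m * t.
have dQ (t : R) : 0 <= t <= 1 -> is_derive t 1 Q (T * (m - complex.Im (k t))).
  move=> t01; have H := rcurve_Re (dP t t01).
  have -> : T * (m - complex.Im (k t)) = complex.Re (k t * tau) + T * m * 1.
    by rewrite ReM; ring.
  apply: is_deriveD; apply: is_deriveZ; exact: is_derive_id.
have Q01 : Q 1 = Q 0.
  have : complex.Re (P 1 - P 0) = - (m * T) by rewrite PF ReM.
  by rewrite raddfB /= /Q; lra.
have Qmono : {in `[0, 1] &, {homo Q : x y / x <= y}}.
  apply: ger0_derive1_le_cc => [t|t|].
  - by rewrite in_itv /= => /andP[t0 t1]; have [|//] := dQ t; rewrite !ltW.
  - rewrite in_itv /= => /andP[t0 t1]; rewrite derive1E.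
    have [|_ ->] := dQ t; first by rewrite !ltW.
    by rewrite mulr_ge0 ?(ltW T0) // subr_ge0.
  - apply: derivable_within_continuous => t; rewrite in_itv /= => t01.
    by have [] := dQ t t01.
have Qcst t : 0 <= t <= 1 -> Q t = Q 0.
  move=> t01; have /andP[t0 t1] := t01.
  apply/eqP; rewrite eq_le -{1}Q01 !Qmono // in_itv /= ?lexx ?ler01 //.
have d0 : is_derive (2^-1 : R) 1 Q 0.
  apply: (@derive1_at_max R Q 0 1) => //.
  - by move=> t; rewrite in_itv /= => /andP[t0 t1]; have [|//] := dQ t; rewrite !ltW.
  - by rewrite in_itv /=; apply/andP; split; lra.
  - move=> t; rewrite in_itv /= => /andP[t0 t1].
    by rewrite !Qcst //; lra.
have half01 : (0 : R) <= 2^-1 <= (1 : R) by apply/andP; split; lra.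
have [_ e1] := dQ _ half01; have [_ e2] := d0.
move: e1; rewrite e2 khalf => /esym/eqP; rewrite mulf_eq0 gt_eqF //= subr_eq0.
by move=> /eqP.
Qed.

End Consequences.

(** * Integration on the surface *)

Section Curves.
Variables (R : realType) (T : topologicalType) (S : riemann_surface R T).
Local Notation C := R[i].
Implicit Types (i j : chart S) (p : T) (g : R -> T) (w : one_form S).

Lemma chart_ball i p : dom i p -> exists2 r : R, 0 < r &
  forall z, nrm (z - zcoord i p) < r -> dom i (param i z) /\ zcoord i (param i z) = z.
Proof.
move=> ip; have : nbhs (zcoord i p : C^o) (zcoord i @` dom i).
  by apply: open_nbhs_nbhs; split; [exact: image_open | exists p].
move=> /nbhs_complexP[r r0 rP]; exists r => // z /rP[q iq <-].
by rewrite zcoordK.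
Qed.

Lemma near_dom i g t : {for t, continuous g} -> dom i (g t) ->
  \forall s \near t, dom i (g s).
Proof.
move=> cg it; apply: cg; apply: open_nbhs_nbhs; split => //; exact: dom_open.
Qed.

Lemma transition_chol i j p : dom i p -> dom j p ->
  chol (zcoord j \o param i) (zcoord i p) (cderiv (zcoord j \o param i) (zcoord i p)).
Proof.
by move=> ip jp; apply/holomorphic_atP; split => //; exact: transition_holomorphic.
Qed.

Lemma rcurve_chart i j g t v : {for t, continuous g} -> dom i (g t) -> dom j (g t) ->
  rcurve (zcoord i \o g) t v ->
  rcurve (zcoord j \o g) t (cderiv (zcoord j \o param i) (zcoord i (g t)) * v).
Proof.
move=> cg it jt dg.
have := hasd_comp (@ccont_real R) (transition_chol it jt) dg.
apply: hasd_near; near=> s.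
rewrite /= zcoordK //; near: s; exact: near_dom.
Unshelve. all: by end_near. Qed.

Lemma holo_form_chol w i p : holo_form w -> dom i p ->
  exists l, chol (w i) (zcoord i p) l.
Proof.
move=> [hw _] ip; exists (cderiv (w i) (zcoord i p)).
by apply/holomorphic_atP; split => //; exact: hw.
Qed.

Lemma pullbackE w i g t v : holo_form w -> {for t, continuous g} -> dom i (g t) ->
  rcurve (zcoord i \o g) t v -> pullback w g t = w i (zcoord i (g t)) * v.
Proof.
move=> [_ hw] cg it dg; rewrite /pullback; set j := chart_at S (g t).
have jt : dom j (g t) by exact: dom_chart_at.
have dgj := rcurve_chart cg it jt dg.
have [_ ->] := (Dt_rcurveP _ _ _).2 dgj.
by rewrite (hw i j) // mulrA.
Qed.

Lemma C1map_rcurve i g t : C1map S g -> dom i (g t) ->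
  rcurve (zcoord i \o g) t (Dt (zcoord i \o g) t).
Proof.
by move=> [_ /(_ i t) H] /H /(_ 1) [d1 d2 _ _]; apply/Dt_rcurveP; split.
Qed.

Lemma C1map_Dt_ccont i g t : C1map S g -> dom i (g t) -> ccont (Dt (zcoord i \o g)) t.
Proof.
by move=> [_ /(_ i t) H] /H /(_ 1) [_ _ c1 c2]; apply/ccont_ReP; split.
Qed.

Lemma C1map_zcoord_ccont i g t : C1map S g -> dom i (g t) -> ccont (zcoord i \o g) t.
Proof. by move=> hg it; exact: ccont_rcurve (C1map_rcurve hg it). Qed.

(** The chart chosen in [pullback] depends on the point without any continuity; near [t] it is
    exchanged for the fixed chart around [g t]. *)
Lemma pullback_ccont w g t : holo_form w -> C1map S g -> ccont (pullback w g) t.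
Proof.
move=> hw hg; have cg := hg.1; set i := chart_at S (g t).
have it : dom i (g t) by exact: dom_chart_at.
apply: (@ccont_near _ _ (fun s => w i (zcoord i (g s)) * Dt (zcoord i \o g) s)).
  near=> s; apply/esym; have id_s : dom i (g s) by near: s; exact: near_dom (cg t) it.
  by apply: pullbackE (cg s) _ _ => //; exact: C1map_rcurve.
apply: ccontM; last exact: C1map_Dt_ccont.
have [l /ccont_chol cw] := holo_form_chol hw it.
exact: (@ccont_comp R R (w i) (zcoord i \o g) t cw (C1map_zcoord_ccont hg it)).
Unshelve. all: by end_near. Qed.

Lemma path_integral_primitive w i g (F : C -> C) : holo_form w -> C1map S g ->
  (forall t, 0 <= t <= 1 ->
     dom i (g t) /\ chol F (zcoord i (g t)) (w i (zcoord i (g t)))) ->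
  path_integral w g = F (zcoord i (g 1)) - F (zcoord i (g 0)).
Proof.
move=> hw hg H.
rewrite -[LHS]/(CI (pullback w g)) (@CI_FTC _ _ (F \o (zcoord i \o g))) //.
  by move=> t _; exact: pullback_ccont.
move=> t t01; have [it dF] := H t t01.
rewrite (pullbackE hw _ it (C1map_rcurve hg it)); last exact: hg.1.
exact: (hasd_comp (@ccont_real R) dF (C1map_rcurve hg it)).
Qed.

(** [coef] identifies arcs by their restrictions to [0, 1]; integrals must respect this
    identification. *)
Lemma path_integral_eq w g g' : holo_form w -> C1map S g ->
  (forall t, 0 <= t <= 1 -> g t = g' t) -> path_integral w g = path_integral w g'.
Proof.
move=> hw hg gg'; apply: (@CI_ext R (pullback w g) (pullback w g')).
  by move=> t _; exact: pullback_ccont.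
move=> t t01; rewrite /pullback.
have tt : g t = g' t by apply: gg'; case/andP: t01 => a b; rewrite !ltW.
rewrite -tt; congr (_ * _).
have it := dom_chart_at S (g t).
have dg' : rcurve (zcoord (chart_at S (g t)) \o g') t (Dt (zcoord (chart_at S (g t)) \o g) t).
  apply: hasd_near (C1map_rcurve hg it); near=> s => /=.
  have /andP[s0 s1] : 0 < s < 1.
    by near: s; apply: near_in_itvoo; rewrite in_itv.
  by rewrite (gg' s) // !ltW.
by have [_ ->] := (Dt_rcurveP _ _ _).2 dg'.
Unshelve. all: by end_near. Qed.

Lemma derive_scale (u : R -> R) (x v d : R) : is_derive x 1 u d -> is_derive x v u (v * d).
Proof.
move=> [du dE]; have ud : differentiable u x by apply/derivable1_diffP.
apply: DeriveDef; first exact: diff_derivable.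
rewrite deriveE // -dE deriveE // -[in LHS](mulr1 v) -[v * 1]/(v *: (1 : R)).
by rewrite linearZ.
Qed.

Lemma C1map_intro g :
  (forall t, {for t, continuous g}) ->
  (forall i t, dom i (g t) -> exists v : R -> C,
    (\forall s \near t, rcurve (zcoord i \o g) s (v s)) /\ ccont v t) ->
  C1map S g.
Proof.
move=> cg H; split => // i x ix d u u'.
have [v [dv /ccont_ReP[cr ci]]] := H i x ix.
have du : \forall s \near x, is_derive s d u (d * complex.Re (v s)).
  by near=> s; apply: derive_scale; apply: rcurve_Re; near: s.
have du' : \forall s \near x, is_derive s d u' (d * complex.Im (v s)).
  by near=> s; apply: derive_scale; apply: rcurve_Im; near: s.
split.
- by have [] := nbhs_singleton du.
- by have [] := nbhs_singleton du'.
- have E : 'D_d u x = d * complex.Re (v x) by have [] := nbhs_singleton du.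
  rewrite /prop_for /continuous_at E.
  have cr' : (fun s => d * complex.Re (v s)) @ x --> d * complex.Re (v x).
    by apply: cvgM; [exact: cvg_cst | exact: cr].
  apply: cvg_trans cr'.
  apply: near_eq_cvg; near=> s.
  by have [_ ->] : is_derive s d u (d * complex.Re (v s)) by near: s.
- have E : 'D_d u' x = d * complex.Im (v x) by have [] := nbhs_singleton du'.
  rewrite /prop_for /continuous_at E.
  have cr' : (fun s => d * complex.Im (v s)) @ x --> d * complex.Im (v x).
    by apply: cvgM; [exact: cvg_cst | exact: ci].
  apply: cvg_trans cr'.
  apply: near_eq_cvg; near=> s.
  by have [_ ->] : is_derive s d u' (d * complex.Im (v s)) by near: s.
Unshelve. all: by end_near. Qed.

(* [C1map] asks for continuous derivatives in every chart, so an arc that is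
   smooth in one chart is C^1 only thanks to this continuity. *)
Lemma transition_derivative_ccont i j p : dom i p -> dom j p ->
  ccontC (cderiv (zcoord j \o param i)) (zcoord i p).
Proof.
move=> ip jp; have [r r0 rP] := chart_ball ip.
have : nbhs (zcoord i p : C^o) [set z | dom j (param i z)].
  have := param_continuous ip; rewrite /prop_for /continuous_at /= zcoordK //; apply.
  by apply: open_nbhs_nbhs; split => //; exact: dom_open.
move=> /nbhs_complexP[s s0 sP].
apply: (@derivative_continuous R (zcoord j \o param i) _ _ (Num.min r s)).
  by rewrite lt_min r0.
move=> z; rewrite lt_min => /andP[zr zs].
have [iz zE] := rP z zr; have := transition_chol iz (sP z zs).
by rewrite zE.
Qed.

Lemma C1map_param i (c c' : R -> C) :
  (forall t, dom i (param i (c t)) /\ zcoord i (param i (c t)) = c t) ->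
  (forall t, rcurve c t (c' t)) -> (forall t, ccont c' t) ->
  C1map S (param i \o c).
Proof.
move=> cdom dc cc'.
have cc t : ccont c t by exact: ccont_rcurve (dc t).
have cg t : {for t, continuous (param i \o c)}.
  have [it itE] := cdom t.
  apply: (@continuous_comp _ (C^o) _ (c : R -> C^o)); first exact/ccontP.
  by have := param_continuous it; rewrite itE.
apply: C1map_intro => // j t jt.
have [it itE] := cdom t.
exists (fun s => cderiv (zcoord j \o param i) (c s) * c' s); split.
  near=> s; have [is_ isE] := cdom s.
  have js : dom j ((param i \o c) s) by near: s; exact: near_dom.
  have dci : rcurve (zcoord i \o (param i \o c)) s (c' s).
    suff -> : zcoord i \o (param i \o c) = c by [].
    by apply/funext => x; have [_ cE] := cdom x.
  by have := rcurve_chart (cg s) is_ js dci; rewrite [zcoord i _]isE.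
apply: ccontM; last exact: cc'.
apply: (@ccont_comp R R (cderiv (zcoord j \o param i)) c) => //.
by have := transition_derivative_ccont it jt; rewrite itE.
Unshelve. all: by end_near. Qed.

End Curves.

(** * Arcs in charts and paths between points *)

Section Reachability.
Variables (R : realType) (T : topologicalType) (S : riemann_surface R T).
Local Notation C := R[i].
Implicit Types (i j : chart S) (p q : T) (g : R -> T) (w : one_form S).

(* A smooth reparametrization of [0, 1] with values in [0, 1] on all of [R], as
   the arcs must be defined on the whole line. *)
Definition ease (t : R) : R := (1 - cos (pi * t)) / 2.

Lemma ease01 t : 0 <= ease t <= 1.
Proof.
by have := cos_geN1 (pi * t); have := cos_le1 (pi * t); rewrite /ease; lra.
Qed.

Lemma is_derive_ease (t : R) : is_derive t 1 ease (pi * sin (pi * t) / 2).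
Proof.
have H : is_derive t 1 (fun s : R => pi * s) (pi * 1).
  by apply: is_deriveZ; exact: is_derive_id.
have H2 := is_derive1_comp (is_derive_cos (pi * t)) H.
have H3 := is_deriveB (is_derive_cst (1 : R) t 1) H2.
have -> : ease = 2^-1 \*: (cst 1 - (@cos R \o (fun s => pi * s))).
  by apply/funext => s; rewrite /ease mulrC.
have -> : pi * sin (pi * t) / 2 = 2^-1 *: (0 - (- sin (pi * t)) * (pi * 1)).
  by rewrite /GRing.scale /=; field.
exact: (is_deriveZ _ H3).
Qed.

Lemma ease_arc i (p : T) (r : R) (z q : C) :
  (forall z, nrm (z - zcoord i p) < r -> dom i (param i z) /\ zcoord i (param i z) = z) ->
  nrm (z - zcoord i p) < r -> nrm (q - zcoord i p) < r ->
  exists g, [/\ C1map S g, g 0 = param i z, g 1 = param i q &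
    forall t, dom i (g t) /\ nrm (zcoord i (g t) - zcoord i p) < r].
Proof.
move=> rP zr qr.
pose c t := seg z q (ease t).
have cr t : nrm (c t - zcoord i p) < r.
  apply: (@le_lt_trans _ _ (Num.max (nrm (z - zcoord i p)) (nrm (q - zcoord i p)))).
    by apply: seg_ball (ease01 t); rewrite le_max lexx ?orbT.
  by rewrite gt_max zr qr.
exists (param i \o c); split.
- apply: (@C1map_param _ _ _ i c (fun t => (pi * sin (pi * t) / 2)%:C * (q - z))).
  + by move=> t; exact: rP.
  + move=> t; rewrite /c /seg.
    have de : rcurve (fun s => (ease s)%:C) t (pi * sin (pi * t) / 2)%:C.
      have d0 : is_derive (t : R) 1 (fun _ : R => 0 : R) 0 by exact: is_derive_cst.
      exact: (rcurve_ReIm (is_derive_ease t) d0).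
    have := hasdD (hasd_cst _ z t) (hasdM (@ccont_real R) de (hasd_cst _ (q - z) t)).
    by rewrite mulr0 addr0 add0r.
  + move=> t; apply: ccontM; last exact: ccont_cst.
    apply/ccont_ReP; split; last exact: cst_continuous.
    apply: (@continuous_comp _ _ _ (fun t : R => pi * t) (fun u => pi * sin u / 2)).
      by apply: cvgM; [exact: cvg_cst | exact: cvg_id].
    apply: cvgM; last exact: cvg_cst.
    by apply: cvgM; [exact: cvg_cst | exact: continuous_sin].
- by rewrite /= /c /ease mulr0 cos0 subrr mul0r seg0.
- rewrite /= /c /ease mulr1 cospi opprK.
  by have -> : (1 + 1) / 2 = 1 :> R; [field | rewrite seg1].
- by move=> t; have [it itE] := rP _ (cr t); split => //=; rewrite itE.
Qed.

Lemma joins_rcons p s q g : joins S p s q -> C1map S g -> g 0 = q ->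
  joins S p (rcons s g) (g 1).
Proof.
elim: s p => [|h s IH] p /=; first by move=> ->.
by move=> [hh h0 hs] hg g0; split => //; exact: IH.
Qed.

Lemma near_arcs p : \forall q \near p,
  (exists2 g : R -> T, C1map S g & g 0 = p /\ g 1 = q) /\
  (exists2 g : R -> T, C1map S g & g 0 = q /\ g 1 = p).
Proof.
pose i := chart_at S p; have ip : dom i p by exact: dom_chart_at.
have [r r0 rP] := chart_ball ip.
have : \forall q \near p, dom i q /\ nrm (zcoord i q - zcoord i p) < r.
  near=> q; split.
    by near: q; apply: open_nbhs_nbhs; split => //; exact: dom_open.
  by near: q; have /ccontP := zcoord_continuous ip; exact.
apply: filterS => q [iq qr].
have pr : nrm (zcoord i p - zcoord i p) < r by rewrite subrr nrm0.
have [g [g1 g2 g3 _]] := ease_arc rP pr qr.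
have [h [h1 h2 h3 _]] := ease_arc rP qr pr.
split; first by exists g; rewrite // g2 g3 !zcoordK.
by exists h; rewrite // h2 h3 !zcoordK.
Unshelve. all: by end_near. Qed.

(** The set of points reachable from [p] is open and closed: a path is prolonged by a short arc to a
    nearby point for the first, and from a nearby point for the second. *)
Lemma joins_exists : connected [set: T] -> forall p q, exists s, joins S p s q.
Proof.
move=> conT p q; pose B := [set q | exists s, joins S p s q].
suff BT : B = [set: T] by have : B q by rewrite BT.
apply: conT.
- by exists p, [::].
- exists B; last by rewrite setTI.
  rewrite openE => x [s sx]; rewrite /interior.
  apply: filterS (near_arcs x) => y [[g hg [g0 g1]] _].
  exists (rcons s g); rewrite -g1; exact: (joins_rcons _ hg g0).
- exists B; last by rewrite setTI.
  rewrite -openC openE => x nx; rewrite /interior.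
  apply: filterS (near_arcs x) => y [_ [g hg [g0 g1]]] [s sy]; apply: nx.
  exists (rcons s g); rewrite -g1; exact: (joins_rcons _ hg g0).
Qed.

Lemma C1map_line (f : R * R -> T) (x v : R * R) : C1map S f ->
  C1map S (fun t : R => f (x + t *: v)).
Proof.
move=> [cf df].
have cl (t : R) : {for t, continuous (fun t : R => x + t *: v)}.
  apply: cvgD; first exact: cvg_cst.
  by apply: cvgZr_tmp; exact: cvg_id.
split.
  by move=> t; apply: (@continuous_comp _ _ _ (fun t : R => x + t *: v) f); [exact: cl | exact: cf].
move=> i t it d u u'.
have [d1 d2 c1 c2] := df i _ it (d *: v).
(* [C1map] on the plane speaks of directional derivatives; the difference quotient along the line in
   direction [d] is literally that of the plane map in direction [d *: v]. *)
have E (h : R -> R) (k : R * R -> R) : h = (fun t => k (x + t *: v)) -> forall s : R,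
    (fun e : R => e^-1 *: (h (e *: d + s) - h s)) =
    (fun e : R => e^-1 *: (k (e *: (d *: v) + (x + s *: v)) - k (x + s *: v))).
  move=> -> s; apply/funext => e; congr (_ *: (k _ - _)).
  by rewrite scalerDl -[(e *: d) *: v]scalerA addrCA.
have Dl (h : R -> R) (k : R * R -> R) : h = (fun t => k (x + t *: v)) ->
    'D_d h = fun s : R => 'D_(d *: v) k (x + s *: v).
  by move=> hk; apply/funext => s; rewrite /derive /= (E h k hk).
split.
- by rewrite /derivable /= (E _ (fun y => complex.Re (zcoord i (f y)))).
- by rewrite /derivable /= (E _ (fun y => complex.Im (zcoord i (f y)))).
- rewrite (Dl _ (fun y => complex.Re (zcoord i (f y)))) //.
  by apply: (@continuous_comp _ _ _ (fun t : R => x + t *: v)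
            ('D_(d *: v) (fun y => complex.Re (zcoord i (f y))))) => //; exact: cl.
- rewrite (Dl _ (fun y => complex.Im (zcoord i (f y)))) //.
  by apply: (@continuous_comp _ _ _ (fun t : R => x + t *: v)
            ('D_(d *: v) (fun y => complex.Im (zcoord i (f y))))) => //; exact: cl.
Qed.

End Reachability.

(** * Closed forms integrate to zero over the boundary of a simplex *)

Section Stokes.
Variables (R : realType) (T : topologicalType) (S : riemann_surface R T).
Local Notation C := R[i].
Implicit Types (i j : chart S) (p q : T) (w : one_form S).

Lemma pullback_affine w (g : R -> T) (a b t : R) : holo_form w -> C1map S g ->
  pullback w (fun s : R => g (a + s * b)) t = pullback w g (a + t * b) * b%:C.
Proof.
move=> hw hg; pose i := chart_at S (g (a + t * b)).
have it : dom i (g (a + t * b)) by exact: dom_chart_at.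
have cg' : {for t, continuous (fun s : R => g (a + s * b))}.
  apply: (@continuous_comp _ _ _ (fun s : R => a + s * b) g); first exact: affine_continuous.
  exact: hg.1.
have dg := C1map_rcurve hg it.
have dg' : rcurve (zcoord i \o (fun s : R => g (a + s * b))) t
    (Dt (zcoord i \o g) (a + t * b) * b%:C).
  exact: (@rcurve_affine R (zcoord i \o g) a b t _ dg).
by rewrite (pullbackE hw cg' it dg') mulrA.
Qed.

Lemma holo_primitive w i p : holo_form w -> dom i p ->
  exists2 r : R, 0 < r & exists F : C -> C, forall z, nrm (z - zcoord i p) < r ->
    [/\ dom i (param i z), zcoord i (param i z) = z & chol F z (w i z)].
Proof.
move=> hw ip; have [r r0 rP] := chart_ball ip; exists r => //.
have [|F FP] := @local_primitive R (w i) (zcoord i p) r.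
  move=> z /rP[iz zE]; have := holo_form_chol hw iz; by rewrite zE.
by exists F => z zr; have [iz zE] := rP z zr; split => //; exact: FP.
Qed.

Definition plane (z : C) : R * R := (complex.Re z, complex.Im z).

Lemma plane_seg (a b : C) (t : R) : plane (seg a b t) = plane a + t *: plane (b - a).
Proof.
case: a b => [a1 a2] [b1 b2]; rewrite /plane /seg /=.
rewrite -[RHS]/(a1 + t * (b1 - a1), a2 + t * (b2 - a2)).
by congr (_, _); ring.
Qed.

Section Simplex.
Variables (w : one_form S) (f : R * R -> T).
Hypotheses (hw : holo_form w) (hf : C1map S f).

Let edge (a b : C) (t : R) : T := f (plane (seg a b t)).

Let J (a b : C) : C := path_integral w (edge a b).

Lemma edge_C1 a b : C1map S (edge a b).
Proof.
have -> : edge a b = fun t => f (plane a + t *: plane (b - a)).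
  by apply/funext => t; rewrite /edge plane_seg.
exact: C1map_line.
Qed.

Let pb a b t : ccont (pullback w (edge a b)) t.
Proof. by apply: pullback_ccont => //; exact: edge_C1. Qed.

Lemma edge_rev a b : J b a = - J a b.
Proof.
rewrite -[J a b]/(CI _) -CI_rev => [|t _]; last exact: pb.
rewrite -[J b a]/(CI _); congr CI; apply/funext => t.
rewrite -(pullback_affine 1 (-1) t hw (edge_C1 a b)); congr (pullback w _ t).
apply/funext => s; congr (f (plane _)).
by rewrite /seg mulrN1 realCB rmorph1; ring.
Qed.

Lemma edge_mid a b : J a b = J a (mid a b) + J (mid a b) b.
Proof.
have e2 : (2^-1)%:C = 2^-1 :> C by rewrite fmorphV rmorph_nat.
rewrite -[J a b]/(CI _) CI_halves => [|t _]; last exact: pb.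
rewrite -[J a _]/(CI _) -[J _ b]/(CI _); congr (CI _ + CI _); apply/funext => t.
  rewrite -(pullback_affine 0 (2^-1) t hw (edge_C1 a b)); congr (pullback w _ t).
  apply/funext => s; congr (f (plane _)).
  by rewrite /seg add0r realCM e2 /mid; field.
rewrite -(pullback_affine (2^-1) (2^-1) t hw (edge_C1 a b)); congr (pullback w _ t).
apply/funext => s; congr (f (plane _)).
by rewrite /seg realCD realCM e2 /mid; field.
Qed.

(** A small triangle is mapped into one chart disc, where the form has a primitive, so the integrals
    along its edges are differences that telescope. The local bound of the bisection argument holds
    with value 0. *)
Lemma edge_local (p : C) : exists2 d : R, 0 < d & forall r a b c, r < d ->
  nrm (a - p) <= r -> nrm (b - p) <= r -> nrm (c - p) <= r -> circ J a b c = 0.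
Proof.
pose i := chart_at S (f (plane p)).
have ip : dom i (f (plane p)) by exact: dom_chart_at.
have [r r0 [F FP]] := holo_primitive hw ip.
have nf : \forall x \near plane p,
    dom i (f x) /\ nrm (zcoord i (f x) - zcoord i (f (plane p))) < r.
  have cf : {for plane p, continuous f} by exact: hf.1.
  have : \forall q \near f (plane p),
      dom i q /\ nrm (zcoord i q - zcoord i (f (plane p))) < r; last by move=> /cf.
  near=> q; split.
    by near: q; apply: open_nbhs_nbhs; split => //; exact: dom_open.
  by near: q; have /ccontP := zcoord_continuous ip; exact.
move: nf => /nbhs_ballP[d /= d0 dP].
exists d => // s a b c sd ap bp cp.
have near_seg x y t : nrm (x - p) <= s -> nrm (y - p) <= s -> 0 <= t <= 1 ->
    dom i (edge x y t) /\ nrm (zcoord i (edge x y t) - zcoord i (f (plane p))) < r.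
  move=> xp yp t01; apply: dP.
  have := le_lt_trans (seg_ball xp yp t01) sd; rewrite nrmB => sb.
  by split; rewrite /= /ball /= -raddfB (le_lt_trans _ sb) // ?Re_le_nrm ?Im_le_nrm.
pose V (x : C) := F (zcoord i (f (plane x))).
have JE x y : nrm (x - p) <= s -> nrm (y - p) <= s -> J x y = V y - V x.
  move=> xp yp; rewrite /J (@path_integral_primitive _ _ _ w i _ F hw (edge_C1 x y)).
    by rewrite /edge seg0 seg1.
  move=> t t01; have [it zr] := near_seg x y t xp yp t01; split => //.
  by have [] := FP _ zr.
by rewrite /circ !JE //; ring.
Unshelve. all: by end_near. Qed.

Lemma simplex_boundary_integral (a b c : C) : circ J a b c = 0.
Proof.
(* The map [f] is C^1 on the whole plane, so no restriction on the triangles is required. *)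
apply: (@circ_eq0 R setT J) => //.
- by move=> x y _ _; exact: edge_mid.
- by move=> x y _ _; exact: edge_rev.
move=> p _ e e0; have [d d0 dP] := edge_local p.
exists d => // r x y z /andP[r0 rd] _ _ _ xr yr zr.
by rewrite (dP r) // nrm0 mulr_ge0 ?exprn_ge0 // ltW.
Qed.

Lemma faces_integral (k : int) :
  \sum_(x <- faces (k, f)) x.1%:~R * path_integral w x.2 = 0.
Proof.
have E a b (g : R -> T) : (forall t, f (plane (seg a b t)) = g t) ->
    path_integral w g = J a b.
  by move=> H; rewrite /J; congr path_integral; apply/funext => t; rewrite -H.
rewrite /faces !big_cons big_nil /=.
(* In the complex plane the vertices (0,0), (1,0), (0,1) of the simplex are 0, 1, i. *)
rewrite (E 1 'i); last first.
  by move=> t; congr f; rewrite /plane /seg /=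
    !(mul0r, mulr0, subr0, addr0, add0r, sub0r, oppr0); congr (_, _); ring.
rewrite (E 0 'i); last first.
  by move=> t; congr f; rewrite /plane /seg /=
    !(mul0r, mulr0, subr0, addr0, add0r, sub0r, mulr1, oppr0).
rewrite (E 0 1); last first.
  by move=> t; congr f; rewrite /plane /seg /=
    !(mul0r, mulr0, subr0, addr0, add0r, sub0r, mulr1, oppr0).
have H : J 0 1 + J 1 'i + - J 0 'i = 0.
  by rewrite -(edge_rev 0 'i); exact: simplex_boundary_integral.
move: (J 0 1) (J 1 'i) (J 0 'i) H => x y z H.
have -> : (- k)%:~R = - k%:~R :> C by rewrite mulrNz.
move: (k%:~R : C) => c; rewrite addr0 -[RHS](mulr0 c) -H; ring.
Qed.

End Simplex.
End Stokes.

(** * Homology invariance of periods and monodromy *)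

Section Homology.
Variables (R : realType) (T : topologicalType) (S : riemann_surface R T).
Local Notation C := R[i].
Implicit Types (w : one_form S) (c d : chain1 R T).

Lemma all_C1_cat (V : normedModType R) (c d : seq (int * (V -> T))) :
  all_C1 S (c ++ d) <-> all_C1 S c /\ all_C1 S d.
Proof.
elim: c => [|x c IH] /=; first by split=> [|[]].
by split=> [[hx /IH[]]|[[hx hc] hd]] //; split => //; apply/IH.
Qed.

Lemma all_C1_map (V : normedModType R) (k : int) (c : seq (int * (V -> T))) :
  all_C1 S c -> all_C1 S [seq (k * x.1, x.2) | x <- c].
Proof. by elim: c => [|x c IH] //= [hx /IH]. Qed.

Lemma all_C1_filter (V : normedModType R) (e : pred (int * (V -> T)))
    (c : seq (int * (V -> T))) : all_C1 S c -> all_C1 S [seq x <- c | e x].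
Proof. by elim: c => [|x c IH] //= [hx /IH]; case: ifP => //= _ ?; split. Qed.

Lemma period_cat w c d : period w (c ++ d) = period w c + period w d.
Proof. by rewrite /period big_cat. Qed.

Lemma period_scale w (k : int) c :
  period w [seq (k * x.1, x.2) | x <- c] = k%:~R * period w c.
Proof.
rewrite /period big_map big_distrr /=; apply: eq_bigr => x _.
by rewrite intrM mulrA.
Qed.

Lemma coef_cat c d g : coef (c ++ d) g = coef c g + coef d g.
Proof. by rewrite /coef big_cat. Qed.

Lemma coef_scale (k : int) c g : coef [seq (k * x.1, x.2) | x <- c] g = k * coef c g.
Proof.
rewrite /coef big_map big_distrr /=; apply: eq_bigr => x _.
by case: ifP => // _; rewrite mulr0.
Qed.

Let agree (g h : R -> T) : bool := `[< forall t, 0 <= t <= 1 -> g t = h t >].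

Let agree_sym g h : agree g h -> agree h g.
Proof. by move=> /asboolP H; apply/asboolP => t /H. Qed.

Let agree_trans g h k : agree g h -> agree h k -> agree g k.
Proof. by move=> /asboolP H /asboolP K; apply/asboolP => t t01; rewrite H // K. Qed.

(** All arcs of [c] that agree with [h] on [0, 1] have the same integral, and their multiplicities
    add up to the coefficient of [h]. *)
Lemma period_filter w c (h : R -> T) : holo_form w -> all_C1 S c -> C1map S h ->
  period w c = (coef c h)%:~R * path_integral w h +
               period w [seq x <- c | ~~ agree x.2 h].
Proof.
move=> hw + hh; elim: c => [|x c IH] /=.
  by rewrite /period /coef !big_nil mul0r addr0.
move=> [hx hc].
have E d x' : period w (x' :: d) = x'.1%:~R * path_integral w x'.2 + period w d.
  by rewrite /period big_cons.
have Ec : coef (x :: c) h = (if agree x.2 h then x.1 else 0) + coef c h.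
  by rewrite /coef big_cons.
rewrite E (IH hc) Ec; case: (boolP (agree x.2 h)) => /= xh.
  by rewrite -(path_integral_eq hw hx (asboolP _ xh)) intrD mulrDl addrA.
by rewrite E (add0r (coef c h)) [LHS]addrCA.
Qed.

(** A list can represent 0 in the free abelian group without being empty. Removing the whole class
    of the first arc leaves a shorter list that still represents 0, whence the induction on a bound
    for the length. *)
Lemma period_coef0 w c : holo_form w -> all_C1 S c -> (forall g, coef c g = 0) ->
  period w c = 0.
Proof.
move=> hw; move: {2}(size c) (leqnn (size c)) => n; elim: n c => [|n IH] [|x c] //=.
- by move=> _ _ _; rewrite /period big_nil.
- by move=> _ _ _; rewrite /period big_nil.
move=> sc [hx hc] c0.
have hxc : all_C1 S (x :: c) by split.
rewrite (period_filter hw hxc hx) c0 mul0r add0r.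
have xx : agree x.2 x.2 by apply/asboolP.
apply: IH; first 1 last.
- exact: all_C1_filter.
- move=> g; have [xg|xg] := boolP (agree x.2 g).
    rewrite /coef big_filter big1_seq // => y /andP[yx _]; case: ifP => // yg.
    by rewrite (agree_trans yg (agree_sym xg)) in yx.
  rewrite -(c0 g) /coef big_filter big_mkcond; apply: eq_bigr => y _.
  case: ifP => // /negbFE yx; case: ifP => // yg.
  by rewrite (agree_trans (agree_sym yx) yg) in xg.
by rewrite /= xx /= size_filter (leq_trans (count_size _ _)).
Qed.

Lemma all_C1_faces (x : int * (R * R -> T)) : C1map S x.2 -> all_C1 S (faces x).
Proof.
move=> hx; split; last split; last split => //.
- suff -> : (fun t : R => x.2 (1 - t, t)) =
    (fun t : R => x.2 (((1, 0) : R * R) + t *: ((-1, 1) : R * R))) by exact: C1map_line.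
  apply/funext => t; congr x.2.
  rewrite -[RHS]/(1 + t * (-1), 0 + t * 1) mulrN1 mulr1 add0r //.
- suff -> : (fun t : R => x.2 (0, t)) =
    (fun t : R => x.2 (((0, 0) : R * R) + t *: ((0, 1) : R * R))) by exact: C1map_line.
  apply/funext => t; congr x.2.
  rewrite -[RHS]/(0 + t * 0, 0 + t * 1) mulr0 mulr1 !add0r //.
- suff -> : (fun t : R => x.2 (t, 0)) =
    (fun t : R => x.2 (((0, 0) : R * R) + t *: ((1, 0) : R * R))) by exact: C1map_line.
  apply/funext => t; congr x.2.
  rewrite -[RHS]/(0 + t * 1, 0 + t * 0) mulr0 mulr1 !add0r //.
Qed.

Lemma all_C1_boundary2 (d : chain2 R T) : all_C1 S d -> all_C1 S (boundary2 d).
Proof.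
elim: d => [|x d IH] // [hx hd]; apply/all_C1_cat; split; last exact: IH.
exact: all_C1_faces.
Qed.

Lemma period_boundary2 w (d : chain2 R T) : holo_form w -> all_C1 S d ->
  period w (boundary2 d) = 0.
Proof.
move=> hw; elim: d => [|x d IH]; first by rewrite /period big_nil.
move=> [hx hd]; have -> : boundary2 (x :: d) = faces x ++ boundary2 d by [].
rewrite period_cat (IH hd) addr0.
by case: x hx => k f hf; exact: faces_integral.
Qed.

Theorem period_homologous w c c' : holo_form w -> all_C1 S c -> all_C1 S c' ->
  homologous S c c' -> period w c = period w c'.
Proof.
move=> hw hc hc' [d hd E].
(* The chain c - c' - boundary(d), which is 0 in the free abelian group. *)
pose e := c ++ [seq (-1 * x.1, x.2) | x <- c'] ++
          [seq (-1 * x.1, x.2) | x <- boundary2 d].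
have : period w e = 0.
  apply: period_coef0 => // [|g].
    apply/all_C1_cat; split => //; apply/all_C1_cat; split; apply: all_C1_map => //.
    exact: all_C1_boundary2.
  by rewrite /e !coef_cat !coef_scale -E; ring.
rewrite /e !period_cat !period_scale period_boundary2 // mulr0 addr0 mulN1r.
by move=> /eqP; rewrite subr_eq0 => /eqP.
Qed.

Lemma period_lincomb w r (k : 'rV[int]_r) (B : 'I_r -> chain1 R T) :
  period w (lincomb k B) = \sum_i (k 0 i)%:~R * period w (B i).
Proof.
rewrite /lincomb -[in RHS]big_enum /=; elim: (enum 'I_r) => [|i s IH].
  by rewrite /period !big_nil.
by rewrite /= period_cat period_scale IH big_cons.
Qed.

Lemma all_C1_lincomb r (k : 'rV[int]_r) (B : 'I_r -> chain1 R T) :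
  (forall i, all_C1 S (B i)) -> all_C1 S (lincomb k B).
Proof.
move=> hB; rewrite /lincomb; elim: (enum 'I_r) => [|i s IH] //=.
by apply/all_C1_cat; split => //; exact: all_C1_map.
Qed.

Lemma cycle_period r (B : 'I_r -> chain1 R T) c : H1_basis S B -> cycle1 S c ->
  exists k : 'rV[int]_r, forall w, holo_form w ->
    period w c = \sum_i (k 0 i)%:~R * period w (B i).
Proof.
move=> [cB gB] hc; have [k [hk _]] := gB c hc; exists k => w hw.
rewrite -period_lincomb; apply: period_homologous => //; first exact: hc.1.
by apply: all_C1_lincomb => i; exact: (cB i).1.
Qed.

Definition path_chain (k : int) (s : seq (R -> T)) : chain1 R T := [seq (k, g) | g <- s].

Lemma joins_all_C1 p s q k : joins S p s q -> all_C1 S (path_chain k s).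
Proof. by elim: s p => [|g s IH] p //= [hg _ /IH]. Qed.

Lemma joins_boundary p s q k x : joins S p s q ->
  boundary1 (path_chain k s) x =
  (if `[< q = x >] then k else 0) - (if `[< p = x >] then k else 0).
Proof.
elim: s p => [|g s IH] p /=; first by move=> ->; rewrite /boundary1 big_nil subrr.
move=> [_ <- /IH E].
have -> : boundary1 ((k, g) :: path_chain k s) x =
    ((if `[< g 1 = x >] then k else 0) - (if `[< g 0 = x >] then k else 0)) +
    boundary1 (path_chain k s) x by rewrite /boundary1 big_cons.
by rewrite E addrC addrA subrK.
Qed.

Lemma boundary1_cat c d x : boundary1 (c ++ d) x = boundary1 c x + boundary1 d x.
Proof. by rewrite /boundary1 big_cat. Qed.

Lemma joins_cycle p q s s' : joins S p s q -> joins S p s' q ->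
  cycle1 S (path_chain 1 s ++ path_chain (-1) s').
Proof.
move=> js js'; split; first by apply/all_C1_cat; split; apply: joins_all_C1; eassumption.
move=> x; rewrite boundary1_cat (joins_boundary _ _ js) (joins_boundary _ _ js').
by case: ifP; case: ifP => _ _; rewrite ?subr0 ?sub0r; ring.
Qed.

Lemma period_path_chain w k s :
  period w (path_chain k s) = k%:~R * \sum_(g <- s) path_integral w g.
Proof. by rewrite /period /path_chain big_map big_distrr. Qed.

Theorem monodromy r (B : 'I_r -> chain1 R T) p q s s' : H1_basis S B ->
  joins S p s q -> joins S p s' q ->
  exists k : 'rV[int]_r, forall w, holo_form w ->
    \sum_(g <- s) path_integral w g =
    \sum_(g <- s') path_integral w g + \sum_i (k 0 i)%:~R * period w (B i).
Proof.
move=> hB js js'; have [k kP] := cycle_period hB (joins_cycle js js').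
exists k => w hw; rewrite -(kP w hw) period_cat !period_path_chain.
by rewrite mulrN1z mulr1z; ring.
Qed.

End Homology.

(** * Local primitives modulo periods, and forms with real periods *)

Section Primitive.
Variables (R : realType) (T : topologicalType) (S : riemann_surface R T).
Local Notation C := R[i].
Implicit Types (i j : chart S) (p q : T) (w : one_form S).

Definition period_lattice r (B : 'I_r -> chain1 R T) w : set C :=
  [set c | exists k : 'rV[int]_r, c = \sum_i (k 0 i)%:~R * period w (B i)].

(** The paths chosen to [p] and to a nearby point are unrelated. Prolonging the first by an arc
    inside the chart gives a second path to the nearby point, and monodromy places the discrepancy
    in the lattice; it may vary with [z] in an uncontrolled way. *)
Lemma integral_from_local r (B : 'I_r -> chain1 R T) w z0 i p :
  H1_basis S B -> connected [set: T] -> holo_form w -> dom i p ->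
  exists2 e : R, 0 < e & exists F : C -> C, forall z, nrm (z - zcoord i p) < e ->
    [/\ dom i (param i z), zcoord i (param i z) = z, chol F z (w i z) &
      period_lattice B w (integral_from w z0 (param i z) - integral_from w z0 p -
                          (F z - F (zcoord i p)))].
Proof.
move=> hB conT hw ip; have [e e0 [F FP]] := holo_primitive hw ip.
exists e => //; exists F => z ze; have [iz zE dF] := FP z ze; split => //.
(* Some path always exists, so the default value of [xget] is never the reason for the result. *)
have joins_xget q : joins S z0 (xget [::] [set s | joins S z0 s q]) q.
  have [s sP] := joins_exists S conT z0 q.
  by apply: (@xgetPex _ [::] [set s | joins S z0 s q]); exists s.
have pe : nrm (zcoord i p - zcoord i p) < e by rewrite subrr nrm0.
have rP x : nrm (x - zcoord i p) < e -> dom i (param i x) /\ zcoord i (param i x) = x.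
  by move=> /FP[].
have [g [hg g0 g1 gP]] := ease_arc rP pe ze.
have g0p : g 0 = p by rewrite g0 zcoordK.
have jg := joins_rcons (joins_xget p) hg g0p; rewrite g1 in jg.
have [k kP] := monodromy hB (joins_xget (param i z)) jg.
exists k; rewrite -/(integral_from w z0 (param i z)) in kP *.
have := kP w hw; rewrite -/(integral_from w z0 (param i z)) big_rcons /=.
rewrite -/(integral_from w z0 p) (@path_integral_primitive _ _ _ w i g F hw hg).
  rewrite g0p g1 zE => ->; ring.
by move=> t _; have [it tr] := gP t; split => //; have [] := FP _ tr.
Qed.

Lemma is_derive_locally_cst (h : R -> R) (t d : R) :
  is_derive t 1 h d -> (\forall s \near t, h s = h t) -> d = 0.
Proof.
move=> dh hc; have : is_derive t 1 (cst (h t)) d.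
  apply: near_eq_is_derive dh; near=> s; rewrite /cst; near: s; exact: hc.
by move=> [_ <-]; exact: derive_cst.
Unshelve. all: by end_near. Qed.

Lemma rcurve_dir (F : C -> C) (z a l : C) : chol F z l ->
  rcurve (fun t => F (z + a * t%:C)) 0 (l * a).
Proof.
move=> dF.
have z0 : z + a * (0 : R)%:C = z by rewrite rmorph0 mulr0 addr0.
have dl : rcurve (fun t : R => z + a * t%:C) 0 a.
  have := hasdD (hasd_cst (real_complex R) z (0 : R))
    (hasdZ (@ccont_real R) a (hasd_self (real_complex R) (0 : R))).
  by rewrite add0r mulr1.
apply: (@hasd_comp R R (real_complex R) (@ccont_real R) F (fun t : R => z + a * t%:C)) => //.
by rewrite z0.
Qed.

Lemma Im_locally_cst (F : C -> C) (z l : C) : chol F z l ->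
  (\forall x \near (z : C^o), complex.Im (F x) = complex.Im (F z)) -> l = 0.
Proof.
move=> dF /nbhs_complexP[d d0 dP].
have dir (a : C) : nrm a = 1 -> complex.Im (l * a) = 0.
  move=> a1; have := rcurve_Im (rcurve_dir a dF) => H.
  apply: (is_derive_locally_cst H); near=> s; rewrite rmorph0 mulr0 addr0.
  apply: dP; rewrite addrC addKr nrmM a1 mul1r nrmR; near: s.
  apply/nbhs_ballP; exists d => // s; rewrite /ball /= sub0r normrN //.
have := dir 1 (nrm1 R); rewrite mulr1 => l1.
have := dir 'i (nrm_i R); rewrite ImiRe => l2.
by rewrite [l]complexE l1 l2 rmorph0 mulr0 addr0.
Unshelve. all: by end_near. Qed.

Lemma ImB (x y : C) : complex.Im (x - y) = complex.Im x - complex.Im y.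
Proof. by case: x y => [a b] [c d]. Qed.

Lemma Im_intM (n : int) (z : C) :
  complex.Im (n%:~R * z) = n%:~R * complex.Im z.
Proof.
by rewrite -(rmorph_int (real_complex R)); case: z => a b /=; rewrite mul0r addr0.
Qed.

Lemma real_periods_zero r (B : 'I_r -> chain1 R T) w :
  H1_basis S B -> connected [set: T] -> compact [set: T] -> holo_form w ->
  (forall k, complex.Im (period w (B k)) = 0) ->
  forall i p, dom i p -> w i (zcoord i p) = 0.
Proof.
move=> hB conT cptT hw per0 i0 p0 ip0; pose u p := complex.Im (integral_from w p0 p).
(* Real periods make the ambiguity of [integral_from] real, so that [u] coincides locally with the
   imaginary part of a primitive up to a constant. *)
have lat0 c : period_lattice B w c -> complex.Im c = 0.
  move=> [k ->]; rewrite raddf_sum big1 // => j _.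
  by apply: (etrans (Im_intM _ _)); rewrite per0 mulr0.
have loc i p : dom i p -> exists2 e : R, 0 < e & exists F : C -> C,
    forall z, nrm (z - zcoord i p) < e ->
    [/\ dom i (param i z), zcoord i (param i z) = z, chol F z (w i z) &
      u (param i z) - u p = complex.Im (F z) - complex.Im (F (zcoord i p))].
  move=> ip; have [e e0 [F FP]] := integral_from_local p0 hB conT hw ip.
  exists e => //; exists F => z ze; have [iz zE dF /lat0 E] := FP z ze; split => //.
  by apply/eqP; rewrite -subr_eq0 /u -!ImB E.
have near_ball i p (e : R) : dom i p -> 0 < e ->
    \forall q \near p, dom i q /\ nrm (zcoord i q - zcoord i p) < e.
  move=> ip e0; near=> q; split.
    by near: q; apply: open_nbhs_nbhs; split => //; exact: dom_open.
  by near: q; have /ccontP := zcoord_continuous ip; exact.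
have cu : continuous u.
  move=> p; have ip := dom_chart_at S p; have [e e0 [F FP]] := loc _ _ ip.
  apply/cvgrPdist_lt => d d0.
  have pe : nrm (zcoord (chart_at S p) p - zcoord (chart_at S p) p) < e.
    by rewrite subrr nrm0.
  have [_ _ /ccont_chol cF _] := FP _ pe.
  have /nbhs_complexP[d' d'0 dP] := cF d d0.
  near=> q.
  have [iq qe] : dom (chart_at S p) q /\
      nrm (zcoord (chart_at S p) q - zcoord (chart_at S p) p) < Num.min e d'.
    by near: q; apply: near_ball => //; rewrite lt_min e0.
  move: qe; rewrite lt_min => /andP[qe qd].
  have [_ _ _] := FP _ qe; rewrite zcoordK // => uE.
  rewrite distrC uE -raddfB (le_lt_trans (Im_le_nrm _)) //; exact: dP.
have [||c _ cmax] := @compact_EVT_max T R u [set: T] _ cptT.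
- by exists p0.
- exact: continuous_subspaceT.
have locmax i p : dom i p -> u p = u c -> exists2 e : R, 0 < e & exists F : C -> C,
    forall z, nrm (z - zcoord i p) < e ->
    [/\ dom i (param i z), chol F z (w i z), u (param i z) = u c &
       complex.Im (F z) = complex.Im (F (zcoord i p))].
  move=> ip upc; have [e e0 [F FP]] := loc _ _ ip; exists e => //; exists F => z ze.
  have [iz zE dF uE] := FP z ze.
  have Fz : complex.Im (F z) = complex.Im (F (zcoord i p)).
    apply: (@maximum_principle R F (zcoord i p) e) => //.
      by move=> x /FP[_ _ dx _]; exists (w i x).
    move=> x xe; have [_ _ _ xE] := FP x xe.
    have : u (param i x) <= u c by apply: cmax; rewrite inE.
    by rewrite -upc -subr_le0 xE subr_le0.
  by split => //; rewrite -upc; apply/eqP; rewrite -subr_eq0 uE Fz subrr.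
(* The set where the maximum is attained is open by the maximum principle and closed by
   continuity. *)
have uc p : u p = u c.
  pose K := [set p | u p = u c].
  suff KT : K = [set: T] by have : K p by rewrite KT.
  apply: conT.
  - by exists c.
  - exists K; last by rewrite setTI.
    rewrite openE => x xK; rewrite /interior.
    have ix := dom_chart_at S x; have [e e0 [F FP]] := locmax _ _ ix xK.
    apply: filterS (near_ball _ _ _ ix e0) => q [iq qe].
    by have [_ _] := FP _ qe; rewrite zcoordK.
  - exists K; last by rewrite setTI.
    have -> : K = u @^-1` [set u c] by [].
    by apply: closed_comp => [x _|]; [exact: cu | exact: closed_eq].
have [e e0 [F FP]] := locmax _ _ ip0 (uc p0).
have pe : nrm (zcoord i0 p0 - zcoord i0 p0) < e by rewrite subrr nrm0.
have [_ dF _ _] := FP _ pe.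
apply: (Im_locally_cst dF); apply/nbhs_complexP; exists e => // z ze.
by have [] := FP z ze.
Unshelve. all: by end_near. Qed.

End Primitive.

(** * Proportional forms and the Laplacian *)

Section Laplacian.
Variables (R : realType) (T : topologicalType) (S : riemann_surface R T).
Local Notation C := R[i].
Local Notation tau := (tau R).
Implicit Types (i j : chart S) (p q : T) (w : one_form S).

Lemma cexp_int (n : int) : cexp (n%:~R * tau) = 1 :> C.
Proof.
have nat_case (k : nat) : cexp (k%:R * tau) = 1 :> C.
  elim: k => [|k IH]; first by rewrite mul0r cexp0.
  by rewrite -natr1 mulrDl mul1r cexpD IH cexp_2pi mulr1.
case: n => k; first by rewrite -pmulrn nat_case.
rewrite NegzE mulrNz mulNr.
by have := cexpNK (k.+1%:R * tau); rewrite nat_case mul1r.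
Qed.

(** The exponent changes by l - conj(l) = 2 i Im l = n tau, a period of the exponential. *)
Lemma cexp_subC_lattice (z l : C) (n : int) : complex.Im l = pi * n%:~R ->
  cexp (z + l - conjc (z + l)) = cexp (z - conjc z).
Proof.
move=> lE; have -> : z + l - conjc (z + l) = (z - conjc z) + n%:~R * tau.
  rewrite -(rmorph_int (real_complex R)).
  case: z l lE => [a b] [c d] /= ->; apply/eqP; rewrite eq_complex /=.
  by apply/andP; split; apply/eqP; ring.
by rewrite cexpD cexp_int mulr1.
Qed.

Lemma wirtinger (f : C -> C) (z a b : C) :
  rcurve (xline f z) 0 a -> rcurve (yline f z) 0 b ->
  [/\ partials_ex f z, d_z f z = (a - 'i%C * b) / 2 & d_zbar f z = (a + 'i%C * b) / 2].
Proof.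
move=> /Dt_rcurveP[ex dx] /Dt_rcurveP[ey dy].
by split; [split | rewrite /d_z dx dy | rewrite /d_zbar dx dy].
Qed.

Lemma rcurve_line_near (f g : C -> C) (z a v : C) :
  (\forall x \near (z : C^o), f x = g x) ->
  rcurve (fun t => f (z + a * t%:C)) 0 v -> rcurve (fun t => g (z + a * t%:C)) 0 v.
Proof.
move=> /nbhs_complexP[d d0 dP]; apply: hasd_near.
have a0 : 0 < nrm a + 1 by rewrite ltr_wpDl ?nrm_ge0.
apply/nbhs_ballP; exists (d / (nrm a + 1)); first by rewrite /= divr_gt0.
move=> t; rewrite /ball /= sub0r normrN => td; apply: dP.
rewrite addrC addKr nrmM nrmR.
have [a00|a00] := eqVneq (nrm a) 0; first by rewrite a00 mul0r.
have a1 : 0 < nrm a by rewrite lt_def a00 nrm_ge0.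
apply: (@lt_trans _ _ (nrm a * (d / (nrm a + 1)))); first by rewrite ltr_pM2l.
by rewrite mulrA ltr_pdivrMr // mulrC ltr_pM2l // ltrDl.
Qed.

Lemma xlineE (f : C -> C) z : xline f z = fun t => f (z + 1 * t%:C).
Proof. by apply/funext => t; rewrite /xline mul1r. Qed.

Lemma conj_mulr_i (z : C) : conjc (z * 'i%C) = - (conjc z * 'i%C).
Proof.
case: z => a b; apply/eqP; rewrite eq_complex /=.
by apply/andP; split; apply/eqP; ring.
Qed.

Lemma ii : 'i%C * 'i%C = -1 :> C.
Proof. by rewrite -expr2 sqr_i. Qed.

(** The algebra of d_z applied to - conj(w) h: [u] and [wb] are w and its conjugate, [e] is h, and
    [kb] is the conjugate of w'. The terms in [kb] cancel because conj(w) is antiholomorphic. *)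
Lemma wirtinger_product (kb wb u e : C) :
  (- (kb * e + wb * (e * (u - wb))) -
    'i%C * - (- (kb * 'i%C) * e + wb * (e * (u * 'i%C - - (wb * 'i%C))))) / 2 =
  - (u * wb * e).
Proof.
have -> : - (kb * e + wb * (e * (u - wb))) -
    'i%C * - (- (kb * 'i%C) * e + wb * (e * (u * 'i%C - - (wb * 'i%C)))) =
  - (kb * e + wb * (e * (u - wb))) + ('i%C * 'i%C) * (- kb * e + wb * (e * (u + wb))).
  by ring.
by rewrite ii; field.
Qed.

Section LocalExponential.
Variables (F : C -> C) (K : C).
Let E (z : C) : C := cexp (K + F z - conjc (F z)).

Lemma rcurve_expdiff (z a l : C) : chol F z l ->
  rcurve (fun t => E (z + a * t%:C)) 0 (E z * (l * a - conjc (l * a))).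
Proof.
move=> dF; have d1 := rcurve_dir a dF.
have d2 := rcurve_conj d1.
have d3 := hasdB (@ccont_real R) (hasdD (hasd_cst (real_complex R) K (0 : R)) d1) d2.
have z0 : z + a * (0 : R)%:C = z by rewrite rmorph0 mulr0 addr0.
rewrite add0r in d3.
have := hasd_comp (@ccont_real R) (chol_cexp _) d3.
by rewrite z0.
Qed.

Lemma d_zbar_expdiff (f : C -> C) (z l : C) :
  (\forall x \near (z : C^o), E x = f x) -> chol F z l ->
  partials_ex f z /\ d_zbar f z = - (conjc l * f z).
Proof.
move=> Ef dF.
have dx := rcurve_line_near Ef (rcurve_expdiff 1 dF); rewrite -xlineE in dx.
have dy := rcurve_line_near Ef (rcurve_expdiff 'i%C dF).
have [pe _ ->] := wirtinger dx dy; split => //.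
rewrite -(nbhs_singleton Ef) mulr1 conj_mulr_i.
have -> : 'i%C * (E z * (l * 'i%C - - (conjc l * 'i%C))) =
  ('i%C * 'i%C) * (E z * (l + conjc l)) by ring.
by rewrite ii; field.
Qed.

Lemma d_z_d_zbar_expdiff (f w : C -> C) (z l k : C) :
  (\forall x \near (z : C^o), E x = f x) ->
  (\forall x \near (z : C^o), chol F x (w x)) -> chol w z k ->
  [/\ \forall x \near (z : C^o), partials_ex f x, partials_ex (d_zbar f) z &
    d_z (d_zbar f) z = - (w z * conjc (w z) * f z)].
Proof.
move=> Ef dF dw.
(* Differentiating [d_zbar f] at [z] requires its formula on a whole neighbourhood of [z]. *)
have nn : \forall x \near (z : C^o), partials_ex f x /\
    - (conjc (w x) * E x) = d_zbar f x.
  have Ef2 : \forall x \near (z : C^o), \forall y \near (x : C^o), E y = f y.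
    exact: nbhs_interior Ef.
  near=> x.
  have Ex : \forall y \near (x : C^o), E y = f y by near: x.
  have dFx : chol F x (w x) by near: x.
  have [p1 ->] := d_zbar_expdiff Ex dFx; split => //.
  by rewrite (nbhs_singleton Ex).
have n1 : \forall x \near (z : C^o), - (conjc (w x) * E x) = d_zbar f x.
  by apply: filterS nn => x [].
have z0 a : z + a * (0 : R)%:C = z by rewrite rmorph0 mulr0 addr0.
have dF0 := nbhs_singleton dF.
have dir a : rcurve (fun t => - (conjc (w (z + a * t%:C)) * E (z + a * t%:C))) 0
   (- (conjc (k * a) * E z + conjc (w z) * (E z * (w z * a - conjc (w z * a))))).
  have d1 := rcurve_conj (rcurve_dir a dw).
  have d2 := hasdZ (@ccont_real R) (-1) (hasdM (@ccont_real R) d1 (rcurve_expdiff a dF0)).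
  rewrite z0 mulN1r in d2; move: d2.
  by under eq_fun do rewrite mulN1r.
have dx := rcurve_line_near n1 (dir 1); rewrite -xlineE in dx.
have dy := rcurve_line_near n1 (dir 'i%C).
have [pe -> _] := wirtinger dx dy; split => //.
  by apply: filterS nn => x [].
rewrite -(nbhs_singleton Ef) !mulr1 !conj_mulr_i.
exact: wirtinger_product.
Unshelve. all: by end_near. Qed.

End LocalExponential.

Lemma normc_sqr (z : C) : `|z| ^+ 2 = z * conjc z.
Proof.
rewrite normE; case: z => a b; rewrite /nrm normc_def /=.
rewrite -rmorphXn /= sqr_sqrtr ?addr_ge0 ?sqr_ge0 //.
by apply/eqP; rewrite eq_complex /=; apply/andP; split; apply/eqP; ring.
Qed.

Theorem laplacian_eigen_proportional r (B : 'I_r -> chain1 R T) w w' z0 (c : C) :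
  H1_basis S B -> connected [set: T] -> holo_form w' -> proportional w' w c ->
  (forall k, exists n : int, complex.Im (period w' (B k)) = pi * n%:~R) ->
  laplacian_eigen w (h_fun w' z0) (2 * area w * `|c| ^+ 2).
Proof.
move=> hB conT hw' w'E per i p ip wp0 f.
have [e e0 [F FP]] := integral_from_local z0 hB conT hw' ip.
have latI l : period_lattice B w' l -> exists n : int, complex.Im l = pi * n%:~R.
  move=> [k ->]; have [N NP] := choice per.
  exists (\sum_j k 0 j * N j); rewrite raddf_sum /= rmorph_sum /= mulr_sumr.
  apply: eq_bigr => j _; rewrite Im_intM NP rmorphM /=; ring.
(* Near [p] the integral is I0 + F up to a period, which [h_fun] does not see; the constant [K] is
   the part of the exponent that comes from [I0]. *)
pose I0 := integral_from w' z0 p - F (zcoord i p).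
pose K := I0 - conjc I0.
have Ef z : nrm (z - zcoord i p) < e -> cexp (K + F z - conjc (F z)) = f z.
  move=> ze; have [iz zE dF] := FP z ze; move=> /latI[n nE].
  set l := _ - _ in nE.
  have IE : integral_from w' z0 (param i z) = I0 + F z + l by rewrite /l /I0; ring.
  rewrite /f /h_fun /= IE (cexp_subC_lattice _ nE) rmorphD /K; congr cexp; ring.
have pe : nrm (zcoord i p - zcoord i p) < e by rewrite subrr nrm0.
have [_ _ dFp _] := FP _ pe.
have nearf : \forall z \near (zcoord i p : C^o), cexp (K + F z - conjc (F z)) = f z.
  by apply/nbhs_complexP; exists e.
have nearF : \forall z \near (zcoord i p : C^o), chol F z (w' i z).
  by apply/nbhs_complexP; exists e => // z /FP[].
have [k dk] := holo_form_chol hw' ip.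
have [h1 h2 h3] := d_z_d_zbar_expdiff K nearf nearF dk.
split => //; rewrite /laplacian h3 (w'E i p ip).
have -> : h_fun w' z0 p = f (zcoord i p) by rewrite /f /= zcoordK.
rewrite !normc_sqr.
have -> : conjc (c * w i (zcoord i p)) = conjc c * conjc (w i (zcoord i p)).
  exact: rmorphM.
have wc0 : conjc (w i (zcoord i p)) != 0 by rewrite conjc_eq0.
by field; rewrite wp0 wc0.
Qed.

End Laplacian.

(** * Linear combinations of holomorphic forms *)

Section LinearCombination.
Variables (R : realType) (T : topologicalType) (S : riemann_surface R T).
Local Notation C := R[i].

Lemma chol_sum (I : Type) (s : seq I) (c l : I -> C) (f : I -> C -> C) (z : C) :
  (forall k, chol (f k) z (l k)) ->
  chol (fun x => \sum_(k <- s) c k * f k x) z (\sum_(k <- s) c k * l k).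
Proof.
move=> df; elim: s => [|k s IH].
  rewrite big_nil; under eq_fun do rewrite big_nil; exact: chol_cst.
rewrite big_cons; under eq_fun do rewrite big_cons.
by apply: cholD IH; exact: cholZ.
Qed.

Lemma CI_sum (I : Type) (s : seq I) (c : I -> C) (f : I -> R -> C) :
  (forall k t, ccont (f k) t) ->
  (forall t, ccont (fun t => \sum_(k <- s) c k * f k t) t) /\
  CI (fun t => \sum_(k <- s) c k * f k t) = \sum_(k <- s) c k * CI (f k).
Proof.
move=> cf; elim: s => [|k s [cs IH]].
  rewrite big_nil; under eq_fun do rewrite big_nil.
  split=> [t|]; first exact: ccont_cst.
  rewrite (@CI_FTC R (fun=> 0) (fun=> 0)) ?subrr //.
    by move=> t _; exact: ccont_cst.
  by move=> t _; exact: hasd_cst.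
rewrite big_cons; under eq_fun do rewrite big_cons; split.
  by move=> t; apply: ccontD (cs t); apply: ccontM (cf k t); exact: ccont_cst.
by rewrite (CI_lin (c k) (fun t _ => cf k t) (fun t _ => cs t)) IH.
Qed.

Variables (g : nat) (w : 'I_g -> one_form S).
Hypothesis hw : forall k, holo_form (w k).

Definition lin_form (c : 'I_g -> C) : one_form S := fun i z => \sum_k c k * w k i z.

Lemma holo_lin_form c : holo_form (lin_form c).
Proof.
split=> [i p ip|i j p ip jp].
  have [l lP] := choice (fun k => holo_form_chol (hw k) ip).
  have := chol_sum (index_enum 'I_g) c lP.
  by move=> /holomorphic_atP[].
rewrite /lin_form big_distrl /=; apply: eq_bigr => k _.
by rewrite ((hw k).2 i j p ip jp) mulrA.
Qed.

Lemma pullback_lin_form c h t :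
  pullback (lin_form c) h t = \sum_k c k * pullback (w k) h t.
Proof.
by rewrite /pullback /lin_form big_distrl /=; apply: eq_bigr => k _; rewrite mulrA.
Qed.

Lemma path_integral_lin_form c h : C1map S h ->
  path_integral (lin_form c) h = \sum_k c k * path_integral (w k) h.
Proof.
move=> hh; have [_ <-] := @CI_sum _ (index_enum 'I_g) c (fun k => pullback (w k) h)
  (fun k t => pullback_ccont t (hw k) hh).
rewrite -[LHS]/(CI _); congr CI; apply/funext => t; exact: pullback_lin_form.
Qed.

Lemma period_lin_form c B : all_C1 S B ->
  period (lin_form c) B = \sum_k c k * period (w k) B.
Proof.
rewrite /period; elim: B => [|x B IH] /= => [_|[hx hB]].
  by rewrite big_nil big1 // => k _; rewrite big_nil mulr0.
rewrite big_cons IH // path_integral_lin_form // big_distrr -big_split /=.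
by apply: eq_bigr => k _; rewrite big_cons; ring.
Qed.

Lemma period_form0 (v : one_form S) B :
  (forall i p, dom i p -> v i (zcoord i p) = 0) -> period v B = 0.
Proof.
move=> v0; rewrite /period big1 // => x _.
suff -> : path_integral v x.2 = 0 by rewrite mulr0.
rewrite -[LHS]/(CI _).
have -> : pullback v x.2 = fun=> 0.
  by apply/funext => t; rewrite /pullback v0 ?mul0r //; exact: dom_chart_at.
rewrite (@CI_FTC R (fun=> 0) (fun=> 0)) ?subrr //.
  by move=> t _; exact: ccont_cst.
by move=> t _; exact: hasd_cst.
Qed.

End LinearCombination.

(** * Nondegeneracy of the imaginary part of the period matrix *)

Section PeriodMatrix.
Variables (R : realType) (T : topologicalType) (S : riemann_surface R T).
Local Notation C := R[i].
Hypotheses (conT : connected [set: T]) (cptT : compact [set: T]).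
Variables (g : nat) (a b : 'I_g -> chain1 R T).
Hypothesis symp : symplectic_basis S a b.
Variable w : 'I_g -> one_form S.
Hypothesis hw : forall k, holo_form (w k).
Hypothesis wnorm : forall j k, period (w k) (a j) = (j == k)%:R.
Variable Om : 'M[C]_g.
Hypotheses (OmE : Om = period_matrix w b) (Omsym : Om^T = Om).

Let Y : 'M[R]_g := map_mx (@complex.Im R) Om.

Let C1a j : all_C1 S (a j).
Proof.
have [[/(_ (fintype.unsplit (inl j))) [] + _] _] := symp.
by rewrite fintype.unsplitK.
Qed.

Let C1b j : all_C1 S (b j).
Proof.
have [[/(_ (fintype.unsplit (inr j))) [] + _] _] := symp.
by rewrite fintype.unsplitK.
Qed.

Lemma period_a c j : period (lin_form w c) (a j) = c j.
Proof.
rewrite (period_lin_form hw) // (bigD1 j) //= wnorm eqxx mulr1 big1 ?addr0 //.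
by move=> k kj; rewrite wnorm eq_sym (negbTE kj) mulr0.
Qed.

Lemma period_b c j : period (lin_form w c) (b j) = \sum_k c k * Om j k.
Proof.
by rewrite (period_lin_form hw) //; apply: eq_bigr => k _; rewrite OmE mxE.
Qed.

Lemma Im_realM (x : R) (z : C) : complex.Im (x%:C * z) = x * complex.Im z.
Proof. by case: z => u v /=; rewrite mul0r addr0. Qed.

Lemma Y_sym j k : Y j k = Y k j.
Proof. by rewrite !mxE -[in LHS]Omsym mxE. Qed.

(* A real vector in the kernel of [Im Om] yields a form with real periods. *)
Lemma Im_period_matrix_unit : Y \in unitmx.
Proof.
rewrite unitmxE unitfE; apply/negP => /det0P[v v0 vY].
pose c k : C := (v 0 k)%:C.
have z0 : forall (i : chart S) p, dom i p -> lin_form w c i (zcoord i p) = 0.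
  apply: (real_periods_zero symp.1 conT cptT (holo_lin_form hw c)) => k.
  case: (fintype.split k) => j; first by rewrite period_a.
  rewrite period_b raddf_sum /=.
  transitivity ((v *m Y) 0 j); last by rewrite vY mxE.
  rewrite mxE; apply: eq_bigr => l _.
  by rewrite -[LHS]/(complex.Im _) Im_realM Y_sym [in RHS]mxE.
(* Integrating the vanishing form over [a j] recovers the coefficient [v 0 j], by the normalization
   of the basis. *)
move/negP: v0; apply; apply/eqP/rowP => j; rewrite mxE.
by apply: (@complexI R); rewrite -/(c j) -period_a period_form0.
Qed.

End PeriodMatrix.

(** * Periods of the forms [omega_nm] and the eigenvalue equation *)

Section Genus2.
Variables (R : realType) (T : topologicalType) (S : riemann_surface R T).
Local Notation C := R[i].

Lemma fmorph_ratR (x : rat) : (ratr x : R)%:C = ratr x :> C.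
Proof. exact: (fmorph_rat (real_complex R)). Qed.

Lemma conj_ratr (x : rat) : conjc (ratr x : C) = ratr x.
Proof. exact: (fmorph_rat (@conjc R)). Qed.

Lemma conj_intr (n : int) : conjc (n%:~R : C) = n%:~R.
Proof. exact: (rmorph_int (@conjc R)). Qed.

Lemma Im_ratrM (x : rat) (z : C) : complex.Im (ratr x * z) = ratr x * complex.Im z.
Proof. by rewrite -fmorph_ratR; case: z => a b /=; rewrite mul0r addr0. Qed.

Lemma conjcD (x y : C) : conjc (x + y) = conjc x + conjc y.
Proof. exact: rmorphD. Qed.

Lemma conjcB (x y : C) : conjc (x - y) = conjc x - conjc y.
Proof. exact: rmorphB. Qed.

Lemma conjcM (x y : C) : conjc (x * y) = conjc x * conjc y.
Proof. exact: rmorphM. Qed.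

Lemma ImD (x y : C) : complex.Im (x + y) = complex.Im x + complex.Im y.
Proof. by case: x y => [a b] [c d]. Qed.

Lemma sum2E (V : nmodType) (f : 'I_2 -> V) : \sum_l f l = f 0 + f 1.
Proof.
by rewrite big_ord_recl big_ord1; congr (_ + f _); exact: val_inj.
Qed.

Lemma ord2_cases (j : 'I_2) : j = 0 \/ j = 1.
Proof. by case: j => [[|[|]]] //= lt; [left | right]; exact: val_inj. Qed.

Section Coefficients.
Variable Om : 'M[C]_2.
Hypothesis Omsym : Om^T = Om.
Let X : 'M[R]_2 := map_mx (@complex.Re R) Om.
Let Y : 'M[R]_2 := map_mx (@complex.Im R) Om.
Hypothesis Yunit : Y \in unitmx.
Variables n m : 'rV[int]_2.
Let nR : 'rV[R]_2 := map_mx intr n.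
Let mR : 'rV[R]_2 := map_mx intr m.

Definition v_nm (n m : 'rV[int]_2) (j : 'I_2) : C :=
  (m 0 j)%:~R - \sum_l (n 0 l)%:~R * conjc (Om l j).

Lemma v_nmE j : v_nm n m j = (mR - nR *m X) 0 j +i* (nR *m Y) 0 j.
Proof.
rewrite /v_nm !mxE !big_ord_recl !big_ord0 !mxE -!(rmorph_int (real_complex R)).
case: (Om _ _) (Om _ _) => [a b] [c d] /=; apply/eqP; rewrite eq_complex /=.
by apply/andP; split; apply/eqP; ring.
Qed.

(** With Om = X + i Y, the vector v equals (m - n X) + i n Y; multiplying by the inverse of Y leaves
    exactly n as the imaginary part. *)
Lemma c_nmE k : c_nm Om n m k =
  (pi * ((mR - nR *m X) *m invmx Y) 0 k) +i* (pi * nR 0 k).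
Proof.
have -> : nR 0 k = ((nR *m Y) *m invmx Y) 0 k by rewrite mulmxK.
rewrite /c_nm -/Y; under eq_bigr do rewrite -/(v_nm n m _) v_nmE.
rewrite [in X in _ = _ +i* (_ * X)]mxE [in X in _ = (_ * X) +i* _]mxE.
rewrite !big_ord_recl !big_ord0; set u := mR - _; set v := nR *m Y.
by apply/eqP; rewrite eq_complex /=; apply/andP; split; apply/eqP; ring.
Qed.

Lemma Im_c_nm k : complex.Im (c_nm Om n m k) = pi * (n 0 k)%:~R.
Proof. by rewrite c_nmE /= mxE. Qed.

(** Writing c = pi (u + i n), the imaginary part of c Om is pi (u Y + n X), and u Y = m - n X by the
    choice of u. So n and m are, up to pi, the imaginary parts of the alpha- and beta-periods, which
    is where the formula for the coefficients comes from. *)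
Lemma Im_c_nm_Om j : complex.Im (\sum_k c_nm Om n m k * Om j k) = pi * (m 0 j)%:~R.
Proof.
pose u : 'rV[R]_2 := (mR - nR *m X) *m invmx Y.
have E k : complex.Im (c_nm Om n m k * Om j k) = pi * (u 0 k * Y k j + nR 0 k * X k j).
  have -> : Om j k = Om k j by rewrite -[in LHS]Omsym mxE.
  rewrite c_nmE -/u !mxE; case: (Om k j) => a b /=; ring.
rewrite raddf_sum /= (eq_bigr _ (fun k _ => E k)) -mulr_sumr big_split /=.
have -> : \sum_i u 0 i * Y i j = (u *m Y) 0 j by rewrite mxE.
have -> : \sum_i nR 0 i * X i j = (nR *m X) 0 j by rewrite mxE.
by rewrite /u mulmxKV // mxE [in X in _ + X + _]mxE subrK mxE.
Qed.

End Coefficients.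

Lemma c_nm_scale (Om : 'M[C]_2) (n m n' m' : 'rV[int]_2) (c : C) :
  (forall j, v_nm Om n' m' j = c * v_nm Om n m j) ->
  forall k, c_nm Om n' m' k = c * c_nm Om n m k.
Proof.
move=> H k; rewrite /c_nm mulrCA; congr (_ * _); rewrite big_distrr /=.
by apply: eq_bigr => j _; rewrite mulrA -/(v_nm Om n m j) -H.
Qed.

(* Both parts of the theorem are instances: [s = M] for (+), [s = - (N2 + M)]
   for (-). *)
Lemma laplacian_eigen_omega_nm
    (cptT : compact [set: T]) (conT : connected [set: T])
    (alpha beta : 'I_2 -> chain1 R T) (symp : symplectic_basis S alpha beta)
    (w : 'I_2 -> one_form S) (hw : forall k, holo_form (w k))
    (wnorm : forall j k, period (w k) (alpha j) = (j == k)%:R)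
    (Om : 'M[C]_2) (OmE : Om = period_matrix w beta) (Omsym : Om^T = Om)
    (s N2 N3 : rat)
    (Omrel : Om 1 1 = ratr (s * N2 + s ^+ 2) * Om 0 0 + ratr N2 * Om 0 1 + ratr N3)
    (z0 : T) (s0 : s != 0) (n m n' m' : 'rV[int]_2) :
  (n 0 0, m 0 0) <> (0, 0) ->
  (n 0 1)%:~R = (n 0 0)%:~R / s ->
  (m 0 1)%:~R = (N2 + s) * (m 0 0)%:~R + N3 * (n 0 0)%:~R / s ->
  (n' 0 1)%:~R = (n' 0 0)%:~R / s ->
  (m' 0 1)%:~R = (N2 + s) * (m' 0 0)%:~R + N3 * (n' 0 0)%:~R / s ->
  let den (a b : int) : C := ratr s * b%:~R - a%:~R * (ratr s * Om 0 0 + Om 0 1) in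
  (exists c : C, proportional (omega_nm w Om n' m') (omega_nm w Om n m) c) /\
  laplacian_eigen (omega_nm w Om n m) (h_fun (omega_nm w Om n' m') z0)
    (2 * area (omega_nm w Om n m) *
      (`|den (n' 0 0) (m' 0 0)| ^+ 2 / `|den (n 0 0) (m 0 0)| ^+ 2)).
Proof.
move=> nm0 n1 m1 n1' m1' den.
have Yunit := Im_period_matrix_unit conT cptT symp hw wnorm OmE Omsym.
set Y := map_mx _ Om in Yunit.
have sC : ratr s != 0 :> C by rewrite fmorph_eq0.
have Om10 : Om 1 0 = Om 0 1 by rewrite -[in LHS]Omsym mxE.
have ImE : complex.Im (Om 1 1) =
    ratr (s * N2 + s ^+ 2) * complex.Im (Om 0 0) + ratr N2 * complex.Im (Om 0 1).
  by rewrite Omrel !ImD !Im_ratrM -[ratr N3]fmorph_ratR addr0.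
have vE (a b : 'rV[int]_2) : (a 0 1)%:~R = (a 0 0)%:~R / s ->
    (b 0 1)%:~R = (N2 + s) * (b 0 0)%:~R + N3 * (a 0 0)%:~R / s ->
    forall j, v_nm Om a b j =
      (if j == 0 then 1 else ratr (N2 + s)) * (conjc (den (a 0 0) (b 0 0)) / ratr s).
  move=> /(congr1 (fun x => ratr x : C)) a1 /(congr1 (fun x => ratr x : C)) b1 j.
  rewrite ?(ratr_int, rmorphD, rmorphM, fmorphV) /= in a1 b1.
  have cden : conjc (den (a 0 0) (b 0 0)) = ratr s * (b 0 0)%:~R -
      (a 0 0)%:~R * (ratr s * conjc (Om 0 0) + conjc (Om 0 1)).
    by rewrite /den !(conjcB, conjcM, conjcD, conj_ratr, conj_intr).
  have Om11 : conjc (Om 1 1) = (ratr s * ratr N2 + ratr s ^+ 2) * conjc (Om 0 0) +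
      ratr N2 * conjc (Om 0 1) + ratr N3.
    by rewrite Omrel !(conjcM, conjcD, conj_ratr) !(rmorphD, rmorphM).
  rewrite cden /v_nm sum2E a1.
  have [->|->] := ord2_cases j; first by rewrite Om10 eqxx; field.
  by rewrite /= b1 Om11; field.
have den0 : den (n 0 0) (m 0 0) != 0.
  apply/negP => /eqP d0.
  have [n0|n0] := eqVneq (n 0 0) 0.
    move/eqP: d0; rewrite /den n0 mul0r subr0 mulf_eq0 (negbTE sC) /= intr_eq0.
    by move=> /eqP m00; apply: nm0; rewrite n0 m00.
  have : complex.Im (den (n 0 0) (m 0 0)) = 0 by rewrite d0.
  have intE (k : int) : k%:~R = (ratr (k%:~R : rat)) :> C by rewrite ratr_int.
  rewrite /den ImB !intE Im_ratrM -fmorph_ratR /= mulr0 sub0r Im_ratrM.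
  rewrite ImD Im_ratrM ratr_int => /eqP; rewrite oppr_eq0 mulf_eq0 intr_eq0.
  rewrite (negbTE n0) /= => /eqP sY.
  (* The imaginary part of the denominator is - n_1 (s Y_11 + Y_12). Its vanishing kills the first
     entry of (s, 1) Y, and the second entry is N2 + s times the first by the relation for Om_22. *)
  pose v : 'rV[R]_2 := \row_j (if j == 0 then ratr s else 1).
  have vY : v *m Y = 0.
    apply/rowP => j; rewrite mxE sum2E !mxE /=.
    have y01 : complex.Im (Om 0 1) = - (ratr s * complex.Im (Om 0 0)).
      by apply/eqP; rewrite -addr_eq0 addrC sY.
    have [->|->] := ord2_cases j; first by rewrite Om10 mul1r.
    rewrite mul1r ImE y01 rmorphD rmorphM rmorphXn /=; ring.
  have : v = 0 by rewrite -(mulmxK Yunit v) vY mul0mx.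
  by move=> /rowP /(_ 1); rewrite !mxE /= => /eqP; rewrite oner_eq0.
pose c := conjc (den (n' 0 0) (m' 0 0)) / conjc (den (n 0 0) (m 0 0)).
have cden0 : conjc (den (n 0 0) (m 0 0)) != 0 by rewrite conjc_eq0.
have cE : forall k, c_nm Om n' m' k = c * c_nm Om n m k.
  apply: c_nm_scale => j; rewrite (vE _ _ n1' m1') (vE _ _ n1 m1) /c.
  by move: (if _ then _ else _) => q; field; rewrite cden0 sC.
have prop : proportional (omega_nm w Om n' m') (omega_nm w Om n m) c.
  move=> i p ip; rewrite /omega_nm big_distrr /=; apply: eq_bigr => k _.
  by rewrite cE mulrA.
split; first by exists c.
have -> : `|den (n' 0 0) (m' 0 0)| ^+ 2 / `|den (n 0 0) (m 0 0)| ^+ 2 = `|c| ^+ 2.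
  by rewrite /c normrM normfV exprMn exprVn !normE !nrm_conj.
apply: (laplacian_eigen_proportional z0 symp.1 conT _ prop).
  exact: (holo_lin_form hw (c_nm Om n' m')).
move=> k; case: (fintype.split k) => j.
  exists (n' 0 j); rewrite -(Im_c_nm Yunit n' m').
  by rewrite -[in RHS](period_a symp hw wnorm).
exists (m' 0 j); rewrite -(Im_c_nm_Om Omsym Yunit n' m').
by rewrite -(period_b symp hw OmE).
Qed.

End Genus2.

Theorem mainTheorem6 (R : realType) (T : topologicalType)
    (S : riemann_surface R T)
    (hT : hausdorff_space T) (cptT : compact [set: T])
    (conT : connected [set: T]) (genus2 : has_genus S 2)
    (alpha beta : 'I_2 -> chain1 R T)
    (symp : symplectic_basis S alpha beta)
    (w : 'I_2 -> one_form S) (wbasis : holo_basis w)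
    (wnorm : forall j k, period (w k) (alpha j) = (j == k)%:R)
    (Om : 'M[R[i]]_2) (OmE : Om = period_matrix w beta) (Omsym : Om^T = Om)
    (M N1 N2 N3 : rat)
    (Omrel : Om 1 1 = ratr N1 * Om 0 0 + ratr N2 * Om 0 1 + ratr N3)
    (N1E : N1 = M * N2 + M ^+ 2) (z0 : T) :
  (M != 0 ->
   forall n m n' m' : 'rV[int]_2,
     Gamma_plus M N2 N3 (n 0 0, m 0 0) ->
     Gamma_plus M N2 N3 (n' 0 0, m' 0 0) ->
     (n 0 0, m 0 0) <> (0, 0) ->
     (n 0 1)%:~R = (n 0 0)%:~R / M ->
     (m 0 1)%:~R = (N2 + M) * (m 0 0)%:~R + N3 * (n 0 0)%:~R / M ->
     (n' 0 1)%:~R = (n' 0 0)%:~R / M ->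
     (m' 0 1)%:~R = (N2 + M) * (m' 0 0)%:~R + N3 * (n' 0 0)%:~R / M ->
     let wnm := omega_nm w Om n m in
     let wnm' := omega_nm w Om n' m' in
     let den (a b : int) : R[i] :=
       ratr M * b%:~R - a%:~R * (ratr M * Om 0 0 + Om 0 1) in
     (exists c : R[i], proportional wnm' wnm c) /\
     laplacian_eigen wnm (h_fun wnm' z0)
       (2 * area wnm * (`|den (n' 0 0) (m' 0 0)| ^+ 2
                        / `|den (n 0 0) (m 0 0)| ^+ 2))) /\
  (N2 + M != 0 ->
   forall n m n' m' : 'rV[int]_2,
     Gamma_minus M N2 N3 (n 0 0, m 0 0) ->
     Gamma_minus M N2 N3 (n' 0 0, m' 0 0) ->
     (n 0 0, m 0 0) <> (0, 0) ->
     (n 0 1)%:~R = - ((n 0 0)%:~R / (N2 + M)) ->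
     (m 0 1)%:~R = - (M * (m 0 0)%:~R) - N3 * (n 0 0)%:~R / (N2 + M) ->
     (n' 0 1)%:~R = - ((n' 0 0)%:~R / (N2 + M)) ->
     (m' 0 1)%:~R = - (M * (m' 0 0)%:~R) - N3 * (n' 0 0)%:~R / (N2 + M) ->
     let wnm := omega_nm w Om n m in
     let wnm' := omega_nm w Om n' m' in
     let den (a b : int) : R[i] :=
       ratr (N2 + M) * b%:~R - a%:~R * (ratr (N2 + M) * Om 0 0 - Om 0 1) in
     (exists c : R[i], proportional wnm' wnm c) /\
     laplacian_eigen wnm (h_fun wnm' z0)
       (2 * area wnm * (`|den (n' 0 0) (m' 0 0)| ^+ 2
                        / `|den (n 0 0) (m 0 0)| ^+ 2))).

Proof.
have hw := wbasis.1; split=> [M0|Q0] n m n' m' _ _ nm0 n1 m1 n1' m1' wnm wnm' den.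
- have Omrel' : Om 1 1 = ratr (M * N2 + M ^+ 2) * Om 0 0 + ratr N2 * Om 0 1 + ratr N3.
    by rewrite -N1E.
  exact: (laplacian_eigen_omega_nm cptT conT symp hw wnorm OmE Omsym Omrel' z0 M0
    nm0 n1 m1 n1' m1').
(* The other root of s^2 + N2 s = N1, for which N2 + s = - M. *)
pose s := - (N2 + M).
have s0 : s != 0 by rewrite oppr_eq0.
have Omrel' : Om 1 1 = ratr (s * N2 + s ^+ 2) * Om 0 0 + ratr N2 * Om 0 1 + ratr N3.
  by rewrite Omrel N1E; congr (ratr _ * _ + _ + _); rewrite /s; ring.
have n_s (a b : int) : a%:~R = - (b%:~R / (N2 + M)) -> a%:~R = b%:~R / s.
  by move=> ->; rewrite /s invrN mulrN.
have m_s (a b k : int) : a%:~R = - (M * b%:~R) - N3 * k%:~R / (N2 + M) ->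
    a%:~R = (N2 + s) * b%:~R + N3 * k%:~R / s.
  by move=> ->; rewrite /s invrN; ring.
(* The two denominators are opposite, which the absolute value does not see. *)
have denN (a b : int) :
    `|den a b| = `|ratr s * b%:~R - a%:~R * (ratr s * Om 0 0 + Om 0 1)|.
  by rewrite -normrN /den /s rmorphN; congr `|_|; ring.
have := laplacian_eigen_omega_nm cptT conT symp hw wnorm OmE Omsym Omrel' z0 s0
  nm0 (n_s _ _ n1) (m_s _ _ _ m1) (n_s _ _ n1') (m_s _ _ _ m1').
by rewrite !denN.
Qed.
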